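(* Let $n\ge 1$ and let $E\subset S=\partial B^n\subset\mathbb{C}^n$ be a closed set. Then the following statements are equivalent: (a) $E$ satisfies the Uniform Hole Condition (with respect to $S$): there is $0<C<1$ such that for any $x\in S$ and any ball $B(x,r)$, $\sup\{d(y,E):\ y\in B(x,r)\cap S\}\ge C r$. (b) There is $s<n$ such that $(E,d)$ satisfies $\Sigma_s$: there is a constant $C=C(s)$ such that for any $x\in S$, $R>0$ and $0<\varepsilon<R$, $\sigma(B(x,R)\cap\{z\in S: d(z,E)<\varepsilon\})\le C R^s\varepsilon^{n-s}$. (c) $\Upsilon(E)<n$. (d) There are $a>0$ and $C>0$ such that for any $x\in S$ and $R>0$, $\int_{B(x,R)\cap S} d(z,E)^{-a}\,d\sigma(z)\le C R^{n-a}$. (e) There is $C>0$ such that for any $x\in S$ and $R>0$, $\int_{B(x,R)\cap S}\log\left(d(z,E)^{-1}\right)d\sigma(z)\le \sigma(B(x,R)\cap S)\log\frac1R + C R^n$. (f) There are $a<n$ and $C>0$ such that for any $x\in E$ and $R>0$, $\int_0^R N\left(x,\delta,\frac{R}{\delta}\right)\delta^{n-a}\frac{d\delta}{\delta}\le C R^{n-a}$. (g) There are $s<n$ and $C>0$ such that for any $x\in E$, $R>0$ and $0<\varepsilon<R$, $V(B(x,R)\cap\{z\in B^n: d(z,E)<\varepsilon\})\le C R^s\varepsilon^{n+1-s}$. (h) There is $a_0>1$ such that for any $a<a_0$ there is $C>0$ such that for any $x\in S$ and $R>0$, $\int_{B(x,R)\cap B^n} d(z,E)^{-a}\,dV(z)\le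 C R^{n+1-a}$.
   Context: $B^n$ is the open unit ball of $\mathbb{C}^n$, $S$ its boundary, $\sigma$ the normalized Lebesgue measure on $S$, $V$ the Lebesgue (volume) measure on $B^n$. For $x,y\in\overline{B^n}$, $x\bar y=\sum_j x_j\overline{y_j}$ and $d(x,y)=|1-x\bar y|$, which satisfies the triangle inequality up to a constant; $d(x,E)=\inf_{y\in E}d(x,y)$ and $B(x,R)=\{y\in\overline{B^n}: d(x,y)<R\}$. For $x\in E$, $R>0$, $k\ge1$, $N(x,R,k)$ is the maximum number of points of $E\cap B(x,kR)$ that are pairwise separated by $d$-distance greater than or equal to $R$. One says $E\in\Upsilon_\gamma$ if there is a constant $C(\gamma)$ such that $N(x,R,k)\le C(\gamma)k^\gamma$ for all $x\in E$ and all $0<R\le kR\le1$. The upper dimension is $\Upsilon(E)=\inf\{\gamma: E\in\Upsilon_\gamma\}$.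
   Formalization: In (a) radii are restricted to 0<r≤2 (for large r the inequality fails for every nonempty E); in (f) a<n is read as 0<a<n (for a<0 it holds even for E=S); in (h) a<a_0 is read as 0<a<a_0 (for a<0 it fails already for E a point). *)

(* Defs.v *)
From HB Require Import structures.
From mathcomp Require Import all_boot all_order all_algebra.
From mathcomp Require Import complex.
From mathcomp Require Import all_classical all_reals all_analysis.
From mathcomp Require Import measurable_realfun.

Set Implicit Arguments.
Unset Strict Implicit.
Unset Printing Implicit Defensive.

Import Order.TTheory GRing.Theory Num.Theory.
Import numFieldNormedType.Exports.

Local Open Scope classical_set_scope.
Local Open Scope ring_scope.

Section lebesgue_tuple.
Context (R : realType).
Local Notation R1 := (measurableTypeR R).

Definition tuple_cons k (p : R1 * k.-tuple R1) : k.+1.-tuple R1 :=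
  [tuple of p.1 :: p.2].

Lemma measurable_tuple_cons k :
  measurable_fun [set: R1 * k.-tuple R1] (@tuple_cons k).
Proof. exact: measurable_cons. Qed.

(* [\x^] rather than [\x]: its measure instance only needs the left factor to be
   sigma-finite. *)
Definition cons_measure k (mu : {measure set (k.-tuple R1) -> \bar R}) :
    set (k.+1.-tuple R1) -> \bar R :=
  pushforward (@lebesgue_measure R \x^ mu)%E (@tuple_cons k).

HB.instance Definition _ k (mu : {measure set (k.-tuple R1) -> \bar R}) :=
  Measure.copy (cons_measure mu)
    (measure_function_pushforward__canonical__measure_function_Measure
      [the {measure set _ -> \bar R} of (@lebesgue_measure R \x^ mu)%E]
      (@measurable_tuple_cons k)).

Fixpoint lebesgue_tuple k : {measure set (k.-tuple R1) -> \bar R} :=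
  match k with
  | 0%N => \d_([tuple] : 0.-tuple R1)
  | k'.+1 => cons_measure (lebesgue_tuple k')
  end.

End lebesgue_tuple.

(* The regular-module alias ^o gives the entries the norm topology of C, hence
   'rV the product topology. *)
Definition Cn (R : realType) (n : nat) : Type := 'rV[R[i]^o]_n.

HB.instance Definition _ (R : realType) (n : nat) :=
  PointedTopological.on (Cn R n).

Definition coords (R : realType) (n : nat) (z : Cn R n) :
    (n + n).-tuple (measurableTypeR R) :=
  [tuple match fintype.split j with
         | inl i => complex.Re (z ord0 i)
         | inr i => complex.Im (z ord0 i)
         end | j < n + n].

(* The sigma-algebra making the 2n real coordinates measurable, i.e. the Borel
   sigma-algebra of C^n = R^(2n). *)
HB.instance Definition _ (R : realType) (n : nat) :=
  Measurable.copy (Cn R n) (g_sigma_algebra_preimageType (@coords R n)).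

Section volume.
Context (R : realType) (n : nat).
Local Notation R1 := (measurableTypeR R).

Definition of_coords (t : (n + n).-tuple R1) : Cn R n :=
  \row_j Complex (tnth t (lshift n j)) (tnth t (rshift n j)).

Lemma of_coordsK : cancel of_coords (@coords R n).
Proof.
move=> t; apply: eq_from_tnth => j; rewrite tnth_mktuple.
by case: fintype.splitP => i ji; rewrite mxE /=; congr tnth; apply/val_inj.
Qed.

Lemma measurable_of_coords :
  measurable_fun [set: (n + n).-tuple R1] of_coords.
Proof.
move=> _ _ [B mB <-]; rewrite !setTI -comp_preimage.
rewrite (_ : _ \o _ = id); last by apply/funext => t /=; rewrite of_coordsK.
by rewrite preimage_id.
Qed.

Definition volume : set (Cn R n) -> \bar R :=
  pushforward (@lebesgue_tuple R (n + n)) of_coords.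

HB.instance Definition _ := Measure.copy volume
  (measure_function_pushforward__canonical__measure_function_Measure
    (@lebesgue_tuple R (n + n)) measurable_of_coords).

End volume.
Arguments volume {R n}.

Section ball_geometry.
Context (R : realType) (n : nat).
Implicit Types (x y z : Cn R n) (E : set (Cn R n)) (r k : R).

Definition herm x y : R[i] := \sum_j x ord0 j * conjc (y ord0 j).

Definition enorm z : R := Num.sqrt (complex.Re (herm z z)).

Definition unit_ball : set (Cn R n) := [set z | enorm z < 1].
Definition unit_sphere : set (Cn R n) := [set z | enorm z = 1].

(* An honest quasi-distance only on the closed unit ball. *)
Definition dist x y : R := Normc.normc (1 - herm x y).

Definition dball x r : set (Cn R n) := [set y | enorm y <= 1 /\ dist x y < r].

(* Extended-real valued: a point is at distance +oo from the empty set. *)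
Definition dist_set x E : \bar R := ereal_inf [set (dist x y)%:E | y in E].

(* z / |z|, with value 0 at z = 0. *)
Definition radial z : Cn R n :=
  \row_j ((real_complex R (enorm z)^-1) * z ord0 j).

(* Normalized surface measure of the sphere by polar coordinates: sigma(A) is the
   proportion of the volume of the unit ball lying on radii through A. It is
   carried by the whole of C^n and concentrated on the sphere; for n >= 1 the
   value of [radial] at 0 is irrelevant. *)
Definition sigma (A : set (Cn R n)) : \bar R :=
  ((fine (volume unit_ball))^-1%:E * volume (radial @^-1` A `&` unit_ball))%E.

Lemma measurable_coord (j : 'I_n) :
  measurable_fun [set: Cn R n] (fun z => complex.Re (z ord0 j)) /\
  measurable_fun [set: Cn R n] (fun z => complex.Im (z ord0 j)).
Proof.
have mc : measurable_fun [set: Cn R n] (@coords R n).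
  by move=> _ B mB; exists B.
split.
- rewrite (_ : (fun z => _) = (@tnth _ _)^~ (lshift n j) \o @coords R n).
    by apply: measurableT_comp mc; exact: measurable_tnth.
  by apply/funext => z; rewrite /= tnth_mktuple; case: fintype.splitP => i /= ji;
    [congr (complex.Re (z _ _)); apply/val_inj
    |move: (ltn_ord j); rewrite ji ltnNge leq_addr].
- rewrite (_ : (fun z => _) = (@tnth _ _)^~ (rshift n j) \o @coords R n).
    by apply: measurableT_comp mc; exact: measurable_tnth.
  by apply/funext => z; rewrite /= tnth_mktuple; case: fintype.splitP => i /= ji;
    [move: (ltn_ord i); rewrite -ji ltnNge leq_addr
    |congr (complex.Im (z _ _)); apply/val_inj/eqP; rewrite -(eqn_add2l n) ji].
Qed.

Lemma Re_herm z :
  complex.Re (herm z z) =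
  \sum_j (complex.Re (z ord0 j) ^+ 2 + complex.Im (z ord0 j) ^+ 2).
Proof.
rewrite /herm (big_morph (@complex.Re R) (id1 := 0) (op1 := +%R)) //.
  by apply: eq_bigr => j _; case: (z ord0 j) => a b /=; rewrite mulrN opprK !expr2.
by move=> [a b] [c d].
Qed.

Lemma measurable_enorm : measurable_fun [set: Cn R n] enorm.
Proof.
rewrite (_ : enorm = (fun a => a `^ 2^-1) \o
    (fun z => \sum_j (complex.Re (z ord0 j) ^+ 2 + complex.Im (z ord0 j) ^+ 2))).
  apply: measurableT_comp; first exact: measurable_powR.
  apply: measurable_sum => j; have [mRe mIm] := measurable_coord j.
  by apply: measurable_funD; exact: measurable_funX.
apply/funext => z; rewrite /enorm Re_herm /= powR12_sqrt//.
by apply: sumr_ge0 => j _; rewrite addr_ge0 ?sqr_ge0.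
Qed.

Lemma measurable_unit_ball : measurable unit_ball.
Proof.
rewrite (_ : unit_ball = setT `&` enorm @^-1` `]-oo, 1[).
  exact: measurable_enorm.
by rewrite setTI; apply/seteqP; split => z /=; rewrite in_itv.
Qed.

Lemma measurable_radial : measurable_fun [set: Cn R n] radial.
Proof.
move=> _ _ [B mB <-]; rewrite !setTI -comp_preimage -[X in measurable X]setTI.
suff : measurable_fun [set: Cn R n] (@coords R n \o radial) by exact.
have minv : measurable_fun [set: Cn R n] (fun z => (enorm z)^-1).
  rewrite (_ : (fun z => _) = (fun a => a `^ (-1)) \o enorm).
    apply: measurableT_comp; [exact: measurable_powR|exact: measurable_enorm].
  by apply/funext => z; rewrite /= powR_inv1// sqrtr_ge0.
apply/measurable_fun_tnthP => j.
rewrite [X in measurable_fun _ X](_ : _ = fun z => (enorm z)^-1 *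
    match fintype.split j with
    | inl i => complex.Re (z ord0 i)
    | inr i => complex.Im (z ord0 i)
    end).
  apply: measurable_funM => //.
  by case: fintype.splitP => i _; have [] := measurable_coord i.
apply/funext => z; rewrite /= tnth_mktuple.
by case: fintype.split => i; rewrite mxE; case: (z ord0 i) => a b /=;
  rewrite !mul0r ?subr0 ?addr0.
Qed.

Let inv_volume_ge0 : 0 <= (fine (volume unit_ball))^-1.
Proof. by rewrite invr_ge0 fine_ge0. Qed.

HB.instance Definition _ := Measure.copy sigma
  (measure_function_pushforward__canonical__measure_function_Measure
    [the {measure set (Cn R n) -> \bar R} of
      mscale (NngNum inv_volume_ge0) (mrestr volume measurable_unit_ball)]
    measurable_radial).

End ball_geometry.
Arguments sigma {R n}.
Arguments unit_ball {R n}.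
Arguments unit_sphere {R n}.

Section dimension.
Context (R : realType) (n : nat).
Implicit Types (x y z : Cn R n) (E : set (Cn R n)) (r k g s C : R).

(* N(x, r, k): the supremum, in the extended reals, of the cardinalities of the
   finite r-separated subsets of E in the ball; it is a maximum when finite. *)
Definition separated_count E x r k : \bar R :=
  ereal_sup [set (size p)%:R%:E | p in
    [set p : seq (Cn R n) | [/\ uniq p,
       {in p, forall y, (E `&` dball x (k * r)) y} &
       {in p &, forall y z, y != z -> r <= dist y z}]]].

(* [r <= k * r] encodes k >= 1. *)
Definition Upsilon_class g E : Prop :=
  exists C, forall x r k, E x -> 0 < r -> r <= k * r -> k * r <= 1 ->
    (separated_count E x r k <= (C * k `^ g)%:E)%E.

(* The infimum is taken over all real exponents, so that the empty set has upper
   dimension -oo; for nonempty E only g >= 0 can occur. *)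
Definition upper_dimension E : \bar R :=
  ereal_inf [set g%:E | g in [set g | Upsilon_class g E]].

Definition Sigma_condition s E : Prop :=
  exists C, forall x r eps, unit_sphere x -> 0 < r -> 0 < eps -> eps < r ->
    (sigma (dball x r `&` [set z | unit_sphere z /\ (dist_set z E < eps%:E)%E])
     <= (C * r `^ s * eps `^ (n%:R - s))%:E)%E.

(* Radii are bounded by 2, the d-diameter of the sphere: larger balls add nothing
   as sets, and the inequality would fail for large r. *)
Definition uniform_hole_condition E : Prop :=
  exists C, [/\ 0 < C, C < 1 &
    forall x r, unit_sphere x -> 0 < r -> r <= 2 ->
      ((C * r)%:E <= ereal_sup
         [set dist_set y E | y in dball x r `&` unit_sphere])%E].

End dimension.

(* Main.v *)
Require Import Defs.
From HB Require Import structures.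
From mathcomp Require Import all_boot all_order all_algebra.
From mathcomp Require Import complex.
From mathcomp Require Import all_classical all_reals all_analysis.
From mathcomp Require Import measurable_realfun.
From mathcomp Require Import ring lra.

Set Implicit Arguments.
Unset Strict Implicit.
Unset Printing Implicit Defensive.

Import Order.TTheory GRing.Theory Num.Theory.
Import numFieldNormedType.Exports.

Local Open Scope classical_set_scope.
Local Open Scope ring_scope.

(** All the conditions are compared with one counting bound: for some g < n, an
    e-separated subset of E in a ball of radius r >= e about a point of E has at
    most K (r / e)^g elements ([counting_condition]). Three facts about the
    geometry make the comparison work.

    First, the square root rho of d satisfies the triangle inequality on the closed
    ball ([rho_triangle]), so balls of radius e / 4 about e-separated points are
    disjoint, and maximal separated sets are nets.

    Secondly, the surface measure and the volume are regular: a ball of radius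
    r <= 2 about a point of the sphere has measure comparable to r^n, respectively
    r^(n+1). The volume is invariant under unitary maps because a translation
    invariant measure is unique up to a factor ([haar_exchange],
    [volume_isometry]); so the centre may be taken to be e1, where balls, and cones
    over caps, lie between explicit boxes ([sigma_dball_le], [sigma_dball_ge],
    [volume_dball_le], [volume_dball_ge]). As the same arguments serve the sphere
    with exponent n and the ball with exponent n + 1, they are stated for any
    measure with this regularity ([ahlfors_regular]).

    Thirdly, counting and measuring are then equivalent: disjoint small balls turn
    a bound on the measure of the e-neighbourhoods of E into a counting bound
    ([counting_of_tube]), covering by balls about a net gives the converse
    ([tube_of_counting]), and summing over dyadic shells, or Chebyshev's
    inequality, exchanges the measures of neighbourhoods for integrals of negative
    powers of the distance ([layer_integral], [chebyshev_neg_power]). This settles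
    the conditions on neighbourhoods, on power integrals, on the upper dimension
    and on the integral of the counting function.

    The hole condition enters in two ways. If every cap contains a hole of
    comparable size, the e-neighbourhood of E loses a fixed proportion of its mass
    whenever e is multiplied by a fixed factor, because the holes about the points
    of a net are disjoint and of total mass comparable to that of the smaller
    neighbourhood ([tube_le_holes]); iterating gives power decay ([porous_tube]).
    Conversely, a power integral bounds the logarithmic integral, as
    ln (1/f) <= ln (1/r) + (r/f)^a / a ([log_le_neg_power]), and the logarithmic
    bound forbids a cap of radius r all of whose points are within c r of E when
    ln (1/c) is large ([log_hole]). *)

(** * The nonisotropic metric on the closed ball *)

Section hermitian.
Context (R : realType) (n : nat).
Implicit Types (x y z u v w : Cn R n) (a b c : R[i]) (r s t : R).
Local Notation normc := Normc.normc.

Lemma normc_sqr a : normc a ^+ 2 = complex.Re a ^+ 2 + complex.Im a ^+ 2.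
Proof. by case: a => p q /=; rewrite sqr_sqrtr// addr_ge0 ?sqr_ge0. Qed.

Lemma normc_ge0 a : 0 <= normc a.
Proof. by case: a => p q; rewrite sqrtr_ge0. Qed.

Lemma normc_conj a : normc (conjc a) = normc a.
Proof. by case: a => p q /=; rewrite sqrrN. Qed.

Lemma mulc_conj a : a * conjc a = (normc a ^+ 2)%:C%C.
Proof.
rewrite normc_sqr; case: a => p q /=.
by apply/eqP; rewrite eq_complex /= !expr2 !mulrN opprK (mulrC p q) addNr !eqxx.
Qed.

Lemma Re_le_normc a : `|complex.Re a| <= normc a.
Proof.
rewrite -(@ler_pXn2r _ 2) ?nnegrE ?normc_ge0 ?normr_ge0//.
by rewrite normc_sqr real_normK ?num_real// lerDl sqr_ge0.
Qed.

Lemma Im_le_normc a : `|complex.Im a| <= normc a.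
Proof.
rewrite -(@ler_pXn2r _ 2) ?nnegrE ?normc_ge0 ?normr_ge0//.
by rewrite normc_sqr real_normK ?num_real// lerDr sqr_ge0.
Qed.

Lemma normc_le_ReIm a : normc a <= `|complex.Re a| + `|complex.Im a|.
Proof.
rewrite -(@ler_pXn2r _ 2) ?nnegrE ?normc_ge0 ?addr_ge0//.
rewrite normc_sqr sqrrD !real_normK ?num_real//.
by rewrite addrAC lerDl mulrn_wge0// mulr_ge0.
Qed.

Lemma normc_real r : normc (r%:C%C) = `|r|.
Proof. by rewrite /= expr0n/= addr0 sqrtr_sqr. Qed.

(** Projections along a line and reflections are both of this shape. *)
Definition subv x a u : Cn R n := \row_j ((x ord0 j : R[i]) - a * u ord0 j).

Lemma herm_conj x y : herm y x = conjc (herm x y).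
Proof.
rewrite /herm rmorph_sum/=; apply: eq_bigr => j _.
by rewrite rmorphM/= conjcK mulrC.
Qed.

Lemma herm_subl x a u z : herm (subv x a u) z = herm x z - a * herm u z.
Proof.
rewrite /herm mulr_sumr -sumrB; apply: eq_bigr => j _.
by rewrite mxE mulrBl mulrA.
Qed.

Lemma herm_subr x a u z : herm z (subv x a u) = herm z x - conjc a * herm z u.
Proof. by rewrite herm_conj herm_subl rmorphB/= rmorphM/= -!herm_conj. Qed.

Lemma herm_self x : herm x x = (enorm x ^+ 2)%:C%C.
Proof.
have h : complex.Im (herm x x) = 0.
  by have := herm_conj x x; case: (herm x x) => p q /= [] /eqP; rewrite -addr_eq0 -mulr2n mulrn_eq0/= => /eqP.
have h0 : 0 <= complex.Re (herm x x).
  by rewrite Re_herm; apply: sumr_ge0 => j _; rewrite addr_ge0 ?sqr_ge0.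
by rewrite /enorm sqr_sqrtr//; case: (herm x x) h => p q /= ->.
Qed.

Lemma enorm_ge0 x : 0 <= enorm x. Proof. exact: sqrtr_ge0. Qed.

Lemma enorm_sqr x :
  enorm x ^+ 2 = \sum_j (complex.Re (x ord0 j) ^+ 2 + complex.Im (x ord0 j) ^+ 2).
Proof.
rewrite -Re_herm /enorm sqr_sqrtr// Re_herm.
by apply: sumr_ge0 => j _; rewrite addr_ge0 ?sqr_ge0.
Qed.

Lemma enorm_eq0 x : enorm x = 0 -> forall j, x ord0 j = 0.
Proof.
move=> /(congr1 (fun t => t ^+ 2)); rewrite enorm_sqr expr0n/= => /eqP.
rewrite psumr_eq0; last by move=> i _; rewrite addr_ge0 ?sqr_ge0.
move=> /allP x0 j; move: (x0 j (mem_index_enum _)) => /=.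
rewrite paddr_eq0 ?sqr_ge0// !sqrf_eq0; case: (x ord0 j) => p q /=.
by move=> /andP[/eqP-> /eqP->].
Qed.

Lemma herm_radial x y : herm (radial x) y = ((enorm x)^-1)%:C%C * herm x y.
Proof. by rewrite /herm mulr_sumr; apply: eq_bigr => j _; rewrite mxE mulrA. Qed.

Lemma herm_radialr x y : herm y (radial x) = ((enorm x)^-1)%:C%C * herm y x.
Proof.
rewrite herm_conj herm_radial (herm_conj x y) rmorphM; congr (_ * _).
exact: conjc_real.
Qed.

Lemma enorm_radial x : enorm x != 0 -> enorm (radial x) = 1.
Proof.
move=> x0; have : herm (radial x) (radial x) = 1%:C%C.
  rewrite herm_radial herm_radialr herm_self -!rmorphM mulrA -expr2 -exprMn.
  by rewrite mulVf// expr1n.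
rewrite herm_self => /(@complexI R)/eqP; rewrite sqrf_eq1 => /predU1P[//|/eqP h].
by have := enorm_ge0 (radial x); rewrite h oppr_ge0 ler10.
Qed.

(** Removing the component along a unit vector is an orthogonal projection. *)
Lemma enorm_proj_sqr x u : enorm u = 1 ->
  enorm (subv x (herm x u) u) ^+ 2 = enorm x ^+ 2 - normc (herm x u) ^+ 2.
Proof.
move=> u1; apply: (@complexI R); rewrite -herm_self rmorphB/=.
rewrite herm_subl !herm_subr !herm_self u1 expr1n.
rewrite (herm_conj x u) -[RHS]/(_ - (normc (herm x u) ^+ 2)%:C%C) -mulc_conj.
by rewrite mulr1 subrr mulr0 subr0 mulrC.
Qed.

(** The squared norm of |y|^2 x - <x, y> y is |y|^2 times the difference of the
    two squared sides. *)
Lemma cauchy_schwarz x y : normc (herm x y) <= enorm x * enorm y.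
Proof.
rewrite -(@ler_pXn2r _ 2) ?nnegrE ?normc_ge0 ?mulr_ge0 ?enorm_ge0//.
have key : enorm (subv (subv x (1 - (enorm y ^+ 2)%:C%C) x) (herm x y) y) ^+ 2 =
   enorm y ^+ 2 * ((enorm x * enorm y) ^+ 2 - normc (herm x y) ^+ 2).
  set B := (enorm y ^+ 2)%:C%C.
  apply: (@complexI R); rewrite -herm_self.
  have -> : (enorm y ^+ 2 * ((enorm x * enorm y) ^+ 2 - normc (herm x y) ^+ 2))%:C%C
      = B * ((enorm x ^+ 2)%:C%C * B - (normc (herm x y) ^+ 2)%:C%C).
    by rewrite /B exprMn !(rmorphM, rmorphB).
  have hyy : herm y y = B by exact: herm_self.
  rewrite -(mulc_conj (herm x y)) !(herm_subl, herm_subr) hyy herm_self.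
  have -> : conjc (1 - B) = 1 - B by rewrite rmorphB/= oppr0.
  rewrite (herm_conj x y); set a := herm x y; set A := (enorm x ^+2)%:C%C.
  ring.
have [y0|y0] := eqVneq (enorm y) 0.
  have -> : herm x y = 0.
    by rewrite /herm big1// => j _; rewrite (enorm_eq0 y0)/= oppr0 mulr0.
  by rewrite y0 mulr0 Normc.normc0.
rewrite -subr_ge0 -(pmulr_rge0 _ (_ : 0 < enorm y ^+ 2)) -?key ?sqr_ge0//.
by rewrite exprn_gt0// lt_neqAle eq_sym y0 enorm_ge0.
Qed.
End hermitian.

Section rho.
Context (R : realType) (n : nat).
Implicit Types (x y z u v w : Cn R n) (a b c : R[i]) (r s t : R).
Local Notation normc := Normc.normc.

Lemma dist_ge0 x y : 0 <= dist x y. Proof. exact: normc_ge0. Qed.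

Lemma distC x y : dist x y = dist y x.
Proof. by rewrite /dist (herm_conj y x) -[RHS]normc_conj rmorphB rmorph1. Qed.

Lemma dist_le2 x y : enorm x <= 1 -> enorm y <= 1 -> dist x y <= 2.
Proof.
move=> x1 y1; apply: (le_trans (le_normcD _ _)).
have -> : normc (1 : R[i]) = 1 by rewrite Normc.normc1.
rewrite normcN -[leRHS]/(1 + 1) lerD2l (le_trans (cauchy_schwarz _ _))//.
by rewrite mulr_ile1 ?enorm_ge0.
Qed.

Lemma dist_self x : enorm x = 1 -> dist x x = 0.
Proof. by move=> x1; rewrite /dist herm_self x1 expr1n subrr Normc.normc0. Qed.

(** The disc version of the quasi-triangle inequality: the middle point r of
    the segment [0, 1] is moved through the pseudo-hyperbolic inequality
    |r - b| <= |1 - r b|. *)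
Lemma disc_triangle r a b : 0 <= r -> r <= 1 -> normc a <= 1 -> normc b <= 1 ->
  normc (1 - a * conjc b) <= normc (1 - a * r%:C%C) + normc (1 - b * r%:C%C).
Proof.
move=> r0 r1 a1 b1.
have -> : 1 - a * conjc b = (1 - a * r%:C%C) + a * (r%:C%C - conjc b) by ring.
apply: (le_trans (le_normcD _ _)); rewrite lerD2l Normc.normcM.
have h : normc (r%:C%C - conjc b) <= normc (1 - b * r%:C%C).
  rewrite -(@ler_pXn2r _ 2) ?nnegrE ?normc_ge0// !normc_sqr.
  have : normc b ^+ 2 <= 1 by rewrite exprn_ile1// normc_ge0.
  rewrite normc_sqr; case: b {b1} => p q /=.
  have r21 : r ^+ 2 <= 1 by rewrite exprn_ile1.
  move=> b1; rewrite -subr_ge0 [leRHS](_ : _ = (1 - r ^+ 2) * (1 - (p ^+ 2 + q ^+ 2))).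
    by rewrite mulr_ge0// subr_ge0.
  by ring.
by rewrite (le_trans _ h)// ler_piMl// normc_ge0.
Qed.

(** Orthogonal splitting along the middle point y = r u: the components along u
    are controlled by the disc inequality, and the components orthogonal to u
    have squared norms at most 2 d(x, y) and 2 d(y, z). *)
Lemma dist_triangle x y z : enorm x <= 1 -> enorm y <= 1 -> enorm z <= 1 ->
  dist x z <= (Num.sqrt (dist x y) + Num.sqrt (dist y z)) ^+ 2.
Proof.
move=> x1 y1 z1; have d0 := @dist_ge0.
have sq t : 0 <= t -> Num.sqrt t ^+ 2 = t by move=> t0; rewrite sqr_sqrtr.
have [r0|r0] := eqVneq (enorm y) 0.
  have yz w : herm w y = 0.
    by rewrite /herm big1// => j _; rewrite (enorm_eq0 r0)/= oppr0 mulr0.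
  rewrite (distC y) /dist !yz subr0 Normc.normc1 sqrtr1.
  by apply: (le_trans (dist_le2 x1 z1)); rewrite -(natrD _ 1 1) expr2; lra.
set r := enorm y; pose u := radial y.
have u1 : enorm u = 1 by exact: enorm_radial.
have hu w : herm w y = herm w u * r%:C%C.
  by rewrite herm_radialr mulrAC -rmorphM mulVf// mul1r.
set a := herm x u; set b := herm z u.
have dxy : dist x y = normc (1 - a * r%:C%C) by rewrite /dist hu.
have dyz : dist y z = normc (1 - b * r%:C%C) by rewrite distC /dist hu.
have le1 w : enorm w <= 1 -> normc (herm w u) <= 1.
  by move=> w1; apply: (le_trans (cauchy_schwarz _ _)); rewrite u1 mulr1.
have orth w : enorm w <= 1 ->
    enorm (subv w (herm w u) u) ^+ 2 <= 2 * normc (1 - herm w u * r%:C%C).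
  move=> w1; rewrite enorm_proj_sqr//.
  have w2 : enorm w ^+ 2 <= 1 by rewrite exprn_ile1// enorm_ge0.
  set t := normc (herm w u); have t0 : 0 <= t by exact: normc_ge0.
  have t1 : t <= 1 by exact: le1.
  have : 1 <= normc (1 - herm w u * r%:C%C) + t * r.
    have <- : normc (herm w u * r%:C%C) = t * r.
      by rewrite Normc.normcM normc_real ger0_norm ?enorm_ge0.
    have := le_normcD (1 - herm w u * r%:C%C) (herm w u * r%:C%C).
    by rewrite subrK Normc.normc1.
  have : t * r <= t by rewrite ler_piMr.
  by nra.
have h1 : normc (1 - a * conjc b) <= dist x y + dist y z.
  by rewrite dxy dyz; apply: disc_triangle => //; [exact: enorm_ge0|exact: le1|exact: le1].
have h2 : normc (herm x z - a * conjc b) <= 2 * (Num.sqrt (dist x y) * Num.sqrt (dist y z)).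
  have -> : herm x z - a * conjc b = herm (subv x a u) (subv z b u).
    rewrite herm_subl !herm_subr herm_self u1 expr1n mulr1 (herm_conj z u) -/b.
    by rewrite subrr mulr0 subr0 mulrC.
  apply: (le_trans (cauchy_schwarz _ _)).
  rewrite -(@ler_pXn2r _ 2) ?nnegrE ?mulr_ge0 ?enorm_ge0 ?sqrtr_ge0//.
  rewrite 3!exprMn (sq (dist x y))// (sq (dist y z))//.
  rewrite [leRHS](_ : _ = (2 * dist x y) * (2 * dist y z)); last by ring.
  apply: ler_pM; rewrite ?sqr_ge0//.
    by rewrite dxy; apply: orth.
  by rewrite dyz; apply: orth.
have -> : dist x z = normc ((1 - a * conjc b) - (herm x z - a * conjc b)).
  by rewrite /dist; congr normc; ring.
apply: (le_trans (le_normcD _ _)); rewrite normcN.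
rewrite sqrrD !sq// addrAC -mulr_natl.
by apply: lerD.
Qed.

(** Unlike the distance itself, its square root satisfies the triangle inequality
    without a constant; radii are added in rho and converted by squaring. *)
Definition rho x y := Num.sqrt (dist x y).

Lemma rho_ge0 x y : 0 <= rho x y. Proof. exact: sqrtr_ge0. Qed.

Lemma rho_sqr x y : rho x y ^+ 2 = dist x y.
Proof. by rewrite sqr_sqrtr ?dist_ge0. Qed.

Lemma rhoC x y : rho x y = rho y x. Proof. by rewrite /rho distC. Qed.

Lemma rho_triangle x y z : enorm x <= 1 -> enorm y <= 1 -> enorm z <= 1 ->
  rho x z <= rho x y + rho y z.
Proof.
move=> x1 y1 z1; rewrite -(@ler_pXn2r _ 2) ?nnegrE ?addr_ge0 ?rho_ge0//.
by rewrite rho_sqr dist_triangle.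
Qed.

Lemma dist_lt_sqr x y t : 0 <= t -> (dist x y < t ^+ 2) = (rho x y < t).
Proof. by move=> t0; rewrite -rho_sqr ltr_pXn2r ?nnegrE ?rho_ge0. Qed.

Lemma dist_ge_sqr x y t : 0 <= t -> (t ^+ 2 <= dist x y) = (t <= rho x y).
Proof. by move=> t0; rewrite -rho_sqr ler_pXn2r ?nnegrE ?rho_ge0. Qed.

End rho.

(** * Lebesgue measure on tuples *)

Section lebesgue_translation.
Context (R : realType).
Local Notation R1 := (measurableTypeR R).
Local Notation mu := (@lebesgue_measure R).

Lemma measurable_add_const (w : R) : measurable_fun [set: R1] (fun t : R1 => t + w : R1).
Proof.
apply: (@measurable_funD _ R1 R setT idfun (cst w)).
  exact: measurable_id.
exact: measurable_cst.
Qed.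

(** Translated intervals have the same length, and the measure is determined by
    the lengths of intervals. *)
Lemma lebesgue_measure_translate (w : R) (A : set R1) : measurable A ->
  mu ((fun t : R1 => t + w : R1) @^-1` A) = mu A.
Proof.
move=> mA; have mw := measurable_add_const w.
pose nu := measure_function_pushforward__canonical__measure_function_Measure mu mw.
suff h X : ocitv X -> mu X = nu X.
  exact: esym (@lebesgue_measure_unique R nu h A mA).
move=> [[a b] /= _ <-]; rewrite /nu /= /pushforward.
rewrite (_ : _ @^-1` _ = `]a - w, b - w]%classic); last first.
  by apply/seteqP; split=> t /=; rewrite !in_itv/= ltrBlDr lerBrDr.
by rewrite !lebesgue_measure_itv/= !lte_fin ltrD2r -!EFinD opprD opprK addrACA addNr addr0.
Qed.
End lebesgue_translation.

Section tuple_measure.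
Context (R : realType).
Local Notation R1 := (measurableTypeR R).
Local Notation mu := (@lebesgue_measure R).

(** Fubini's theorem in the form of the definition: integrate over the first
    entry, for each value of the others. *)
Lemma lebesgue_tupleS k (A : set (k.+1.-tuple R1)) :
  lebesgue_tuple R k.+1 A =
  (\int[lebesgue_tuple R k]_t mu [set a : R1 | A (tuple_cons (a, t))])%E.
Proof.
rewrite /= /cons_measure /pushforward /product_measure2.
by apply: eq_integral => t _ /=; congr (mu _); rewrite /ysection; apply/seteqP; split=> a /=; rewrite inE.
Qed.

Definition tuple_shift k (w t : k.-tuple R1) : k.-tuple R1 :=
  [tuple tnth t i + tnth w i | i < k].

Lemma measurable_tuple_shift k (w : k.-tuple R1) :
  measurable_fun setT (tuple_shift w).
Proof.
apply/measurable_fun_tnthP => i.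
rewrite (_ : _ \o _ = (fun t : R1 => t + tnth w i : R1) \o @tnth k R1 ^~ i).
  by apply: measurableT_comp; [exact: measurable_add_const|exact: measurable_tnth].
by apply/funext => t /=; rewrite tnth_mktuple.
Qed.

(** Translate the sections by the first entry of w, then the outer variable by
    the remaining ones. *)
Lemma lebesgue_tuple_translate k (w : k.-tuple R1) (A : set (k.-tuple R1)) :
  measurable A -> lebesgue_tuple R k (tuple_shift w @^-1` A) = lebesgue_tuple R k A.
Proof.
elim: k w A => [|k ih] w A mA.
  by congr (lebesgue_tuple R 0 _); apply/seteqP; split=> t; rewrite (tuple0 t) /= (tuple0 (tuple_shift _ _)).
pose w' : k.-tuple R1 := [tuple of behead w].
have shE a t : tuple_shift w (tuple_cons (a, t)) = tuple_cons (a + thead w, tuple_shift w' t).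
  apply: eq_from_tnth => i; rewrite tnth_mktuple.
  case: (unliftP ord0 i) => [j ->|->].
    rewrite !tnthS tnth_mktuple; congr (_ + _).
    by rewrite /w' tnth_behead; congr tnth; apply/val_inj; rewrite /= inordK// ltnS.
  by rewrite !tnth0.
pose g (t : k.-tuple R1) : \bar R := mu [set a : R1 | A (tuple_cons (a, t))].
have mcA : measurable (@tuple_cons R k @^-1` A).
  by rewrite -[X in measurable X]setTI; exact: measurable_tuple_cons.
have secE t : [set a : R1 | A (tuple_cons (a, t))] = ysection (@tuple_cons R k @^-1` A) t.
  by rewrite /ysection; apply/seteqP; split=> a /=; rewrite inE.
have mg : measurable_fun setT g.
  rewrite (_ : g = mu \o ysection (@tuple_cons R k @^-1` A)).
    by apply: measurable_fun_ysection; rewrite ?inE.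
  by apply/funext => t; rewrite /g secE.
rewrite !lebesgue_tupleS.
transitivity (\int[lebesgue_tuple R k]_t (g \o tuple_shift w') t)%E.
  apply: eq_integral => t _ /=; rewrite /g.
  rewrite -(@lebesgue_measure_translate _ (thead w) [set a | A (tuple_cons (a, tuple_shift w' t))]).
    by congr (mu _); apply/seteqP; split=> a /=; rewrite shE.
  by rewrite secE; exact: measurable_ysection.
pose nu := measure_function_pushforward__canonical__measure_function_Measure
  (lebesgue_tuple R k) (measurable_tuple_shift w').
transitivity (\int[nu]_t g t)%E; last first.
  by apply: eq_measure_integral => B mB _; exact: ih.
rewrite (ge0_integral_pushforward (measurable_tuple_shift w'))//.
Qed.

Definition tuple_box k (c h : 'I_k -> R) : set (k.-tuple R1) :=
  [set t | forall i, `|tnth t i - c i| <= h i].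

Lemma itv_distrE (c h : R) : [set a : R1 | `|a - c| <= h] = `[c - h, c + h]%classic.
Proof.
apply/seteqP; split=> a /=; rewrite in_itv/= ler_distl; by [].
Qed.

Lemma measurable_tuple_box k (c h : 'I_k -> R) : measurable (tuple_box c h).
Proof.
rewrite (_ : tuple_box c h =
    \bigcap_(i in [set: 'I_k]) (@tnth k R1 ^~ i @^-1` [set a : R1 | `|a - c i| <= h i])).
  apply: fin_bigcap_measurable; first exact: finite_finset.
  move=> i _; rewrite itv_distrE -[X in measurable X]setTI.
  by apply: measurable_tnth => //; exact: measurable_itv.
by apply/seteqP; split=> t /=; [move=> H i _|move=> H i]; exact: H.
Qed.

Lemma lebesgue_tuple_box k (c h : 'I_k -> R) : (forall i, 0 <= h i) ->
  lebesgue_tuple R k (tuple_box c h) = (\prod_i (2 * h i))%:E.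
Proof.
elim: k c h => [|k ih] c h h0.
  by rewrite big_ord0 /= diracE mem_set// => -[].
rewrite lebesgue_tupleS big_ord_recl.
pose c' i := c (lift ord0 i); pose h' i := h (lift ord0 i).
transitivity (\int[lebesgue_tuple R k]_t ((2 * h ord0)%:E * (\1_(tuple_box c' h') t)%:E))%E.
  apply: eq_integral => t _; rewrite indicE.
  have [/set_mem tin|/negP tout] := boolP (t \in tuple_box c' h').
    rewrite mule1 (_ : [set _ | _] = [set a : R1 | `|a - c ord0| <= h ord0]).
      rewrite itv_distrE lebesgue_measure_itv/= lte_fin.
      case: ltP => [_|]; first by rewrite -EFinD; congr EFin; ring.
      have := h0 ord0; rewrite le0r => /predU1P[->|hp]; first by rewrite mulr0.
      by move: (h ord0) hp (c ord0) => x x0 y; rewrite leNgt => /negP[]; lra.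
    apply/seteqP; split=> a /=; first by move/(_ ord0); rewrite tnth0.
    by move=> ha i; case: (unliftP ord0 i) => [j ->|->]; rewrite ?tnthS ?tnth0//; exact: tin.
  rewrite mule0 (_ : [set _ | _] = set0) ?measure0//.
  rewrite -subset0 => a /= ta; apply: tout; rewrite inE => i.
  by have := ta (lift ord0 i); rewrite tnthS.
have mb := measurable_tuple_box c' h'.
rewrite ge0_integralZl//; last 2 first.
- by apply/measurable_EFinP; exact: measurable_indic.
- by rewrite lee_fin mulr_ge0.
rewrite integral_indic// setIT ih ?EFinM//.
by move=> i; exact: h0.
Qed.
End tuple_measure.

(** * Volume on C^n and uniqueness of invariant measures *)

Section volume_basic.
Context (R : realType) (n : nat).
Local Notation R1 := (measurableTypeR R).
Implicit Types (x y z w : Cn R n) (A : set (Cn R n)).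

Lemma coords_lshift z (j : 'I_n) : tnth (coords z) (lshift n j) = complex.Re (z ord0 j).
Proof.
rewrite tnth_mktuple; case: fintype.splitP => i /= ji.
  by congr (complex.Re (z _ _)); apply/val_inj.
by move: (ltn_ord j); rewrite ji ltnNge leq_addr.
Qed.

Lemma coords_rshift z (j : 'I_n) : tnth (coords z) (rshift n j) = complex.Im (z ord0 j).
Proof.
rewrite tnth_mktuple; case: fintype.splitP => i /= ji.
  by move: (ltn_ord i); rewrite -ji ltnNge leq_addr.
by congr (complex.Im (z _ _)); apply/val_inj/eqP; rewrite -(eqn_add2l n) ji.
Qed.

Lemma measurable_coords : measurable_fun [set: Cn R n] (@coords R n).
Proof. by move=> _ B mB; exists B. Qed.

Lemma volume_coords (B : set ((n + n).-tuple R1)) :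
  volume (@coords R n @^-1` B) = lebesgue_tuple R (n + n) B.
Proof.
rewrite /volume /= /pushforward; congr (lebesgue_tuple R (n + n) _).
by apply/seteqP; split=> t /=; rewrite of_coordsK.
Qed.

Lemma measurable_to_Cn d (T : measurableType d) (D : set T) (f : T -> Cn R n) :
  measurable D ->
  (forall j, measurable_fun setT (fun t => complex.Re (f t ord0 j))) ->
  (forall j, measurable_fun setT (fun t => complex.Im (f t ord0 j))) ->
  measurable_fun D f.
Proof.
move=> mD mRe mIm.
suff mc : measurable_fun setT (@coords R n \o f).
  apply: (measurable_funS measurableT) => // _ _ [B mB <-].
  by rewrite !setTI -comp_preimage -[X in measurable X]setTI; exact: mc.
apply/measurable_fun_tnthP => j.
case: (split_ordP j) => i ->.
  rewrite (_ : _ \o _ = fun t => complex.Re (f t ord0 i)); first exact: mRe.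
  by apply/funext => t /=; rewrite coords_lshift.
rewrite (_ : _ \o _ = fun t => complex.Im (f t ord0 i)); first exact: mIm.
by apply/funext => t /=; rewrite coords_rshift.
Qed.

Definition addv x y : Cn R n := \row_j ((x ord0 j : R[i]) + y ord0 j).
Definition oppv x : Cn R n := \row_j (- (x ord0 j : R[i])).

Lemma measurable_Re_coord (j : 'I_n) :
  measurable_fun [set: Cn R n] (fun z => complex.Re (z ord0 j)).
Proof. by have [] := @measurable_coord R n j. Qed.

Lemma measurable_Im_coord (j : 'I_n) :
  measurable_fun [set: Cn R n] (fun z => complex.Im (z ord0 j)).
Proof. by have [] := @measurable_coord R n j. Qed.

Lemma measurable_oppv : measurable_fun setT oppv.
Proof.
apply: measurable_to_Cn => // j.
  rewrite [X in measurable_fun _ X](_ : _ = (fun z => - complex.Re (z ord0 j))).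
    by apply: measurableT_comp => //; exact: measurable_Re_coord.
  by apply/funext => z; rewrite mxE; case: (z ord0 j).
rewrite [X in measurable_fun _ X](_ : _ = (fun z => - complex.Im (z ord0 j))).
  by apply: measurableT_comp => //; exact: measurable_Im_coord.
by apply/funext => z; rewrite mxE; case: (z ord0 j).
Qed.

Lemma measurable_addv : measurable_fun setT (fun p : Cn R n * Cn R n => addv p.1 p.2).
Proof.
have mRe j : measurable_fun setT (fun p : Cn R n * Cn R n => complex.Re (p.1 ord0 j)).
  by apply: (measurableT_comp (measurable_Re_coord j)).
have mRe2 j : measurable_fun setT (fun p : Cn R n * Cn R n => complex.Re (p.2 ord0 j)).
  by apply: (measurableT_comp (measurable_Re_coord j)).
have mIm j : measurable_fun setT (fun p : Cn R n * Cn R n => complex.Im (p.1 ord0 j)).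
  by apply: (measurableT_comp (measurable_Im_coord j)).
have mIm2 j : measurable_fun setT (fun p : Cn R n * Cn R n => complex.Im (p.2 ord0 j)).
  by apply: (measurableT_comp (measurable_Im_coord j)).
apply: measurable_to_Cn => // j.
  rewrite [X in measurable_fun _ X](_ : _ = (fun p : Cn R n * Cn R n => complex.Re (p.1 ord0 j) + complex.Re (p.2 ord0 j))).
    exact: measurable_funD.
  by apply/funext => -[z w]; rewrite mxE /=; case: (z ord0 j) (w ord0 j) => ? ? [].
rewrite [X in measurable_fun _ X](_ : _ = (fun p : Cn R n * Cn R n => complex.Im (p.1 ord0 j) + complex.Im (p.2 ord0 j))).
  exact: measurable_funD.
by apply/funext => -[z w]; rewrite mxE /=; case: (z ord0 j) (w ord0 j) => ? ? [].
Qed.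

Lemma volume_translate w A : measurable A ->
  volume ((fun z => addv z w) @^-1` A) = volume A.
Proof.
move=> [B mB <-]; rewrite setTI volume_coords.
have cE z : tuple_shift (coords w) (coords z) = coords (addv z w).
  apply: eq_from_tnth => j; rewrite tnth_mktuple.
  case: (split_ordP j) => i ->.
    by rewrite !coords_lshift mxE; case: (z ord0 i) (w ord0 i) => ? ? [].
  by rewrite !coords_rshift mxE; case: (z ord0 i) (w ord0 i) => ? ? [].
rewrite -(lebesgue_tuple_translate (coords w) mB) -volume_coords.
by congr (volume _); apply/seteqP; split=> z /=; rewrite cE.
Qed.

Definition cbox (c h : 'I_(n + n) -> R) : set (Cn R n) := @coords R n @^-1` tuple_box c h.

Lemma measurable_cbox c h : measurable (cbox c h).
Proof.
rewrite -[X in measurable X]setTI.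
exact: (measurable_coords measurableT (measurable_tuple_box c h)).
Qed.

Lemma volume_cbox c h : (forall i, 0 <= h i) ->
  volume (cbox c h) = (\prod_i (2 * h i))%:E.
Proof. by move=> h0; rewrite volume_coords lebesgue_tuple_box. Qed.

Lemma volume_sigma_finite : sigma_finite [set: Cn R n] (@volume R n).
Proof.
exists (fun k => cbox (fun=> 0) (fun=> k%:R)).
  apply/seteqP; split=> // z _.
  have [k hk] : exists k : nat, \sum_i `|tnth (coords z) i| <= k%:R.
    exists (Num.truncn (\sum_i `|tnth (coords z) i|)).+1.
    exact/ltW/truncnS_gt.
  exists k => // i; rewrite subr0 (le_trans _ hk)//.
  by rewrite (bigD1 i)//= lerDl sumr_ge0.
move=> k; split; first exact: measurable_cbox.
by rewrite [ltLHS]volume_cbox ?ltry.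
Qed.

End volume_basic.

HB.instance Definition _ (R : realType) (n : nat) :=
  @Measure_isSigmaFinite.Build _ _ _ (@volume R n) (@volume_sigma_finite R n).

Section haar.
Context d (T : measurableType d) (R : realType).
Context (add : T -> T -> T) (opp : T -> T).
Hypothesis addC : forall x y, add x y = add y x.
Hypothesis addKopp : forall x y, add y (opp (add x y)) = opp x.
Hypothesis m_add : measurable_fun setT (fun p : T * T => add p.1 p.2).
Hypothesis m_opp : measurable_fun setT opp.
Local Open Scope ereal_scope.

Definition translation_invariant (mu : set T -> \bar R) :=
  forall w A, measurable A -> mu ((fun z => add z w) @^-1` A) = mu A.

(** Two invariant measures are exchanged under Fubini: integrating the indicator
    of x in A, y - x in B in the two orders gives mu(A) nu(B) on one side and,
    after the substitution x -> x + y, mu(-B) nu(A) on the other. *)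
Lemma haar_exchange (mu nu : {sigma_finite_measure set T -> \bar R}) (A B : set T) :
  translation_invariant mu -> translation_invariant nu ->
  measurable A -> measurable B ->
  mu A * nu B = mu (opp @^-1` B) * nu A.
Proof.
move=> imu inu mA mB.
have m_sub : measurable_fun setT (fun p : T * T => add p.2 (opp p.1)).
  have m2 : measurable_fun setT (fun p : T * T => (p.2, opp p.1)).
    by apply: measurable_fun_pair => //; exact: (measurableT_comp m_opp).
  exact: (measurableT_comp m_add m2).
have m_addw w : measurable_fun setT (fun z => add z w).
  have m2 : measurable_fun setT (fun z : T => (z, w)) by exact: measurable_fun_pair.
  exact: (measurableT_comp m_add m2).
have pre (f : T -> T) C : measurable_fun setT f -> measurable C -> measurable (f @^-1` C).
  by move=> mf mC; rewrite -[X in measurable X]setTI; exact: mf.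
pose S : set (T * T) := [set p | A p.1 /\ B (add p.2 (opp p.1))].
have mS : measurable S.
  apply: measurableI; rewrite -[X in measurable X]setTI.
    exact: (measurable_fst measurableT _ mA).
  exact: (m_sub measurableT _ mB).
pose S' : set (T * T) := [set p | B (opp p.1) /\ A (add p.1 p.2)].
have mS' : measurable S'.
  have m_o1 : measurable_fun setT (fun p : T * T => opp p.1).
    exact: measurableT_comp.
  have h1 := m_o1 measurableT _ mB; have h2 := m_add measurableT mA.
  rewrite !setTI in h1 h2; exact: measurableI h1 h2.
have swap (X : set (T * T)) : measurable X ->
    \int[mu]_x nu (xsection X x) = \int[nu]_y mu (ysection X y).
  move=> mX; apply: (@product_measure_unique _ _ _ _ _ mu nu (mu \x^ nu)) => //.
  by move=> *; rewrite [LHS]product_measure2E.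
have cint (X : set T) (g : T -> set T) (c : \bar R) : measurable X -> 0 <= c ->
    (forall x, X x -> nu (g x) = c) -> (forall x, ~ X x -> g x = set0) ->
    \int[mu]_x nu (g x) = mu X * c.
  move=> mX c0 g1 g0; transitivity (\int[mu]_x (c * (\1_X x)%:E)).
    apply: eq_integral => x _; rewrite indicE.
    have [/set_mem Xx|/negP Xx] := boolP (x \in X); first by rewrite mule1 g1.
    by rewrite mule0 g0 ?measure0// => Xx'; apply: Xx; rewrite inE.
  rewrite ge0_integralZl//; last by apply/measurable_EFinP; exact: measurable_indic.
  by rewrite integral_indic// setIT muleC.
rewrite -(cint A (xsection S))//; last 2 first.
- move=> x Ax; rewrite -(inu (opp x) B mB); congr (nu _).
  by apply/seteqP; split=> y /=; rewrite /xsection /= inE => // -[].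
- by move=> x Ax; rewrite -subset0 => y; rewrite /xsection /= inE => -[].
rewrite swap//.
transitivity (\int[nu]_y mu (ysection S' y)).
  apply: eq_integral => y _; rewrite -(imu y (ysection S y)); last exact: measurable_ysection.
  by congr (mu _); apply/seteqP; split=> x /=; rewrite /ysection /= !inE /S /S' /= addKopp => -[].
rewrite -swap// (cint (opp @^-1` B) _ (nu A))//.
- exact: pre.
- move=> x Bx; rewrite -(inu x A mA); congr (nu _).
  by apply/seteqP; split=> y /=; rewrite /xsection /= inE /S' /= addC => // -[].
- by move=> x Bx; rewrite -subset0 => y; rewrite /xsection /= inE => -[].
Qed.
End haar.

(** * Measurability and unitary reflections *)

Section measurable_complex.
Context d (T : measurableType d) (R : realType).
Implicit Types (f g : T -> R[i]).

Definition measurable_cfun f :=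
  measurable_fun setT (fun t => complex.Re (f t)) /\
  measurable_fun setT (fun t => complex.Im (f t)).

Lemma measurable_cfun_cst (c : R[i]) : measurable_cfun (fun=> c).
Proof. by split; exact: measurable_cst. Qed.

Lemma measurable_cfunB f g : measurable_cfun f -> measurable_cfun g ->
  measurable_cfun (fun t => f t - g t).
Proof.
move=> [fr fi] [gr gi]; split.
  rewrite [X in measurable_fun _ X](_ : _ = fun t => complex.Re (f t) - complex.Re (g t)).
    exact: measurable_funB.
  by apply/funext => t; case: (f t) (g t) => ? ? [].
rewrite [X in measurable_fun _ X](_ : _ = fun t => complex.Im (f t) - complex.Im (g t)).
  exact: measurable_funB.
by apply/funext => t; case: (f t) (g t) => ? ? [].
Qed.

Lemma measurable_cfunM f g : measurable_cfun f -> measurable_cfun g ->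
  measurable_cfun (fun t => f t * g t).
Proof.
move=> [fr fi] [gr gi]; split.
  rewrite [X in measurable_fun _ X](_ : _ = fun t =>
      complex.Re (f t) * complex.Re (g t) - complex.Im (f t) * complex.Im (g t)).
    by apply: measurable_funB; exact: measurable_funM.
  by apply/funext => t; case: (f t) (g t) => ? ? [].
rewrite [X in measurable_fun _ X](_ : _ = fun t =>
    complex.Re (f t) * complex.Im (g t) + complex.Im (f t) * complex.Re (g t)).
  by apply: measurable_funD; exact: measurable_funM.
by apply/funext => t; case: (f t) (g t) => ? ? [].
Qed.

Lemma measurable_cfun_sum (I : Type) (s : seq I) (F : I -> T -> R[i]) :
  (forall i, measurable_cfun (F i)) -> measurable_cfun (fun t => \sum_(i <- s) F i t).
Proof.
move=> mF; split.
  rewrite [X in measurable_fun _ X](_ : _ = fun t => \sum_(i <- s) complex.Re (F i t)).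
    by apply: measurable_sum => i; have [] := mF i.
  apply/funext => t; rewrite (big_morph (@complex.Re R) (id1 := 0) (op1 := +%R))//.
  by move=> [a b] [a' b'].
rewrite [X in measurable_fun _ X](_ : _ = fun t => \sum_(i <- s) complex.Im (F i t)).
  by apply: measurable_sum => i; have [] := mF i.
apply/funext => t; rewrite (big_morph (@complex.Im R) (id1 := 0) (op1 := +%R))//.
by move=> [a b] [a' b'].
Qed.

Lemma measurable_normc f : measurable_cfun f ->
  measurable_fun setT (fun t => Normc.normc (f t)).
Proof.
move=> [fr fi].
rewrite [X in measurable_fun _ X](_ : _ = (fun a => a `^ 2^-1) \o
    (fun t => complex.Re (f t) ^+ 2 + complex.Im (f t) ^+ 2)).
  apply: measurableT_comp; first exact: measurable_powR.
  by apply: measurable_funD; exact: measurable_funX.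
apply/funext => t /=; rewrite powR12_sqrt ?addr_ge0 ?sqr_ge0//.
by case: (f t).
Qed.
End measurable_complex.

Section measurable_geometry.
Context (R : realType) (n : nat).
Implicit Types (x y z u v : Cn R n).

Lemma measurable_cfun_coord j : measurable_cfun (fun z : Cn R n => z ord0 j).
Proof. by split; [exact: measurable_Re_coord|exact: measurable_Im_coord]. Qed.

Lemma measurable_hermr y : measurable_cfun (fun z => herm z y).
Proof.
apply: measurable_cfun_sum => j; apply: measurable_cfunM.
  exact: measurable_cfun_coord.
exact: measurable_cfun_cst.
Qed.

Lemma measurable_dist x : measurable_fun setT (dist x).
Proof.
rewrite (_ : dist x = fun z => Normc.normc (1 - herm z x)).
  apply: measurable_normc; apply: measurable_cfunB; first exact: measurable_cfun_cst.
  exact: measurable_hermr.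
by apply/funext => z; rewrite distC.
Qed.

Lemma measurable_unit_sphere : measurable (@unit_sphere R n).
Proof.
rewrite (_ : unit_sphere = setT `&` @enorm R n @^-1` [set 1]).
  exact: measurable_enorm.
by rewrite setTI.
Qed.

Lemma measurable_dball x r : measurable (dball x r).
Proof.
rewrite (_ : dball x r = (setT `&` @enorm R n @^-1` `]-oo, 1]) `&` (setT `&` dist x @^-1` `]-oo, r[)).
  apply: measurableI; first exact: measurable_enorm.
  exact: measurable_dist.
by rewrite !setTI; apply/seteqP; split => z /=; rewrite !in_itv/=.
Qed.

End measurable_geometry.

Section reflection.
Context (R : realType) (n : nat).
Implicit Types (x y z u v w e : Cn R n) (c : R[i]).

(** The map z |-> z - c <z, v> v is unitary when |c|^2 |v|^2 = 2 Re c;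
    real reflections are the case c = 2 / |v|^2. *)
Definition refl c v z : Cn R n := subv z (c * herm z v) v.

Lemma herm_addl x y z : herm (addv x y) z = herm x z + herm y z.
Proof.
rewrite /herm -big_split; apply: eq_bigr => j _ /=.
by rewrite mxE mulrDl.
Qed.

Lemma refl_add c v x y : refl c v (addv x y) = addv (refl c v x) (refl c v y).
Proof. by apply/rowP => j; rewrite !mxE herm_addl; ring. Qed.

Lemma measurable_refl c v : measurable_fun setT (refl c v).
Proof.
have m j : measurable_cfun (fun z => refl c v z ord0 j).
  rewrite (_ : (fun z => _) = (fun z => z ord0 j - c * herm z v * v ord0 j)).
    apply: measurable_cfunB; first exact: measurable_cfun_coord.
    apply: measurable_cfunM; last exact: measurable_cfun_cst.
    apply: measurable_cfunM; first exact: measurable_cfun_cst.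
    exact: measurable_hermr.
  by apply/funext => z; rewrite mxE.
by apply: measurable_to_Cn => // j; have [] := m j.
Qed.

Lemma refl_herm c v x y :
  (Normc.normc c ^+ 2)%:C%C * herm v v = c + conjc c ->
  herm (refl c v x) (refl c v y) = herm x y.
Proof.
rewrite -mulc_conj => h; rewrite /refl !(herm_subl, herm_subr).
rewrite rmorphM (herm_conj y v).
rewrite -[LHS](_ : herm x y - herm x v * conjc (herm y v) * (c + conjc c - c * conjc c * herm v v) = _); last by ring.
by rewrite h subrr mulr0 subr0.
Qed.

Lemma refl_inv c v z :
  (Normc.normc c ^+ 2)%:C%C * herm v v = c + conjc c ->
  refl c v (refl (conjc c) v z) = z.
Proof.
rewrite -mulc_conj => h; apply/rowP => j; rewrite !mxE herm_subl.
transitivity ((z ord0 j : R[i]) - herm z v * v ord0 j * (c + conjc c - c * conjc c * herm v v)).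
  by ring.
by rewrite h subrr mulr0 subr0.
Qed.

(** The unitary group acts transitively on the sphere, already through
    reflections: reflecting along x - e exchanges x and e. *)
Lemma sphere_transitive x e : enorm x = 1 -> enorm e = 1 ->
  exists U : Cn R n -> Cn R n,
    [/\ measurable_fun setT U, forall y z, U (addv y z) = addv (U y) (U z),
        forall y z, herm (U y) (U z) = herm y z,
        (exists V, cancel V U) & U x = e].
Proof.
move=> x1 e1; have [->|xe] := eqVneq x e.
  by exists id; split => //; exists id.
(* With v = x - e and c = 1 / <x, v>, the image of x is x - v, and
   |v|^2 = 2 Re <x, v> is the unitarity condition. *)
pose v := subv x 1 e.
have xv : herm x v = 1 - herm x e by rewrite herm_subr herm_self x1 expr1n !rmorph1 mul1r.
have ev : herm e v = - conjc (1 - herm x e).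
  by rewrite herm_subr herm_self e1 expr1n !rmorph1 mulr1 (herm_conj x e) rmorphB rmorph1 opprB.
have vv : herm v v = herm x v + conjc (herm x v).
  by rewrite {1}/v herm_subl ev mul1r opprK xv.
have xv0 : herm x v != 0.
  apply/eqP => xv0; move: vv; rewrite xv0 rmorph0 addr0 herm_self.
  move=> /(@complexI R)/eqP; rewrite sqrf_eq0 => /eqP/enorm_eq0 v0.
  move/eqP: xe; apply; apply/rowP => j; have := v0 j.
  by rewrite mxE mul1r => /eqP; rewrite subr_eq0 => /eqP.
pose c := (herm x v)^-1.
have cc : (Normc.normc c ^+ 2)%:C%C * herm v v = c + conjc c.
  have xvc : conjc (herm x v) != 0 by rewrite conjc_eq0.
  rewrite -mulc_conj vv /c conjc_inv; field.
  by rewrite xv0 xvc.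
exists (refl c v); split.
- exact: measurable_refl.
- exact: refl_add.
- by move=> y z; exact: refl_herm.
- by exists (refl (conjc c) v) => z; exact: refl_inv.
- by apply/rowP => j; rewrite !mxE mulVf// !mul1r subKr.
Qed.
End reflection.

(** * Boxes comparable to balls and to cones over caps *)

Section polar_boxes.
Context (R : realType) (m : nat).
Local Notation n := m.+1.
Local Notation normc := Normc.normc.
Implicit Types (x y z : Cn R n) (c A B h r t : R).

Lemma normr_le_sqr t h : 0 <= h -> (`|t| <= h) = (t ^+ 2 <= h ^+ 2).
Proof.
by move=> h0; rewrite -[in RHS](@real_normK _ t) ?num_real// ler_pXn2r ?nnegrE.
Qed.

Definition tail_sqr z : R := \sum_(j < m)
  (complex.Re (z ord0 (lift ord0 j)) ^+ 2 + complex.Im (z ord0 (lift ord0 j)) ^+ 2).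

Lemma enorm_tail z : enorm z ^+ 2 = normc (z ord0 ord0) ^+ 2 + tail_sqr z.
Proof. by rewrite enorm_sqr big_ord_recl normc_sqr. Qed.

Lemma tail_sqr_ge0 z : 0 <= tail_sqr z.
Proof. by apply: sumr_ge0 => j _; rewrite addr_ge0 ?sqr_ge0. Qed.

(** Boxes adapted to the first coordinate axis: the first coordinate ranges over
    a 2A by 2B rectangle centred at the real point c, the others over squares of
    side 2h. Near the point e1 of the sphere, the balls of the nonisotropic
    distance are comparable to such boxes with h of the order of sqrt r. *)
Definition axis_box c A B h : set (Cn R n) := [set z |
  [/\ `|complex.Re (z ord0 ord0) - c| <= A, `|complex.Im (z ord0 ord0)| <= B &
   forall j : 'I_m, `|complex.Re (z ord0 (lift ord0 j))| <= h /\
                    `|complex.Im (z ord0 (lift ord0 j))| <= h]].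

Lemma axis_boxE c A B h : exists c' h' : 'I_(n + n) -> R,
  [/\ axis_box c A B h = cbox c' h',
      (0 <= A -> 0 <= B -> 0 <= h -> forall i, 0 <= h' i) &
      \prod_i (2 * h' i) = (2 * A) * (2 * B) * (4 * h ^+ 2) ^+ m].
Proof.
pose c' (i : 'I_(n + n)) := match fintype.split i with
  | inl j => if j == ord0 then c else 0 | inr j => 0 end.
pose h' (i : 'I_(n + n)) := match fintype.split i with
  | inl j => if j == ord0 then A else h | inr j => if j == ord0 then B else h end.
have sl (j : 'I_n) : fintype.split (lshift n j) = inl j by exact: (unsplitK (inl j)).
have sr (j : 'I_n) : fintype.split (rshift n j) = inr j by exact: (unsplitK (inr j)).
exists c', h'; split.
- apply/seteqP; split=> z.
    move=> [hA hB hh] i; case: (split_ordP i) => j ->.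
      rewrite coords_lshift /c' /h' sl; case: (unliftP ord0 j) => [k ->|->] /=.
        by rewrite subr0; have [] := hh k.
      exact: hA.
    rewrite coords_rshift /c' /h' sr subr0; case: (unliftP ord0 j) => [k ->|->] /=.
      by have [] := hh k.
    exact: hB.
  move=> hz.
  have hl j := hz (lshift n j); have hr j := hz (rshift n j).
  split => [||j].
  - by have := hl ord0; rewrite coords_lshift /c' /h' sl.
  - by have := hr ord0; rewrite coords_rshift /c' /h' sr subr0.
  - split.
      by have := hl (lift ord0 j); rewrite coords_lshift /c' /h' sl/= subr0.
    by have := hr (lift ord0 j); rewrite coords_rshift /c' /h' sr/= subr0.
- by move=> A0 B0 h0 i; rewrite /h'; case: fintype.split => j; case: ifP.
- rewrite big_split_ord/= !big_ord_recl/= /h' !sl !sr /=.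
  under eq_bigr do rewrite sl /=.
  under [X in _ * (_ * X)]eq_bigr do rewrite sr /=.
  by rewrite !prodr_const card_ord (_ : 4 * h ^+ 2 = (2 * h) * (2 * h)) ?exprMn; ring.
Qed.

Lemma measurable_axis_box c A B h : measurable (axis_box c A B h).
Proof. by have [c' [h' [-> _ _]]] := axis_boxE c A B h; exact: measurable_cbox. Qed.

Lemma volume_axis_box c A B h : 0 <= A -> 0 <= B -> 0 <= h ->
  volume (axis_box c A B h) = ((2 * A) * (2 * B) * (4 * h ^+ 2) ^+ m)%:E.
Proof.
move=> A0 B0 h0; have [c' [h' [-> h'0 <-]]] := axis_boxE c A B h.
by rewrite volume_cbox//; exact: h'0.
Qed.

Lemma tail_sqr_le z h : 0 <= h -> tail_sqr z <= h ^+ 2 ->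
  forall j : 'I_m, `|complex.Re (z ord0 (lift ord0 j))| <= h /\
                    `|complex.Im (z ord0 (lift ord0 j))| <= h.
Proof.
move=> h0 hz j.
have hj : complex.Re (z ord0 (lift ord0 j)) ^+ 2 +
          complex.Im (z ord0 (lift ord0 j)) ^+ 2 <= h ^+ 2.
  apply: le_trans hz; rewrite /tail_sqr (bigD1 j)//= lerDl.
  by apply: sumr_ge0 => k _; rewrite addr_ge0 ?sqr_ge0.
rewrite !normr_le_sqr//; split; apply: le_trans hj.
  by rewrite lerDl sqr_ge0.
by rewrite lerDr sqr_ge0.
Qed.

Lemma tail_sqr_box c A B h z : 0 <= h -> axis_box c A B h z ->
  tail_sqr z <= 2 * n%:R * h ^+ 2.
Proof.
move=> h0 [_ _ hz]; apply: (@le_trans _ _ (\sum_(j < m) (2 * h ^+ 2))).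
  apply: ler_sum => j _; have [h1 h2] := hz j.
  by rewrite !normr_le_sqr// in h1 h2; rewrite mulr2n mulrDl mul1r lerD.
have -> : \sum_(j < m) (2 * h ^+ 2) = 2 * m%:R * h ^+ 2.
  by rewrite sumr_const card_ord -mulr_natl; ring.
by rewrite ler_wpM2r ?sqr_ge0// ler_wpM2l// ler_nat.
Qed.

Lemma unit_ball_sub_box : @unit_ball R n `<=` axis_box 0 1 1 1.
Proof.
move=> z /= z1.
have z2 : enorm z ^+ 2 <= 1 by rewrite exprn_ile1 ?enorm_ge0// ltW.
have t0 := tail_sqr_ge0 z; rewrite enorm_tail in z2.
have c0 : normc (z ord0 ord0) <= 1.
  by rewrite -(@ler_pXn2r _ 2) ?nnegrE ?normc_ge0// expr1n; lra.
split; last by apply: tail_sqr_le => //; rewrite expr1n; have := sqr_ge0 (normc (z ord0 ord0)); lra.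
  by rewrite subr0; apply: le_trans c0; exact: Re_le_normc.
by apply: le_trans c0; exact: Im_le_normc.
Qed.

Lemma volume_unit_ball_lty : (volume (@unit_ball R n) < +oo)%E.
Proof.
apply: le_lt_trans (_ : volume (axis_box 0 1 1 1) < _)%E.
  apply: le_measure; rewrite ?inE; [exact: measurable_unit_ball|exact: measurable_axis_box|].
  exact: unit_ball_sub_box.
by rewrite volume_axis_box ?ltry.
Qed.

Lemma enorm_lt1 z : (enorm z ^+ 2 < 1) = (enorm z < 1).
Proof. by rewrite expr_lt1// enorm_ge0. Qed.

(** A box of size comparable to r (in the first coordinate) and sqrt r (in the
    others), at height r below e1, inside the ball of radius r. *)
Definition inner_box r := axis_box (1 - 3 / 8 * r) (r / 8) (r / 4) (Num.sqrt (r / (16 * n%:R))).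

Lemma inner_box_sub r z : 0 < r -> r <= 2 -> inner_box r z ->
  enorm z < 1 /\ normc (1 - z ord0 ord0) < r.
Proof.
move=> r0 r2 /[dup] /(tail_sqr_box (sqrtr_ge0 _)).
have n0 : n%:R != 0 :> R by rewrite pnatr_eq0.
rewrite sqr_sqrtr; last by rewrite divr_ge0 ?mulr_ge0 ?ltW// ?ltr0n.
rewrite (_ : 2 * n%:R * (r / (16 * n%:R)) = r / 8); last by field.
move=> ht [+ + _]; rewrite -enorm_lt1 enorm_tail normc_sqr.
have -> : (normc (1 - z ord0 ord0) < r) =
    ((1 - complex.Re (z ord0 ord0)) ^+ 2 + complex.Im (z ord0 ord0) ^+ 2 < r ^+ 2).
  rewrite -(@ltr_pXn2r _ 2) ?nnegrE ?normc_ge0 ?(ltW r0)// normc_sqr.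
  by case: (z ord0 ord0) => a b /=; rewrite add0r sqrrN.
move: (tail_sqr z) ht (complex.Re _) (complex.Im _) => t ht a b.
rewrite ler_distl (normr_le_sqr _ (_ : 0 <= r / 4)); last by rewrite divr_ge0// ltW.
move=> /andP[a1 a2] hb.
have ha : a ^+ 2 <= (1 - r / 4) ^+ 2 by rewrite ler_pXn2r ?nnegrE//; lra.
have ha' : (1 - a) ^+ 2 <= (r / 2) ^+ 2 by rewrite ler_pXn2r ?nnegrE//; lra.
by split; nra.
Qed.

Lemma volume_inner_box r : 0 < r ->
  volume (inner_box r) = ((8^-1 * (4 * n%:R)^-1 ^+ m) * r ^+ m.+2)%:E.
Proof.
move=> r0; have n0 : n%:R != 0 :> R by rewrite pnatr_eq0.
have r0' := ltW r0.
rewrite volume_axis_box ?divr_ge0 ?sqrtr_ge0// sqr_sqrtr ?divr_ge0 ?mulr_ge0//.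
congr EFin; rewrite (_ : 4 * (r / (16 * n%:R)) = (4 * n%:R)^-1 * r); last by field.
by rewrite exprMn !exprS; field.
Qed.

Lemma volume_unit_ball_gt0 : (0 < volume (@unit_ball R n))%E.
Proof.
apply: lt_le_trans (_ : volume (inner_box 1) <= _)%E.
  by rewrite volume_inner_box// lte_fin !mulr_gt0 ?exprn_gt0 ?invr_gt0 ?mulr_gt0 ?ltr0n.
apply: le_measure; rewrite ?inE; [exact: measurable_axis_box|exact: measurable_unit_ball|].
by move=> z /inner_box_sub[]//; rewrite ler1n.
Qed.


(** The case t = 1 bounds the coordinates other than the first by sqrt r in a
    ball of radius r about e1, and t = |z| does so in the cone over a cap. *)
Lemma tail_sqr_le_dist z t : enorm z <= t -> 
  tail_sqr z <= 2 * t * normc (t%:C%C - z ord0 ord0).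
Proof.
move=> zt; have t0 : 0 <= t := le_trans (enorm_ge0 z) zt.
have zt2 : enorm z ^+ 2 <= t ^+ 2 by rewrite ler_pXn2r ?nnegrE ?enorm_ge0.
rewrite enorm_tail in zt2.
have : t <= normc (t%:C%C - z ord0 ord0) + normc (z ord0 ord0).
  rewrite -[leLHS]ger0_norm// -normc_real.
  by apply: le_trans (le_normcD _ _); rewrite subrK.
have := normc_ge0 (z ord0 ord0); have := normc_ge0 (t%:C%C - z ord0 ord0).
have := tail_sqr_ge0 z; move: zt2.
move: (tail_sqr z) (normc _) (normc _) => u v w.
have [wt|wt] := leP w t; last by nra.
nra.
Qed.

(** The first coordinate is within r of 1, and the tail has squared norm at most
    1 - |z_1|^2 <= 2 |1 - z_1|. *)
Definition outer_box r := axis_box 1 r r (Num.sqrt (2 * r)).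

Lemma outer_box_sub r z : 0 < r -> enorm z <= 1 -> normc (1 - z ord0 ord0) < r ->
  outer_box r z.
Proof.
move=> r0 z1 zr; split.
- rewrite distrC (le_trans _ (ltW zr))//.
  rewrite (_ : 1 - complex.Re _ = complex.Re (1 - z ord0 ord0)) ?Re_le_normc//.
  by case: (z ord0 ord0).
- rewrite (le_trans _ (ltW zr))// -normrN.
  rewrite (_ : - complex.Im _ = complex.Im (1 - z ord0 ord0)) ?Im_le_normc//.
  by case: (z ord0 ord0) => a b /=; rewrite add0r.
apply: tail_sqr_le; rewrite ?sqrtr_ge0// sqr_sqrtr ?mulr_ge0 ?(ltW r0)//.
apply: le_trans (tail_sqr_le_dist z1) _.
by rewrite mulr1 ler_wpM2l// ltW.
Qed.

Lemma volume_outer_box r : 0 < r -> volume (outer_box r) = ((4 * 8 ^+ m) * r ^+ m.+2)%:E.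
Proof.
move=> r0; have r0' := ltW r0.
rewrite volume_axis_box ?sqrtr_ge0// sqr_sqrtr ?mulr_ge0//.
congr EFin; rewrite (_ : 4 * (2 * r) = 8 * r); last by ring.
by rewrite exprMn !exprS; ring.
Qed.

(** Clearing the denominator in the distance from e1 to z / |z|. *)
Lemma radial_scale z : enorm z != 0 ->
  normc (1 - radial z ord0 ord0) * enorm z = normc ((enorm z)%:C%C - z ord0 ord0).
Proof.
move=> z0; rewrite -[X in _ * X]ger0_norm ?enorm_ge0// -normc_real -Normc.normcM.
congr normc; rewrite mxE mulrBl mul1r mulrAC -rmorphM mulVf//.
by rewrite mul1r.
Qed.

(** The cone over a cap has length of order 1 in the real direction of the first
    coordinate, hence one factor r less than a ball. *)
Definition cone_outer_box r := axis_box 0 1 r (Num.sqrt (2 * r)).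

Lemma cone_outer_box_sub r z : 0 < r -> enorm z < 1 ->
  normc (1 - radial z ord0 ord0) < r -> cone_outer_box r z.
Proof.
move=> r0 z1 zr; have r0' := ltW r0.
have [e0|e0] := eqVneq (enorm z) 0.
  split; rewrite ?(enorm_eq0 e0)/= ?subr0 ?normr0// => j.
  by rewrite !(enorm_eq0 e0)/= normr0 sqrtr_ge0.
have eg : 0 < enorm z by rewrite lt_neqAle eq_sym e0 enorm_ge0.
have hz : normc ((enorm z)%:C%C - z ord0 ord0) <= r.
  rewrite -radial_scale// -[leRHS]mulr1.
  by rewrite ler_pM ?normc_ge0 ?enorm_ge0// ltW.
split.
- rewrite subr0; have := unit_ball_sub_box z1 => -[+ _ _].
  by rewrite subr0.
- rewrite (le_trans _ hz)// -normrN.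
  rewrite (_ : - complex.Im _ = complex.Im ((enorm z)%:C%C - z ord0 ord0)) ?Im_le_normc//.
  by case: (z ord0 ord0) => a b /=; rewrite add0r.
apply: tail_sqr_le; rewrite ?sqrtr_ge0// sqr_sqrtr ?mulr_ge0//.
apply: le_trans (tail_sqr_le_dist (lexx _)) _.
rewrite -mulrA ler_wpM2l// (le_trans _ hz)// ler_piMl ?normc_ge0//.
exact: ltW.
Qed.

Lemma volume_cone_outer_box r : 0 < r ->
  volume (cone_outer_box r) = ((4 * 8 ^+ m) * r ^+ m.+1)%:E.
Proof.
move=> r0; have r0' := ltW r0.
rewrite volume_axis_box ?sqrtr_ge0// sqr_sqrtr ?mulr_ge0//.
congr EFin; rewrite (_ : 4 * (2 * r) = 8 * r); last by ring.
by rewrite exprMn !exprS; ring.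
Qed.

(** The constants keep z away from 0 and make | |z| - z_1 | < r / 4 <= r |z|: the
    real part of z_1 is at least 1/4, while | |z| - Re z_1 | is at most twice the
    sum of (Im z_1)^2 and of the squared tail. *)
Definition cone_inner_box r := axis_box (3 / 8) (1 / 8) (r / 40) (Num.sqrt (r / (40 * n%:R))).

Lemma cone_inner_box_sub r z : 0 < r -> r <= 2 -> cone_inner_box r z ->
  [/\ enorm z < 1, enorm z != 0 & normc (1 - radial z ord0 ord0) < r].
Proof.
move=> r0 r2 /[dup] /(tail_sqr_box (sqrtr_ge0 _)).
have n0 : n%:R != 0 :> R by rewrite pnatr_eq0.
rewrite sqr_sqrtr; last by rewrite divr_ge0 ?mulr_ge0 ?ltW// ?ltr0n.
rewrite (_ : 2 * n%:R * (r / (40 * n%:R)) = r / 20); last by field.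
move=> ht [+ + _]; have t0 := tail_sqr_ge0 z.
set a := complex.Re (z ord0 ord0); set b := complex.Im (z ord0 ord0).
rewrite ler_distl => /andP[a1 a2] hb.
have hb2 : b ^+ 2 <= (r / 40) ^+ 2 by rewrite -normr_le_sqr// divr_ge0// ltW.
have e2 : enorm z ^+ 2 = a ^+ 2 + b ^+ 2 + tail_sqr z by rewrite enorm_tail normc_sqr.
have ea : a <= enorm z.
  have a0 : 0 <= a by lra.
  rewrite -(@ler_pXn2r _ 2) ?nnegrE ?enorm_ge0// e2.
  by rewrite -addrA lerDl addr_ge0 ?sqr_ge0.
have e0 : enorm z != 0 by rewrite gt_eqF//; lra.
have ha : a ^+ 2 <= (1 / 2) ^+ 2 by rewrite ler_pXn2r ?nnegrE//; lra.
split=> //; first by rewrite -enorm_lt1 e2; nra.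
have : normc ((enorm z)%:C%C - z ord0 ord0) <= (enorm z - a) + `|b|.
  apply: le_trans (normc_le_ReIm _) _.
  have -> : complex.Re ((enorm z)%:C%C - z ord0 ord0) = enorm z - a.
    by rewrite /a; case: (z ord0 ord0).
  have -> : complex.Im ((enorm z)%:C%C - z ord0 ord0) = - b.
    by rewrite /b; case: (z ord0 ord0) => ? ? /=; rewrite add0r.
  by rewrite normrN ger0_norm// subr_ge0.
rewrite -radial_scale// => hn.
rewrite -(@ltr_pM2r _ (enorm z)); last by lra.
apply: le_lt_trans hn _.
have hd : enorm z - a <= 2 * (b ^+ 2 + tail_sqr z).
  have -> : b ^+ 2 + tail_sqr z = (enorm z - a) * (enorm z + a).
    rewrite (_ : (_ - a) * _ = enorm z ^+ 2 - a ^+ 2); last by ring.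
    by rewrite e2; ring.
  nra.
nra.
Qed.

Lemma volume_cone_inner_box r : 0 < r ->
  volume (cone_inner_box r) = ((80^-1 * (10 * n%:R)^-1 ^+ m) * r ^+ m.+1)%:E.
Proof.
move=> r0; have n0 : n%:R != 0 :> R by rewrite pnatr_eq0.
have r0' := ltW r0.
rewrite volume_axis_box ?divr_ge0 ?sqrtr_ge0// sqr_sqrtr ?divr_ge0 ?mulr_ge0//.
congr EFin; rewrite (_ : 4 * (r / (40 * n%:R)) = (10 * n%:R)^-1 * r); last by field.
by rewrite exprMn !exprS; field.
Qed.
End polar_boxes.

(** * Regularity of the volume and of the surface measure *)

Lemma mule_cancel (R : realType) (b u v : \bar R) :
  (0 < b -> b < +oo -> u * b = b * v -> v = u)%E.
Proof.
case: b => // b; rewrite lte_fin => b0 _ h.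
have : (b^-1%:E * (u * b%:E) = b^-1%:E * (b%:E * v))%E by rewrite h.
by rewrite (muleC u) !muleA -EFinM mulVf ?gt_eqF// !mul1e.
Qed.

Section isometry.
Context (R : realType) (m : nat).
Local Notation n := m.+1.
Local Notation C := (Cn R n).
Context (U : C -> C).
Hypothesis mU : measurable_fun setT U.
Hypothesis addU : forall y z, U (addv y z) = addv (U y) (U z).
Hypothesis hermU : forall y z, herm (U y) (U z) = herm y z.
Hypothesis surjU : exists V, cancel V U.

Lemma enorm_isometry z : enorm (U z) = enorm z.
Proof. by rewrite /enorm hermU. Qed.

Lemma isometry_preimage_measurable (A : set C) : measurable A -> measurable (U @^-1` A).
Proof. by move=> mA; rewrite -[X in measurable X]setTI; exact: mU. Qed.

(** A name for the image of the volume, which has to carry the structure of a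
   sigma-finite measure. *)
Definition image_volume : set C -> \bar R := pushforward (@volume R n) U.
Local Notation nu := image_volume.

HB.instance Definition _ := Measure.copy image_volume
  (measure_function_pushforward__canonical__measure_function_Measure
    (@volume R n) mU).

Let nuE B : nu B = volume (U @^-1` B). Proof. by []. Qed.

Let nu_sigma_finite : sigma_finite [set: C] nu.
Proof.
exists (fun k => [set z | enorm z <= k%:R]).
  apply/seteqP; split=> // z _; exists (Num.truncn (enorm z)).+1 => //=.
  exact/ltW/truncnS_gt.
move=> k; have mk : measurable [set z : C | enorm z <= k%:R].
  rewrite (_ : [set _ | _] = setT `&` @enorm R n @^-1` `]-oo, k%:R]).
    exact: measurable_enorm.
  by rewrite setTI; apply/seteqP; split=> z /=; rewrite in_itv.
split=> //; rewrite [ltLHS]nuE.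
apply: le_lt_trans (_ : volume (@cbox R n (fun=> 0%R) (fun=> k%:R%R)) < _)%E.
  apply: le_measure; rewrite ?inE; [exact: isometry_preimage_measurable|exact: measurable_cbox|].
  move=> z /=; rewrite enorm_isometry => zk i; rewrite subr0 (le_trans _ zk)//.
  have hj (j : 'I_n) : complex.Re (z ord0 j) ^+ 2 + complex.Im (z ord0 j) ^+ 2 <= enorm z ^+ 2.
    rewrite enorm_sqr (bigD1 j)//= lerDl.
    by apply: sumr_ge0 => l _; rewrite addr_ge0 ?sqr_ge0.
  rewrite normr_le_sqr ?enorm_ge0//.
  case: (split_ordP i) => j ->; rewrite ?coords_lshift ?coords_rshift.
    by apply: le_trans (hj j); rewrite lerDl sqr_ge0.
  by apply: le_trans (hj j); rewrite lerDr sqr_ge0.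
by rewrite volume_cbox ?ltry.
Qed.

HB.instance Definition _ := @Measure_isSigmaFinite.Build _ _ _ nu nu_sigma_finite.

(** The image of the volume by a linear isometry is invariant under translations
    too, hence proportional to the volume, and both give the same positive finite
    mass to the unit ball. *)
Lemma volume_isometry (A : set C) : measurable A -> volume (U @^-1` A) = volume A.
Proof.
move=> mA.
have itr : translation_invariant (@addv R n) (@volume R n).
  by move=> w B mB; exact: volume_translate.
have inu : translation_invariant (@addv R n) nu.
  move=> w B mB; have [V UV] := surjU.
  rewrite [RHS]nuE [LHS]nuE -[RHS](itr (V w)).
    by congr (volume _); apply/seteqP; split=> z /=; rewrite addU UV.
  exact: isometry_preimage_measurable.
have addC : forall x y : C, addv x y = addv y x.
  by move=> x y; apply/rowP => j; rewrite !mxE addrC.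
have addK : forall x y : C, addv y (oppv (addv x y)) = oppv x.
  by move=> x y; apply/rowP => j; rewrite !mxE opprD addrCA subrr addr0.
have ex : (volume A * nu unit_ball = volume (@oppv R n @^-1` unit_ball) * nu A)%E.
  apply: (haar_exchange addC addK) => //; first exact: measurable_addv.
    exact: measurable_oppv.
  exact: measurable_unit_ball.
have oppb : @oppv R n @^-1` (@unit_ball R n) = unit_ball.
  have eN z : enorm (oppv z : C) = enorm z.
    rewrite /enorm !Re_herm; congr Num.sqrt; apply: eq_bigr => j _.
    by rewrite mxE; case: (z ord0 j) => a b /=; rewrite !sqrrN.
  by apply/seteqP; split=> z /=; rewrite /unit_ball /= eN.
rewrite oppb in ex.
have b0 := @volume_unit_ball_gt0 R m; have b1 := @volume_unit_ball_lty R m.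
apply: (mule_cancel b0 b1).
have nub : nu unit_ball = volume (@unit_ball R n).
  rewrite nuE; congr (volume _).
  by apply/seteqP; split=> z /=; rewrite /unit_ball /= enorm_isometry.
rewrite -{1}nub -nuE.
rewrite ex.
reflexivity.
Qed.

End isometry.

Section regularity.
Context (R : realType) (m : nat).
Local Notation n := m.+1.
Local Notation C := (Cn R n).
Local Notation normc := Normc.normc.
Implicit Types (x z : C) (r : R).

Definition e1 : C := \row_j (j == ord0)%:R.

Lemma herm_e1 z : herm z e1 = z ord0 ord0.
Proof.
rewrite /herm (bigD1 ord0)//= big1 ?addr0.
  by rewrite (_ : e1 ord0 ord0 = 1) ?mxE ?eqxx// conjc1 mulr1.
move=> j /negbTE j0; rewrite (_ : e1 ord0 j = 0) ?mxE ?j0//.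
by rewrite conjc0 mulr0.
Qed.

Lemma enorm_e1 : enorm e1 = 1.
Proof. by rewrite /enorm herm_e1 mxE/= sqrtr1. Qed.

Lemma measurable_radial_cone x r :
  measurable (@radial R n @^-1` (dball x r `&` unit_sphere) `&` unit_ball).
Proof.
apply: measurableI; last exact: measurable_unit_ball.
rewrite -[X in measurable X]setTI; apply: (@measurable_radial R n measurableT).
apply: measurableI; [exact: measurable_dball|exact: measurable_unit_sphere].
Qed.

(** An isometry taking x to e1 commutes with the radial projection, so balls and
    cones about x are preimages of those about e1. *)
Lemma rotate_ball x r : unit_sphere x ->
  volume (dball x r `&` unit_ball) = volume (dball e1 r `&` unit_ball) /\
  volume (@radial R n @^-1` (dball x r `&` unit_sphere) `&` unit_ball) =
  volume (@radial R n @^-1` (dball e1 r `&` unit_sphere) `&` unit_ball).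
Proof.
move=> x1; have [U [mU addU hU sU <-]] := sphere_transitive x1 enorm_e1.
have eU z : enorm (U z) = enorm z := enorm_isometry hU z.
have dU z : dist (U x) (U z) = dist x z by rewrite /dist hU.
have rU z : (enorm (radial (U z)) = enorm (radial z)) * (dist (U x) (radial (U z)) = dist x (radial z)).
  by rewrite /enorm /dist !(herm_radial, herm_radialr) eU !hU.
split.
  rewrite -[RHS](volume_isometry mU addU hU sU).
    by congr (volume _); apply/seteqP; split=> z /=; rewrite /unit_ball /dball /= eU dU.
  by apply: measurableI; [exact: measurable_dball|exact: measurable_unit_ball].
rewrite -[RHS](volume_isometry mU addU hU sU); last exact: measurable_radial_cone.
by congr (volume _); apply/seteqP; split=> z /=;
  rewrite /unit_ball /dball /unit_sphere /= eU !rU.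
Qed.

Lemma dist_e1 z : dist e1 z = normc (1 - z ord0 ord0).
Proof. by rewrite distC /dist herm_e1. Qed.

Lemma volume_dball_le : exists2 K : R, 0 < K & forall x r, unit_sphere x -> 0 < r ->
  (volume (dball x r `&` unit_ball) <= (K * r `^ (n.+1)%:R)%:E)%E.
Proof.
exists (4 * 8 ^+ m); first by rewrite mulr_gt0 ?exprn_gt0.
move=> x r x1 r0; have [-> _] := rotate_ball r x1.
rewrite powR_mulrn ?(ltW r0)// -volume_outer_box//.
apply: le_measure; rewrite ?inE; [|exact: measurable_axis_box|].
  by apply: measurableI; [exact: measurable_dball|exact: measurable_unit_ball].
by move=> z [[z1 zr] _]; apply: outer_box_sub; rewrite -?dist_e1.
Qed.

Lemma volume_dball_ge : exists2 K : R, 0 < K & forall x r, unit_sphere x -> 0 < r -> r <= 2 ->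
  ((K * r `^ (n.+1)%:R)%:E <= volume (dball x r `&` unit_ball))%E.
Proof.
exists (8^-1 * (4 * n%:R)^-1 ^+ m).
  by rewrite mulr_gt0 ?exprn_gt0 ?invr_gt0 ?mulr_gt0 ?ltr0n.
move=> x r x1 r0 r2; have [-> _] := rotate_ball r x1.
rewrite powR_mulrn ?(ltW r0)// -volume_inner_box//.
apply: le_measure; rewrite ?inE; [exact: measurable_axis_box| |].
  by apply: measurableI; [exact: measurable_dball|exact: measurable_unit_ball].
move=> z /(inner_box_sub r0 r2)[z1 zr]; split=> //.
by split; rewrite ?dist_e1 ?ltW.
Qed.

Lemma sigma_dballE x r : sigma (dball x r `&` unit_sphere) =
  ((fine (volume (@unit_ball R n)))^-1%:E *
   volume (@radial R n @^-1` (dball x r `&` unit_sphere) `&` unit_ball))%E.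
Proof. by []. Qed.

Lemma sigma_dball_le : exists2 K : R, 0 < K & forall x r, unit_sphere x -> 0 < r ->
  (sigma (dball x r `&` unit_sphere) <= (K * r `^ n%:R)%:E)%E.
Proof.
have b0 : 0 < fine (volume (@unit_ball R n)).
  by rewrite fine_gt0// volume_unit_ball_gt0 volume_unit_ball_lty.
exists ((fine (volume (@unit_ball R n)))^-1 * (4 * 8 ^+ m)).
  by rewrite mulr_gt0 ?invr_gt0 ?mulr_gt0 ?exprn_gt0.
move=> x r x1 r0; rewrite sigma_dballE; have [_ ->] := rotate_ball r x1.
rewrite powR_mulrn ?(ltW r0)// -mulrA EFinM lee_pmul2l ?lte_fin ?invr_gt0//.
rewrite -volume_cone_outer_box//.
apply: le_measure; rewrite ?inE; [exact: measurable_radial_cone|exact: measurable_axis_box|].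
move=> z [[[_ zr] _] zb]; apply: cone_outer_box_sub => //.
by rewrite -dist_e1.
Qed.

Lemma sigma_dball_ge : exists2 K : R, 0 < K & forall x r, unit_sphere x -> 0 < r -> r <= 2 ->
  ((K * r `^ n%:R)%:E <= sigma (dball x r `&` unit_sphere))%E.
Proof.
have b0 : 0 < fine (volume (@unit_ball R n)).
  by rewrite fine_gt0// volume_unit_ball_gt0 volume_unit_ball_lty.
exists ((fine (volume (@unit_ball R n)))^-1 * (80^-1 * (10 * n%:R)^-1 ^+ m)).
  by rewrite !mulr_gt0 ?invr_gt0 ?exprn_gt0 ?invr_gt0 ?mulr_gt0 ?ltr0n.
move=> x r x1 r0 r2; rewrite sigma_dballE; have [_ ->] := rotate_ball r x1.
rewrite powR_mulrn ?(ltW r0)// -mulrA EFinM lee_pmul2l ?lte_fin ?invr_gt0//.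
rewrite -volume_cone_inner_box//.
apply: le_measure; rewrite ?inE; [exact: measurable_axis_box|exact: measurable_radial_cone|].
move=> z /(cone_inner_box_sub r0 r2)[z1 z0 zr]; split=> //; split.
  by split; rewrite ?dist_e1 ?enorm_radial.
exact: enorm_radial.
Qed.
End regularity.

(** * Packing and covering by separated sets *)

Section separated.
Context (R : realType) (n : nat).
Local Notation C := (Cn R n).
Implicit Types (x y z : C) (A B E : set C) (p : seq C) (r d e : R).

Definition sep_seq A d p := [/\ uniq p, {in p, forall y, A y} &
  {in p &, forall y z, y != z -> d <= dist y z}].

Lemma sub_sep_seq A B d p : A `<=` B -> sep_seq A d p -> sep_seq B d p.
Proof. by move=> AB [up Ap sp]; split=> // y /Ap /AB. Qed.

Lemma le_sep_seq A d e p : e <= d -> sep_seq A d p -> sep_seq A e p.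
Proof.
move=> ed [up Ap sp]; split=> // y z yp zp yz.
exact: le_trans ed (sp _ _ yp zp yz).
Qed.

Lemma sep_seq_filter A B d p (P : pred C) : sep_seq A d p ->
  (forall y, y \in p -> P y -> B y) -> sep_seq B d [seq y <- p | P y].
Proof.
move=> [up Ap sp] PB; split; first exact: filter_uniq.
  by move=> y; rewrite mem_filter => /andP[Py yp]; exact: PB.
by move=> y z; rewrite !mem_filter => /andP[_ yp] /andP[_ zp]; exact: sp.
Qed.

Lemma sep_seq_size1 A d p : (forall x y, A x -> A y -> dist x y < d) ->
  sep_seq A d p -> (size p <= 1)%N.
Proof.
case: p => [|y [|z p]] // Ad [/= /andP[ynz _] Ap sp].
have yin : y \in [:: y, z & p] by rewrite inE eqxx.
have zin : z \in [:: y, z & p] by rewrite !inE eqxx orbT.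
have yz : y != z by move: ynz; rewrite inE negb_or => /andP[].
have := sp _ _ yin zin yz; rewrite leNgt Ad//.
  exact: Ap.
exact: Ap.
Qed.

(** A separated set of maximal size is a net. *)
Lemma maximal_sep_seq A d (N : R) : A `<=` unit_sphere -> 0 < d ->
  (forall p, sep_seq A d p -> (size p)%:R <= N) ->
  exists2 p, sep_seq A d p & forall z, A z -> exists2 y, y \in p & dist z y < d.
Proof.
move=> AS d0 bnd.
pose P k := `[< exists2 p, sep_seq A d p & size p = k >].
have P0 : exists k, P k by exists 0%N; apply/asboolP; exists [::].
have Pb k : P k -> (k <= Num.truncn N)%N.
  move=> /asboolP[p /bnd pN <-]; rewrite truncn_ge_nat//.
  by apply: le_trans pN; rewrite ler0n.
case: (ex_maxnP P0 Pb) => k /asboolP[p sp pk] kmax.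
exists p => // z Az; apply: contrapT => hz.
have far y : y \in p -> d <= dist z y.
  by move=> yp; rewrite leNgt; apply/negP => dzy; apply: hz; exists y.
have : P k.+1.
  apply/asboolP; exists (z :: p); last by rewrite /= pk.
  case: sp => up Ap sp; split.
  - rewrite /= up andbT; apply/negP => zp.
    by have := far _ zp; rewrite dist_self ?leNgt ?d0//; exact: AS.
  - by move=> y; rewrite inE => /predU1P[->//|]; exact: Ap.
  - move=> y w; rewrite !inE => /predU1P[->|yp] /predU1P[->|wp]; rewrite ?eqxx// => yw.
    + exact: far.
    + by rewrite distC; exact: far.
    + exact: sp.
by move=> /kmax; rewrite ltnn.
Qed.

Variable mu : {measure set C -> \bar R}.

(** Volume counting: the sets G y attached to separated points y are disjoint,
    since the square root of the distance is a metric. *)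
Lemma packing A B d p (G : C -> set C) (c : R) : A `<=` unit_sphere -> 0 < d ->
  sep_seq A d p -> measurable B -> (forall y, y \in p -> measurable (G y)) ->
  (forall y, y \in p -> G y `<=` B `&` dball y (d / 4)) ->
  (forall y, y \in p -> (c%:E <= mu (G y))%E) ->
  (((size p)%:R * c)%:E <= mu B)%E.
Proof.
move=> AS d0; elim: p B => [|y p ih] B [up Ap sp] mB mG GB Gc.
  by rewrite mul0r measure_ge0.
have yin : y \in y :: p by rewrite inE eqxx.
have my := mG y yin; have GBy := GB y yin.
rewrite (measureDI _ mB my) (setIidr (fun z Gz => (GBy z Gz).1)).
rewrite /= -natr1 mulrDl mul1r EFinD; apply: leeD; last exact: Gc.
have sub z : z \in p -> z \in y :: p by rewrite inE => ->; rewrite orbT.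
apply: ih.
- split; first by case/andP: up.
  + by move=> z /sub; exact: Ap.
  + by move=> z w /sub zp /sub wp; exact: sp.
- exact: measurableD.
- by move=> z /sub; exact: mG.
- move=> z zp w Gzw; have [Bw [w1 wz]] := GB z (sub _ zp) w Gzw.
  split=> //; split=> // Gyw; have [_ [_ wy]] := GBy w Gyw.
  have yz : y != z by apply/eqP => yz; move: up; rewrite /= yz zp.
  have := sp _ _ yin (sub _ zp) yz; rewrite leNgt => /negP; apply.
  have y1 : enorm y <= 1 by rewrite (AS _ (Ap y yin)).
  have z1 : enorm z <= 1 by rewrite (AS _ (Ap z (sub _ zp))).
  have dE : d = (Num.sqrt d) ^+ 2 by rewrite sqr_sqrtr// ltW.
  have d4 : d / 4 = (Num.sqrt d / 2) ^+ 2.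
    by rewrite expr_div_n -dE; congr (_ / _); rewrite -natrX.
  have s0 : 0 <= Num.sqrt d / 2 by rewrite divr_ge0 ?sqrtr_ge0.
  rewrite d4 !dist_lt_sqr// in wz wy.
  rewrite dE dist_lt_sqr ?sqrtr_ge0//.
  apply: le_lt_trans (rho_triangle y1 w1 z1) _.
  by rewrite (rhoC w z); lra.
- by move=> z /sub; exact: Gc.
Qed.

Lemma cover_measure B p (G : C -> set C) (c : R) : measurable B ->
  (forall y, y \in p -> measurable (G y)) ->
  (forall z, B z -> exists2 y, y \in p & G y z) ->
  (forall y, y \in p -> (mu (G y) <= c%:E)%E) ->
  (mu B <= ((size p)%:R * c)%:E)%E.
Proof.
elim: p B => [|y p ih] B mB mG BG Gc.
  have -> : B = set0 by rewrite -subset0 => z /BG[].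
  by rewrite measure0 mul0r.
have yin : y \in y :: p by rewrite inE eqxx.
have sub z : z \in p -> z \in y :: p by rewrite inE => ->; rewrite orbT.
have my := mG y yin.
rewrite (measureDI _ mB my) /= -natr1 mulrDl mul1r EFinD; apply: leeD.
  apply: ih.
  - exact: measurableD.
  - by move=> z /sub; exact: mG.
  - move=> z [Bz nG]; have [w] := BG z Bz.
    by rewrite inE => /predU1P[->//|wp] Gw; exists w.
  - by move=> z /sub; exact: Gc.
apply: le_trans (Gc y yin); apply: le_measure; rewrite ?inE//.
exact: measurableI.
Qed.

End separated.

Section ratio.
Context (R : realType).
Implicit Types (q s r e : R).

(** The common shape of all the bounds: (r/e)^s pieces of measure e^q. *)
Lemma powR_pieces q s r e : 0 < r -> 0 < e ->
  e `^ q * (r / e) `^ s = r `^ s * e `^ (q - s).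
Proof.
move=> r0 e0; rewrite powRM ?invr_ge0 ?ltW// mulrCA; congr (_ * _).
rewrite -powR_inv1 ?ltW// -powRrM mulN1r -powRD//.
by apply/implyP => _; rewrite gt_eqF.
Qed.

Lemma powR_pieces_self q r e : 0 < r -> 0 < e -> e `^ q * (r / e) `^ q = r `^ q.
Proof. by move=> r0 e0; rewrite powR_pieces// subrr powRr0 mulr1. Qed.

Lemma powR_scale q c r : 0 < c -> 0 < r -> (c * r) `^ q = c `^ q * r `^ q.
Proof. by move=> c0 r0; rewrite powRM ?ltW. Qed.

Lemma powR_ratio_ge1 s r e : 0 <= s -> 0 < e -> e <= r -> 1 <= (r / e) `^ s.
Proof.
move=> s0 e0 er; rewrite -(powRr0 (r / e)) ler_powR//.
by rewrite ler_pdivlMr// mul1r.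
Qed.
End ratio.

(** * Neighbourhoods of E and counting bounds *)

Section tubes.
Context (R : realType) (n : nat).
Local Notation C := (Cn R n).
Implicit Types (x y z : C) (A B E D : set C) (p : seq C) (r d e g q s K : R).

Definition tube E e : set C := [set z | (dist_set z E < e%:E)%E].

Lemma tubeP E e z : tube E e z <-> exists2 y, E y & dist z y < e.
Proof.
split=> [/ereal_inf_lt[_ [y Ey <-]]|[y Ey dzy]].
  by rewrite lte_fin; exists y.
apply: le_lt_trans (_ : (dist z y)%:E < _)%E; last by rewrite lte_fin.
by apply: ereal_inf_lbound; exists y.
Qed.

Lemma dist_set_ge0 z E : (0 <= dist_set z E)%E.
Proof. by apply: le_ereal_inf_tmp => _ [y _ <-]; rewrite lee_fin dist_ge0. Qed.

Definition ahlfors_regular (mu : set C -> \bar R) D q :=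
  [/\ measurable D, D `<=` [set z | enorm z <= 1],
   exists2 K, 0 < K & forall x r, unit_sphere x -> 0 < r ->
     (mu (dball x r `&` D) <= (K * r `^ q)%:E)%E &
   exists2 K, 0 < K & forall x r, unit_sphere x -> 0 < r -> r <= 2 ->
     ((K * r `^ q)%:E <= mu (dball x r `&` D))%E].

(** As in the class of sets defining the upper dimension, but for radii of any
    size. *)
Definition counting_bound g E := exists2 K, 0 < K & forall x r d p,
  E x -> 0 < d -> d <= r -> sep_seq (E `&` dball x r) d p ->
  (size p)%:R <= K * (r / d) `^ g.

Lemma counting_bound_le g g' E : g <= g' -> counting_bound g E -> counting_bound g' E.
Proof.
move=> gg' [K K0 hK]; exists K => // x r d p Ex d0 dr sp.
apply: le_trans (hK x r d p Ex d0 dr sp) _.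
by rewrite ler_wpM2l ?(ltW K0)// ler_powR// ler_pdivlMr// mul1r.
Qed.

Section regular.
Variables (mu : {measure set C -> \bar R}) (D : set C) (q : R).
Hypothesis reg : ahlfors_regular mu D q.
Hypothesis q0 : 0 <= q.

Let mD : measurable D. Proof. by case: reg. Qed.
Let D1 z : D z -> enorm z <= 1. Proof. by case: reg => _ + _ _; exact. Qed.

(** The balls of radius d / 4 about the points of p lie in any set B containing
    the d-neighbourhood of E in the ball of radius 4 r; beyond the diameter 2 of
    the sphere only singletons are separated, which is the first alternative. *)
Lemma sep_count : exists2 k, 0 < k & forall E x r d p B, E `<=` unit_sphere ->
  E x -> 0 < d -> d <= r -> sep_seq (E `&` dball x r) d p -> measurable B ->
  dball x (4 * r) `&` D `&` tube E d `<=` B ->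
  (size p <= 1)%N \/ (((size p)%:R * (k * d `^ q))%:E <= mu B)%E.
Proof.
have [_ _ _ [k k0 hk]] := reg.
exists (k * 4^-1 `^ q); first by rewrite mulr_gt0// powR_gt0.
move=> E x r d p B ES Ex d0 dr sp mB sB.
have r0 : 0 < r := lt_le_trans d0 dr.
have [d2|d2] := ltP 2 d.
  left; apply: sep_seq_size1 sp => y z [Ey _] [Ez _].
  by apply: le_lt_trans d2; apply: dist_le2; rewrite ES.
right; have [up Ap _] := sp.
apply: (packing (G := fun y => dball y (d / 4) `&` D) _ d0 sp) => //.
- by move=> y [/ES].
- by move=> y yp; apply: measurableI => //; exact: measurable_dball.
- move=> y yp z [[z1 zy] Dz]; split=> //; apply: sB.
  have [Ey [y1 xy]] := Ap y yp.
  split; last by apply/tubeP; exists y => //; rewrite distC; lra.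
  split=> //; split=> //.
  have rE : (Num.sqrt r) ^+ 2 = r by rewrite sqr_sqrtr// ltW.
  have s0 := sqrtr_ge0 r.
  have -> : 4 * r = (2 * Num.sqrt r) ^+ 2 by rewrite exprMn rE; ring.
  have hy : dist y z < (Num.sqrt r) ^+ 2 by rewrite rE; lra.
  rewrite -rE in xy; rewrite !dist_lt_sqr ?mulr_ge0// in hy xy *.
  apply: le_lt_trans (rho_triangle _ y1 z1) _; first by rewrite ES.
  by lra.
- move=> y yp; have [Ey _] := Ap y yp.
  rewrite -mulrA -powR_scale ?invr_gt0// (mulrC 4^-1).
  by apply: hk; [exact: ES|rewrite divr_gt0|lra].
Qed.

(** Any subset of the sphere has at most the full dimension q. This is what makes
    maximal separated sets exist at every scale. *)
Lemma counting_regular E : E `<=` unit_sphere -> counting_bound q E.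
Proof.
move=> ES; have [k k0 hk] := sep_count; have [_ _ [K K0 hK] _] := reg.
exists (1 + K * 4 `^ q / k).
  by rewrite addr_gt0// divr_gt0// mulr_gt0// powR_gt0.
move=> x r d p Ex d0 dr sp; have r0 : 0 < r := lt_le_trans d0 dr.
have rd1 := powR_ratio_ge1 q0 d0 dr.
have c0 : 0 <= K * 4 `^ q / k by rewrite divr_ge0 ?mulr_ge0 ?powR_ge0 ?ltW.
have mB : measurable (dball x (4 * r) `&` D).
  by apply: measurableI => //; exact: measurable_dball.
have [p1|] := hk E x r d p _ ES Ex d0 dr sp mB (@subIsetl _ _ _).
  apply: (@le_trans _ _ 1); first by rewrite (ler_nat _ _ 1%N).
  by rewrite -[leLHS]mulr1; apply: ler_pM => //; rewrite lerDl.
move=> h; have {h} := le_trans h (hK x (4 * r) (ES _ Ex) (mulr_gt0 (ltr0Sn _ _) r0)).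
rewrite lee_fin powR_scale// => h.
have hd : 0 < d `^ q by exact: powR_gt0.
rewrite mulrDl mul1r (@le_trans _ _ (K * 4 `^ q / k * (r / d) `^ q))//; last first.
  by rewrite lerDr powR_ge0.
rewrite -(@ler_pM2r _ (k * d `^ q)); last by rewrite mulr_gt0.
apply: le_trans h _; rewrite -(powR_pieces_self q r0 d0) le_eqVlt; apply/orP; left.
by apply/eqP; field; rewrite gt_eqF.
Qed.

(** A tube around E is a countable union of balls, because maximal separated
    subsets of E at scales tending to 0 form a countable dense subset. *)
Lemma measurable_tube E e : E `<=` unit_sphere -> measurable (D `&` tube E e).
Proof.
move=> ES; have [K K0 hK] := counting_regular ES.
have [[x0 Ex0]|E0] := pselect (exists x, E x); last first.
  rewrite (_ : _ `&` _ = set0) ?measurable0// -subset0 => z [_ /tubeP[y Ey _]].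
  by apply: E0; exists y.
have sub3 : E `<=` E `&` dball x0 3.
  move=> y Ey; have y1 : enorm y <= 1 by rewrite ES.
  split=> //; split=> //; apply: (@le_lt_trans _ _ 2); last by rewrite ltr_nat.
  by apply: dist_le2 => //; rewrite ES.
have net k : exists p, sep_seq E (k.+1%:R^-1) p /\
    forall z, E z -> exists2 y, y \in p & dist z y < k.+1%:R^-1.
  have d0 : 0 < k.+1%:R^-1 :> R by rewrite invr_gt0 ltr0n.
  have d3 : k.+1%:R^-1 <= 3 :> R.
    apply: (@le_trans _ _ 1); last by rewrite (ler_nat _ 1 3).
    by rewrite invf_le1 ?ltr0n// (ler_nat _ 1).
  have [p sp pz] := maximal_sep_seq ES d0 (fun p sp =>
    hK x0 3 _ p Ex0 d0 d3 (sub_sep_seq sub3 sp)).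
  by exists p.
have [f hf] := choice net.
rewrite (_ : D `&` tube E e = \bigcup_k
   (D `&` \big[setU/set0]_(y <- f k) [set z | dist z y < e])).
  apply: bigcupT_measurable => k; apply: measurableI => //.
  apply: bigsetU_measurable => y _.
  rewrite (_ : [set _ | _] = setT `&` dist y @^-1` `]-oo, e[).
    exact: measurable_dist.
  by rewrite setTI; apply/seteqP; split=> z /=; rewrite in_itv/= distC.
apply/seteqP; split=> z.
  move=> [Dz /tubeP[y Ey zy]].
  pose t := Num.sqrt e - rho z y.
  have e0 : 0 <= e by apply: le_trans (ltW zy); exact: dist_ge0.
  have eE : Num.sqrt e ^+ 2 = e by rewrite sqr_sqrtr.
  have zy' := zy; rewrite -eE dist_lt_sqr ?sqrtr_ge0// in zy'.
  have t0 : 0 < t by rewrite subr_gt0.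
  have [k hk] : exists k : nat, k.+1%:R^-1 <= t ^+ 2.
    exists (Num.truncn (t ^+ 2)^-1).
    rewrite -[leRHS]invrK lef_pV2 ?posrE ?invr_gt0 ?exprn_gt0 ?ltr0n//.
    exact/ltW/truncnS_gt.
  exists k => //; split=> //; have [[_ Ef _] /(_ y Ey)[w wf yw]] := hf k.
  rewrite -bigcup_seq; exists w => //=.
  rewrite -eE dist_lt_sqr ?sqrtr_ge0//.
  have w1 : enorm w <= 1 by rewrite (ES _ (Ef _ wf)).
  have y1 : enorm y <= 1 by rewrite ES.
  apply: le_lt_trans (rho_triangle (D1 Dz) y1 w1) _.
  have := lt_le_trans yw hk; rewrite dist_lt_sqr ?(ltW t0)//.
  by rewrite /t; lra.
move=> [k _ [Dz]]; rewrite -bigcup_seq => -[y /= yf zy].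
by split=> //; apply/tubeP; exists y => //; have [[_ + _] _] := hf k; apply.
Qed.

(** The disjoint balls of measure about d^q fit into the d-neighbourhood. *)
Lemma counting_of_tube E s K : E `<=` unit_sphere -> 0 <= s -> 0 <= K ->
  (forall x r e, E x -> 0 < r -> 0 < e -> e < r ->
    (mu (dball x r `&` D `&` tube E e) <= (K * (e `^ q * (r / e) `^ s))%:E)%E) ->
  counting_bound s E.
Proof.
move=> ES s0 K0 hK; have [k k0 hk] := sep_count.
have c0 : 0 <= K * 4 `^ s / k by rewrite divr_ge0 ?mulr_ge0 ?powR_ge0 ?(ltW k0).
exists (1 + K * 4 `^ s / k); first by apply: lt_le_trans ltr01 _; rewrite lerDl.
move=> x r d p Ex d0 dr sp; have r0 : 0 < r := lt_le_trans d0 dr.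
have rd1 := powR_ratio_ge1 s0 d0 dr.
have mB : measurable (dball x (4 * r) `&` D `&` tube E d).
  by rewrite -setIA; apply: measurableI; [exact: measurable_dball|exact: measurable_tube].
have [p1|] := hk E x r d p _ ES Ex d0 dr sp mB (@subset_refl _ _).
  apply: (@le_trans _ _ 1); first by rewrite (ler_nat _ _ 1%N).
  by rewrite -[leLHS]mulr1; apply: ler_pM => //; rewrite lerDl.
have r4 : d < 4 * r by lra.
move=> h; have {h} := le_trans h (hK x (4 * r) d Ex (mulr_gt0 (ltr0Sn _ _) r0) d0 r4).
rewrite lee_fin => h; have hd : 0 < d `^ q by exact: powR_gt0.
rewrite -mulrA (powR_scale _ (ltr0Sn _ 3)) ?divr_gt0// in h.
rewrite mulrDl mul1r (@le_trans _ _ (K * 4 `^ s / k * (r / d) `^ s))//; last first.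
  by rewrite lerDr powR_ge0.
rewrite -(@ler_pM2r _ (k * d `^ q)); last by rewrite mulr_gt0.
apply: le_trans h _; rewrite le_eqVlt; apply/orP; left.
by apply/eqP; field; rewrite gt_eqF.
Qed.

(** The e-neighbourhood is covered by balls of radius 4 e about an e-net of E.
    The counting bound is centred at points of E, so x is first replaced by a
    point of E near it, which multiplies the radius by 16. *)
Lemma tube_of_counting E g : E `<=` unit_sphere -> counting_bound g E ->
  exists2 K, 0 < K & forall x r e, unit_sphere x -> 0 < r -> 0 < e -> e < r ->
    (mu (dball x r `&` D `&` tube E e) <= (K * (e `^ q * (r / e) `^ g))%:E)%E.
Proof.
move=> ES [N N0 hN]; have [_ _ [K K0 hK] _] := reg.
exists (N * 16 `^ g * (K * 4 `^ q)); first by rewrite !mulr_gt0 ?powR_gt0.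
move=> x r e Sx r0 e0 er.
have x1 : enorm x <= 1 by rewrite Sx.
set Z := _ `&` _.
have mZ : measurable Z.
  by rewrite /Z -setIA; apply: measurableI; [exact: measurable_dball|exact: measurable_tube].
have rE : (Num.sqrt r) ^+ 2 = r by rewrite sqr_sqrtr// ltW.
have eE : (Num.sqrt e) ^+ 2 = e by rewrite sqr_sqrtr// ltW.
have sr := sqrtr_ge0 r; have se := sqrtr_ge0 e.
have ser : Num.sqrt e <= Num.sqrt r by rewrite ler_wsqrtr// ltW.
have near y z : enorm z <= 1 -> E y -> dist x z < r -> dist z y < e -> dist x y < 4 * r.
  move=> z1 Ey xz zy; have y1 : enorm y <= 1 by rewrite ES.
  have -> : 4 * r = (2 * Num.sqrt r) ^+ 2 by rewrite exprMn rE; ring.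
  rewrite -rE in xz; rewrite -eE in zy.
  rewrite !dist_lt_sqr ?mulr_ge0// in xz zy *.
  by apply: le_lt_trans (rho_triangle x1 z1 y1) _; lra.
have [[e0' [Ee0 xe0]]|noE] := pselect (exists y, E y /\ dist x y < 4 * r); last first.
  rewrite (_ : Z = set0) ?measure0 ?lee_fin ?mulr_ge0 ?powR_ge0 ?(ltW N0) ?(ltW K0)//.
  rewrite -subset0 => z [[[z1 xz] _] /tubeP[y Ey zy]]; apply: noE.
  by exists y; split=> //; exact: near zy.
have sub16 : E `&` dball x (4 * r) `<=` E `&` dball e0' (16 * r).
  move=> y [Ey [y1 xy]]; split=> //; split=> //.
  have h4 : 4 * r = (2 * Num.sqrt r) ^+ 2 by rewrite exprMn rE; ring.
  have -> : 16 * r = (4 * Num.sqrt r) ^+ 2 by rewrite exprMn rE; ring.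
  rewrite h4 !dist_lt_sqr ?mulr_ge0// in xy xe0 *.
  apply: le_lt_trans (rho_triangle _ x1 y1) _; first by rewrite ES.
  by rewrite rhoC; lra.
have e16 : e <= 16 * r by lra.
have AS : E `&` dball x (4 * r) `<=` unit_sphere by move=> y [/ES].
have [p sp pz] := maximal_sep_seq AS e0 (fun p sp =>
    hN e0' (16 * r) e p Ee0 e0 e16 (sub_sep_seq sub16 sp)).
have sz := hN e0' (16 * r) e p Ee0 e0 e16 (sub_sep_seq sub16 sp).
have [_ Ap _] := sp.
apply: le_trans (_ : (((size p)%:R * (K * (4 * e) `^ q))%:E <= _)%E).
  apply: (cover_measure (G := fun y => dball y (4 * e) `&` D)) => //.
  - by move=> y _; apply: measurableI => //; exact: measurable_dball.
  - move=> z [[[z1 xz] Dz] /tubeP[y Ey zy]].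
    have y1 : enorm y <= 1 by rewrite ES.
    have [|w wp yw] := pz y; first by split=> //; split=> //; exact: near zy.
    exists w => //; split=> //; split=> //.
    have w1 : enorm w <= 1 by rewrite (AS _ (Ap _ wp)).
    have -> : 4 * e = (2 * Num.sqrt e) ^+ 2 by rewrite exprMn eE; ring.
    rewrite -eE in zy yw; rewrite (distC w) !dist_lt_sqr ?mulr_ge0// in zy yw *.
    by apply: le_lt_trans (rho_triangle z1 y1 w1) _; lra.
  - by move=> y yp; apply: hK; [exact: AS (Ap _ yp)|rewrite mulr_gt0].
rewrite lee_fin powR_scale//.
rewrite -mulrA (powR_scale _ _ (_ : 0 < r / e)) ?divr_gt0// in sz.
have -> : N * 16 `^ g * (K * 4 `^ q) * (e `^ q * (r / e) `^ g) =
   (N * (16 `^ g * (r / e) `^ g)) * (K * (4 `^ q * e `^ q)) by ring.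
by rewrite ler_wpM2r// !mulr_ge0 ?powR_ge0 ?(ltW K0).
Qed.

End regular.
End tubes.

(** * Layer-cake estimates *)

Lemma inv_powR_le (R : realType) (a t e : R) : 0 <= a -> 0 < t -> t <= e ->
  e^-1 `^ a <= t^-1 `^ a.
Proof.
move=> a0 t0 te; have e0 : 0 < e := lt_le_trans t0 te.
apply: ge0_ler_powR => //; rewrite ?nnegrE ?invr_ge0 ?(ltW t0) ?(ltW e0)//.
by rewrite lef_pV2.
Qed.

Lemma half_powR_lt1 (R : realType) (p : R) : 0 < p -> 2^-1 `^ p < 1.
Proof.
move=> p0; have : 2^-1 `^ p < 1 `^ p.
  by rewrite gt0_ltr_powR ?nnegrE ?invr_ge0// invf_lt1// ltr1n.
by rewrite powR1.
Qed.

Section integrals.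
Context d (T : measurableType d) (R : realType).
Variable mu : {measure set T -> \bar R}.
Implicit Types (X A : set T) (f g : T -> \bar R).
Local Open Scope ereal_scope.

(** Monotonicity holds for the lower integral of arbitrary functions; it is used
    for the integrand of the counting function, and for the logarithm, whose
    negative part need not be discussed. *)
Lemma le_integral_any X f g : (forall x, X x -> f x <= g x) ->
  \int[mu]_(x in X) f x <= \int[mu]_(x in X) g x.
Proof.
move=> fg; have fg' x : (f \_ X) x <= (g \_ X) x.
  by rewrite /patch; case: ifPn => // xX; apply: fg; rewrite -inE.
rewrite /integral; apply: leeB; apply: ereal_sup_le => _ [h hle <-].
  exists h => // x; apply: le_trans (hle x) _.
  by apply: (@funepos_le _ _ setT) => //; rewrite ?inE// => y _; exact: fg'.
exists h => // x; apply: le_trans (hle x) _.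
by apply: (@funeneg_le _ _ setT) => //; rewrite ?inE// => y _; exact: fg'.
Qed.

Lemma integral_indic_in X A (c : R) : measurable X -> measurable A -> A `<=` X -> (0 <= c)%R ->
  \int[mu]_(x in X) (c%:E * (\1_A x)%:E) = c%:E * mu A.
Proof.
move=> mX mA AX c0; rewrite ge0_integralZl//.
- by rewrite integral_indic// setIidl.
- by apply/measurable_EFinP; exact: measurable_indic.
Qed.

(** Chebyshev's inequality: f^-a is at least e^-a where f < e. *)
Lemma chebyshev_neg_power X f (a e B : R) : measurable X -> measurable (X `&` [set x | f x < e%:E]) ->
  (0 < a)%R -> (0 < e)%R -> (forall x, X x -> 0 <= f x) ->
  \int[mu]_(x in X) ((f x)^-1 `^ a) <= B%:E ->
  mu (X `&` [set x | f x < e%:E]) <= (B * e `^ a)%:E.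
Proof.
move=> mX mA a0 e0 f0 hB.
have ea0 : (0 < e^-1 `^ a)%R by rewrite powR_gt0// invr_gt0.
have : ((e^-1 `^ a)%:E * mu (X `&` [set x | f x < e%:E]) <= B%:E)%E.
  rewrite -(integral_indic_in mX mA (@subIsetl _ _ _) (ltW ea0)).
  apply: le_trans hB; apply: le_integral_any => x Xx; rewrite indicE.
  have [/set_mem[_ /=]|_] := boolP (x \in _); last by rewrite mule0 poweR_ge0.
  rewrite mule1; have := f0 x Xx; case: (f x) => [t| |] //; rewrite lee_fin => t0 te.
  rewrite lte_fin in te; have [t00|t00] := eqVneq t 0%R.
    by rewrite t00 inve0 poweRyr ?leey// gt_eqF.
  have tp : (0 < t)%R by rewrite lt_neqAle eq_sym t00.
  rewrite inver (negbTE t00) poweR_EFin lee_fin inv_powR_le//; exact: ltW.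
case: (mu _) (measure_ge0 mu (X `&` [set x | f x < e%:E])) => [u| |] //.
  rewrite !lee_fin => u0 h.
  rewrite -(ler_pM2l ea0); apply: le_trans h _.
  by rewrite mulrCA -powRM ?invr_ge0 ?(ltW e0)// mulVf ?gt_eqF// powR1 mulr1.
  by move=> _; rewrite gt0_muley ?lte_fin// leye_eq.
by move=> _ _; rewrite leNye.
Qed.

Lemma geometric_sum_le (t : R) N : (0 <= t)%R -> (t < 1)%R ->
  (\sum_(0 <= i < N) t ^+ i <= (1 - t)^-1)%R.
Proof.
move=> t0 t1; have t1' : (0 < 1 - t)%R by rewrite subr_gt0.
rewrite -[leRHS]mul1r ler_pdivlMr// big_mkord mulrC.
rewrite -[leLHS]opprK -mulNr opprB -subrX1 opprB.
by rewrite lerBlDr lerDl exprn_ge0.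
Qed.

(** The sum of a geometric series of first term 2^a and ratio 2^-(q - s - a): on
    the shell 2^-(j+1) r <= f < 2^-j r the power f^-a is at most 2^a (2^-j r)^-a. *)
Definition layer_const (a q s : R) : R :=
  (2 `^ a / (1 - (2^-1) `^ (q - s - a)))%R.

Lemma layer_const_gt0 a q s : (a < q - s)%R -> (0 < layer_const a q s)%R.
Proof.
move=> aqs; rewrite divr_gt0 ?powR_gt0// subr_gt0.
by apply: half_powR_lt1; rewrite subr_gt0.
Qed.

(** Layer-cake estimate: the shells on which f is about 2^-j r have measures
    decaying geometrically faster than f^-a grows on them. The zero set of f
    belongs to all the layers, so the majorising series diverges there. *)
Lemma layer_integral X f (K a q s r : R) : measurable X ->
  (forall e : R, measurable (X `&` [set x | f x < e%:E])) ->
  (forall x, X x -> 0 <= f x) -> (0 < r)%R -> (0 <= K)%R -> (0 < a)%R -> (a < q - s)%R ->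
  mu X <= (K * r `^ q)%:E ->
  (forall e : R, (0 < e)%R -> (e < r)%R ->
     mu (X `&` [set x | f x < e%:E]) <= (K * (e `^ q * (r / e) `^ s))%:E) ->
  \int[mu]_(x in X) ((f x)^-1 `^ a) <= (K * layer_const a q s * r `^ (q - a))%:E.
Proof.
move=> mX mf f0 r0 K0 a0 aqs hX hf.
pose u j : R := (2^-1 ^+ j)%R.
have u0 j : (0 < u j)%R by rewrite exprn_gt0// invr_gt0.
have ru0 j : (0 < r * u j)%R by rewrite mulr_gt0.
pose L j : set T := X `&` [set x | (j == 0%N) || (f x < (r * u j)%:E)].
have LE0 : L 0%N = X by rewrite /L; apply/seteqP; split=> x; [case|].
have LES j : L j.+1 = X `&` [set x | f x < (r * u j.+1)%:E] by [].
have mL j : measurable (L j) by case: j => [|j]; [rewrite LE0|rewrite LES].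
pose c j : R := ((r * u j.+1)^-1 `^ a)%R.
have c0 j : (0 < c j)%R by rewrite powR_gt0// invr_gt0.
have muL j : mu (L j) <= (K * ((r * u j) `^ q * (r / (r * u j)) `^ s))%:E.
  case: j => [|j].
    by rewrite LE0 /u expr0 mulr1 divff ?gt_eqF// powR1 mulr1.
  rewrite LES; apply: hf => //.
  by rewrite gtr_pMr// exprn_ilt1// ?invf_lt1 ?ltr1n// invr_ge0.
pose t : R := (2^-1 `^ (q - s - a))%R.
have t0 : (0 <= t)%R by exact: powR_ge0.
have t1 : (t < 1)%R.
  by apply: half_powR_lt1; rewrite subr_gt0.
have termE j : (c j * (K * ((r * u j) `^ q * (r / (r * u j)) `^ s)) =
    K * 2 `^ a * r `^ (q - a) * t ^+ j)%R.
  have uj : (t ^+ j = u j `^ (q - s - a))%R.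
    have h2 : (0 <= 2^-1 :> R)%R by rewrite invr_ge0.
    by rewrite /t /u -(powR_mulrn j (powR_ge0 _ _)) -(powR_mulrn j h2) powRAC.
  have rE : (r / (r * u j) = (u j)^-1)%R by rewrite invfM mulrA divff ?gt_eqF// mul1r.
  have cE : (c j = 2 `^ a * (r `^ (- a) * u j `^ (- a)))%R.
    have -> : c j = ((2 * (r^-1 * (u j)^-1)) `^ a)%R.
      by rewrite /c /u exprS !invfM invrK; congr (_ `^ a)%R; ring.
    rewrite !powRM ?mulr_ge0 ?invr_ge0 ?(ltW r0) ?(ltW (u0 j))//.
    by rewrite -!powR_inv1 ?(ltW r0) ?(ltW (u0 j))// -!powRrM !mulN1r.
  rewrite uj rE cE -powR_inv1 ?(ltW (u0 j))// -powRrM mulN1r.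
  rewrite powRM ?(ltW r0) ?(ltW (u0 j))//.
  have ne x : (0 < x)%R -> forall b e : R, (x `^ (b + e) = x `^ b * x `^ e)%R.
    by move=> x0 b e; rewrite powRD//; apply/implyP => _; rewrite gt_eqF.
  by rewrite !(ne _ r0) !(ne _ (u0 j)); ring.
pose g x := \sum_(j <oo) (c j)%:E * (\1_(L j) x)%:E.
have term0 x j : 0 <= (c j)%:E * (\1_(L j) x)%:E :> \bar R.
  by rewrite mule_ge0 ?lee_fin ?(ltW (c0 j)).
have fg x : X x -> (f x)^-1 `^ a <= g x.
  move=> Xx; have gj N : \sum_(0 <= j < N) (c j)%:E * (\1_(L j) x)%:E <= g x.
    exact: nneseries_lim_ge.
  have gc j : L j x -> (c j)%:E <= g x.
    move=> Lx; apply: le_trans (gj j.+1); rewrite big_nat_recr//= indicE mem_set// mule1.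
    by rewrite leeDr// sume_ge0.
  have := f0 x Xx; case E : (f x) => [v| |] //; last first.
    by move=> _; rewrite invey poweR_EFin powR0 ?gt_eqF// nneseries_ge0.
  rewrite lee_fin le_eqVlt => /predU1P[v0|v0].
    have -> : g x = +oo.
      apply/eqyP => A A0.
      have Lx j : L j x by split=> //=; rewrite E -v0 lte_fin ru0 orbT.
      apply: le_trans (gj (Num.truncn (A / c 0%N)).+1).
      apply: (@le_trans _ _ (\sum_(0 <= j < (Num.truncn (A / c 0%N)).+1) (c 0%N)%:E)).
        rewrite sumEFin lee_fin sumr_const_nat subn0 -mulr_natl -ler_pdivrMr//.
        exact/ltW/truncnS_gt.
      apply: lee_sum => j _; rewrite indicE mem_set// mule1 lee_fin.
      apply: inv_powR_le => //; first exact: ltW.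
      by rewrite ler_wpM2l ?(ltW r0)// ler_wiXn2l ?invr_ge0 ?invf_le1 ?ler1n.
    by rewrite leey.
  rewrite inver gt_eqF// poweR_EFin.
  have exj : exists j, (r * u j.+1 <= v)%R.
    pose N := Num.truncn (r / v); exists N.
    have h1 : (r / v < N.+1%:R)%R by exact: truncnS_gt.
    have h2 : (N.+1%:R <= 2 ^+ N.+1 :> R)%R by rewrite -natrX ler_nat ltnW// ltn_expl.
    rewrite /u exprVn ler_pdivrMr ?exprn_gt0//.
    by rewrite -ler_pdivrMl// mulrC (le_trans (ltW h1)).
  case: (ex_minnP exj) => j hj jmin.
  apply: (@le_trans _ _ (c j)%:E).
    by rewrite lee_fin; apply: inv_powR_le => //; exact: ltW.
  apply: gc; split=> //=; case: j hj jmin => // j hj jmin.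
  by rewrite E lte_fin ltNge; apply/negP => /jmin; rewrite ltnn.
apply: (@le_trans _ _ (\int[mu]_(x in X) g x)); first exact: le_integral_any.
rewrite /g integral_nneseries//; last first.
  move=> j; apply: measurable_funeM; apply/measurable_EFinP.
  exact: measurable_indic.
apply: (@le_trans _ _ (\sum_(j <oo) (K * 2 `^ a * r `^ (q - a) * t ^+ j)%:E)).
  apply: lee_nneseries => j _; first by move=> _; apply: integral_ge0 => x _.
  rewrite integral_indic_in// ?(ltW (c0 j))//; last by move=> x [].
  rewrite -termE EFinM lee_pmul2l ?lte_fin//.
have M0 : (0 <= K * 2 `^ a * r `^ (q - a))%R by rewrite !mulr_ge0 ?powR_ge0.
apply: lime_le.
  by apply: is_cvg_nneseries => j _ _; rewrite lee_fin mulr_ge0 ?exprn_ge0.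
apply: nearW => N; rewrite sumEFin lee_fin -mulr_sumr.
rewrite (_ : (K * layer_const a q s * _ = K * 2 `^ a * r `^ (q - a) * (1 - t)^-1)%R).
  by rewrite ler_wpM2l// geometric_sum_le.
by rewrite /layer_const -/t; ring.
Qed.
End integrals.

(** * Porous sets have small neighbourhoods *)

Section porosity.
Context (R : realType) (n : nat).
Local Notation C := (Cn R n).
Local Notation S := (@unit_sphere R n).
Variables (mu : {measure set C -> \bar R}) (q : R).
Hypothesis reg : ahlfors_regular mu S q.
Hypothesis q0 : 0 < q.
Variable E : set C.
Hypothesis ES : E `<=` S.
Implicit Types (x y z w : C) (t h l e r : R).

Lemma sphere_le1 x : S x -> enorm x <= 1.
Proof. by move=> ->. Qed.

(** Both radii are measured with rho, in which enlarging the cap by chains of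
    balls only adds radii. *)
Definition cap_tube x h t : set C := dball x (t ^+ 2) `&` S `&` tube E (h ^+ 2).

Lemma measurable_cap_tube x h t : measurable (cap_tube x h t).
Proof.
rewrite /cap_tube -setIA; apply: measurableI; first exact: measurable_dball.
exact: (measurable_tube reg (ltW q0)).
Qed.

Lemma cap_tubeP x h t z : 0 <= h -> 0 <= t ->
  cap_tube x h t z <-> [/\ rho x z < t, S z & exists2 y, E y & rho z y < h].
Proof.
move=> h0 t0; split.
  move=> [[[z1 xz] Sz] /tubeP[y Ey zy]].
  by rewrite !dist_lt_sqr// in xz zy; split=> //; exists y.
move=> [xz Sz [y Ey zy]]; split; last first.
  by apply/tubeP; exists y; rewrite ?dist_lt_sqr.
by split=> //; split; [exact: sphere_le1|rewrite dist_lt_sqr].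
Qed.

Lemma rho_tri x y z : S x -> S y -> S z -> rho x z <= rho x y + rho y z.
Proof. by move=> ? ? ?; apply: rho_triangle; exact: sphere_le1. Qed.

(** The hole in the cap of rho-radius h / 4 has rho-radius
    sqrt (c / 2) (h / 4), half of c being given up to attain the supremum. It is
    written 2 l h, with l = sqrt (c / 2) / 8, because the ball of radius l h about y
    will be used, which stays at distance l h from E. *)
Lemma hole_point c : 0 < c -> c < 1 ->
  (forall x r, S x -> 0 < r -> r <= 2 ->
    ((c * r)%:E <= ereal_sup [set dist_set y E | y in dball x r `&` S])%E) ->
  forall x h, S x -> 0 < h -> h <= 2 ->
    exists y, [/\ S y, rho x y < h / 4 &
      forall z, E z -> 2 * (Num.sqrt (c / 2) / 8) * h <= rho y z].
Proof.
move=> c0 c1 hole x h Sx h0 h2.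
have r0 : 0 < (h / 4) ^+ 2 by rewrite exprn_gt0// divr_gt0.
have r2 : (h / 4) ^+ 2 <= 2 by nra.
have lt : ((c / 2 * (h / 4) ^+ 2)%:E <
    ereal_sup [set dist_set y E | y in dball x ((h / 4) ^+ 2) `&` S])%E.
  by apply: lt_le_trans (hole x _ Sx r0 r2); rewrite lte_fin ltr_pM2r//; lra.
have [_ [y [[y1 xy] Sy] <-] hy] := ereal_sup_gt lt.
exists y; split=> //; first by rewrite -dist_lt_sqr// divr_ge0// ltW.
move=> z Ez; rewrite -dist_ge_sqr; last by rewrite !mulr_ge0 ?sqrtr_ge0// ltW.
rewrite !exprMn sqr_sqrtr ?divr_ge0 ?(ltW c0)//.
rewrite [leLHS](_ : _ = c / 2 * (h / 4) ^+ 2); last by field.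
rewrite -lee_fin; apply: le_trans (ltW hy) _.
by apply: ereal_inf_lbound; exists z.
Qed.

Section one_scale.
Variables (l : R).
Hypotheses (l0 : 0 < l) (l8 : l <= 8^-1).
Hypothesis hole : forall x h, S x -> 0 < h -> h <= 2 ->
    exists y, [/\ S y, rho x y < h / 4 & forall z, E z -> 2 * l * h <= rho y z].

Lemma l_le1 : l <= 1.
Proof. by apply: le_trans l8 _; rewrite invf_le1// ler1n. Qed.

(** Each point of a maximal h-separated subset of E carries a hole of comparable
    size: the holes are disjoint, lie in the h-neighbourhood of E but outside its
    (l h)-neighbourhood, while the balls of radius 2 h about the same points
    cover the latter. *)
Lemma tube_le_holes : exists2 M : R, 0 < M & forall x h t, S x -> 0 < h -> h <= 2 -> 0 < t ->
  (mu (cap_tube x (l * h) t) <=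
   M%:E * mu (cap_tube x h (t + 2 * h) `\` cap_tube x (l * h) (t + 2 * h)))%E.
Proof.
have [_ _ [K K0 hK] [k k0 hk]] := reg.
have [N N0 hN] := counting_regular reg (ltW q0) ES.
exists (K * 4 `^ q / (k * (l ^+ 2) `^ q)).
  by rewrite divr_gt0// mulr_gt0 ?powR_gt0// exprn_gt0.
move=> x h t Sx h0 h2 t0; set B := _ `\` _.
have lh0 : 0 <= l * h by rewrite mulr_ge0 ?ltW.
have lhh : l * h <= h / 8 by rewrite mulrC ler_wpM2l ?(ltW h0).
have M0 : 0 <= K * 4 `^ q / (k * (l ^+ 2) `^ q).
  by rewrite divr_ge0 ?mulr_ge0 ?powR_ge0 ?(ltW K0) ?(ltW k0).
have ht0 : 0 <= t + h by lra.
have ht20 : 0 <= t + 2 * h by lra.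
have mB : measurable B by apply: measurableD; exact: measurable_cap_tube.
pose A : set C := E `&` dball x ((t + h) ^+ 2).
have AS : A `<=` S by move=> y [/ES].
have [[e0 Ae0]|noA] := pselect (exists y, A y); last first.
  rewrite (_ : cap_tube x (l * h) t = set0) ?measure0 ?mule_ge0//.
  rewrite -subset0 => z /(cap_tubeP _ _ lh0 (ltW t0))[xz Sz [y Ey zy]]; apply: noA.
  exists y; split=> //; split; first exact: sphere_le1 (ES Ey).
  by rewrite dist_lt_sqr//; have := rho_tri Sx Sz (ES Ey); lra.
have Ee0 : E e0 by case: Ae0.
have d0 : 0 < h ^+ 2 by rewrite exprn_gt0.
have dr : h ^+ 2 <= (2 * (t + h)) ^+ 2 by apply: lerXn2r; rewrite ?nnegrE; lra.
have Asub : A `<=` E `&` dball e0 ((2 * (t + h)) ^+ 2).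
  move=> y [Ey [y1 xy]]; split=> //; split=> //.
  have [_ [_ xe0]] := Ae0; rewrite !dist_lt_sqr ?mulr_ge0// in xy xe0 *.
  by have := rho_tri (ES Ee0) Sx (ES Ey); rewrite (rhoC e0 x); lra.
have [p sp pz] := maximal_sep_seq AS d0 (fun p sp =>
    hN e0 _ _ p Ee0 d0 dr (sub_sep_seq Asub sp)).
have [_ Ap _] := sp.
have pS y : y \in p -> S y by move=> /Ap/AS.
have /choice[f hf] : forall y, exists w, S y ->
    [/\ S w, rho y w < h / 4 & forall z, E z -> 2 * l * h <= rho w z].
  move=> y; have [Sy|nSy] := pselect (S y); last by exists y.
  by have [w hw] := hole Sy h0 h2; exists w.
have covered : (mu (cap_tube x (l * h) t) <= ((size p)%:R * (K * ((2 * h) ^+ 2) `^ q))%:E)%E.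
  apply: (cover_measure (G := fun y => dball y ((2 * h) ^+ 2) `&` S)).
  - exact: measurable_cap_tube.
  - by move=> y _; apply: measurableI; [exact: measurable_dball|exact: measurable_unit_sphere].
  - move=> z /(cap_tubeP _ _ lh0 (ltW t0))[xz Sz [y Ey zy]].
    have [|w wp yw] := pz y.
      split=> //; split; first exact: sphere_le1 (ES Ey).
      by rewrite dist_lt_sqr//; have := rho_tri Sx Sz (ES Ey); lra.
    exists w => //; split=> //; split; first exact: sphere_le1.
    rewrite !dist_lt_sqr ?mulr_ge0 ?(ltW h0)// in yw *.
    by have := rho_tri Sz (ES Ey) (pS _ wp); rewrite (rhoC w); lra.
  - by move=> y yp; apply: hK; [exact: pS|rewrite exprn_gt0// mulr_gt0].
have packed : (((size p)%:R * (k * ((l * h) ^+ 2) `^ q))%:E <= mu B)%E.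
  apply: (packing (G := fun y => dball (f y) ((l * h) ^+ 2) `&` S) AS d0 sp) => //.
  - by move=> y _; apply: measurableI; [exact: measurable_dball|exact: measurable_unit_sphere].
  - move=> y yp z [[z1 fz] Sz]; have [Sf yf fE] := hf y (pS _ yp).
    have [Ey [_ xy]] := Ap y yp; rewrite !dist_lt_sqr// in fz xy.
    have yz := rho_tri (pS _ yp) Sf Sz.
    split; last first.
      split=> //; rewrite (_ : h ^+ 2 / 4 = (h / 2) ^+ 2); last by field.
      by rewrite dist_lt_sqr; lra.
    split.
      apply/cap_tubeP => //; first exact: ltW.
      split=> //; first by have := rho_tri Sx (pS _ yp) Sz; lra.
      by exists y => //; rewrite rhoC; lra.
    move=> /(cap_tubeP _ _ lh0 ht20)[_ _ [w Ew zw]].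
    by have := fE w Ew; have := rho_tri Sf Sz (ES Ew); lra.
  - move=> y yp; have [Sf _ _] := hf y (pS _ yp).
    by apply: hk => //; [rewrite exprn_gt0// mulr_gt0|nra].
apply: le_trans covered _.
apply: le_trans (_ : ((K * 4 `^ q / (k * (l ^+ 2) `^ q))%:E *
   ((size p)%:R * (k * ((l * h) ^+ 2) `^ q))%:E <= _)%E); last exact: lee_wpmul2l.
have e4 : (2 * h) ^+ 2 = 4 * h ^+ 2 by ring.
rewrite -EFinM lee_fin e4 (exprMn 2 l h).
rewrite (powR_scale q (ltr0Sn _ 3) d0) (powR_scale q (exprn_gt0 2 l0) d0).
rewrite le_eqVlt; apply/orP; left; apply/eqP; field.
by rewrite !gt_eqF// powR_gt0// exprn_gt0.
Qed.

Let mass x h t := fine (mu (cap_tube x h t)).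

Lemma cap_tube_fin x h t : S x -> 0 < t -> mu (cap_tube x h t) = (mass x h t)%:E.
Proof.
move=> Sx t0; have [_ _ [K K0 hK] _] := reg.
rewrite /mass fineK// ge0_fin_numE// (le_lt_trans _ (ltry (K * (t ^+ 2) `^ q)))//.
apply: le_trans (hK x (t ^+ 2) Sx (exprn_gt0 _ t0)).
apply: le_measure; rewrite ?inE; [exact: measurable_cap_tube| |by move=> z []].
by apply: measurableI; [exact: measurable_dball|exact: measurable_unit_sphere].
Qed.

(** The mass of the (l h)-tube is at most M times the mass lost between the two
    tubes, hence at most the proportion M / (1 + M) of the mass of the h-tube. *)
Lemma mass_step : exists2 a : R, 0 < a < 1 & forall x h t, S x -> 0 < h -> h <= 2 -> 0 < t ->
  mass x (l * h) t <= a * mass x h (t + 2 * h).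
Proof.
have [M M0 hM] := tube_le_holes.
have M1 : 0 < 1 + M by lra.
exists (M / (1 + M)); first by rewrite divr_gt0//= ltr_pdivrMr// mul1r; lra.
move=> x h t Sx h0 h2 t0; have := hM x h t Sx h0 h2 t0.
have t2 : 0 < t + 2 * h by lra.
have lh0 : 0 <= l * h by rewrite mulr_ge0 ?ltW.
have sub : cap_tube x (l * h) (t + 2 * h) `<=` cap_tube x h (t + 2 * h).
  move=> z /(cap_tubeP _ _ lh0 (ltW t2))[xz Sz [y Ey zy]].
  have lh : l * h <= h by rewrite ler_piMl ?(ltW h0)// l_le1.
  by apply/cap_tubeP; rewrite ?ltW//; split=> //; exists y => //; lra.
have inc : (mu (cap_tube x (l * h) t) <= mu (cap_tube x (l * h) (t + 2 * h)))%E.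
  apply: le_measure; rewrite ?inE; [exact: measurable_cap_tube|exact: measurable_cap_tube|].
  move=> z /(cap_tubeP _ _ lh0 (ltW t0))[xz Sz yz].
  by apply/cap_tubeP; [exact: lh0|exact: ltW|split=> //; lra].
set B := _ `\` _ => hl.
have hb : ((mass x h (t + 2 * h))%:E = mu B + (mass x (l * h) (t + 2 * h))%:E)%E.
  rewrite -!cap_tube_fin// -[in X in (_ + X)%E](setIidr sub).
  by apply: measureDI; exact: measurable_cap_tube.
move: hl hb; rewrite !cap_tube_fin// in inc *.
move: (mu B) (measure_ge0 mu B) inc => [b| |] //.
move: (mass x (l * h) t) (mass x h _) (mass x _ (t + 2 * h)) => u v w.
rewrite -!EFinD !lee_fin => b0 uw ub [->].
rewrite mulrAC ler_pdivlMr//.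
have := ler_wpM2l (ltW M0) uw; lra.
Qed.

(** The radius of the cap grows by 2 l^k h at step k. Subtracting 4 l^k h in the
    bound makes the induction absorb this geometric series, as 4 l <= 2. *)
Lemma mass_iterate : exists a K : R, [/\ 0 < a, a < 1, 0 < K & forall k x h t, S x -> 0 < h -> h <= 2 -> 0 < t ->
  mass x (l ^+ k * h) t <= a ^+ k * (K * ((t + 4 * h - 4 * (l ^+ k * h)) ^+ 2) `^ q)].
Proof.
have [a /andP[a0 a1] ha] := mass_step; have [_ _ [K K0 hK] _] := reg.
exists a, K; split=> // k x h t Sx h0 h2; elim: k t => [|k ih] t t0.
  rewrite !expr0 !mul1r addrK -lee_fin -cap_tube_fin//.
  apply: le_trans (hK x (t ^+ 2) Sx (exprn_gt0 _ t0)).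
  apply: le_measure; rewrite ?inE; [exact: measurable_cap_tube| |by move=> z []].
  by apply: measurableI; [exact: measurable_dball|exact: measurable_unit_sphere].
have lk0 : 0 < l ^+ k by rewrite exprn_gt0.
have lk1 : l ^+ k <= 1 by rewrite exprn_ile1 ?(ltW l0)// l_le1.
have h0' : 0 < l ^+ k * h by rewrite mulr_gt0.
have h2' : l ^+ k * h <= h by rewrite ler_piMl// ltW.
rewrite exprS -mulrA; apply: le_trans (ha x _ t Sx h0' (le_trans h2' h2) t0) _.
rewrite exprS -mulrA ler_wpM2l ?(ltW a0)//.
apply: le_trans (ih _ _) _; first by lra.
rewrite ler_wpM2l ?exprn_ge0 ?(ltW a0)// ler_wpM2l ?(ltW K0)//.
have u0 : 0 <= t + 2 * (l ^+ k * h) + 4 * h - 4 * (l ^+ k * h) by lra.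
have lh : l * (l ^+ k * h) <= (l ^+ k * h) / 8 by rewrite mulrC ler_wpM2l ?(ltW h0').
rewrite ge0_ler_powR ?nnegrE ?sqr_ge0 ?(ltW q0)// ler_pXn2r ?nnegrE//; lra.
Qed.

(** Iterating over the scales l^j turns the loss of a fixed proportion of mass at
    each scale into a power of e / r. *)
Lemma mass_power : exists b K : R, [/\ 0 < b, b <= q, 0 < K & forall x r e, S x ->
  0 < r -> r <= 4 -> 0 < e -> e < r ->
  (mu (dball x r `&` S `&` tube E e) <= (K * (e `^ q * (r / e) `^ (q - b)))%:E)%E].
Proof.
have [a [K [a0 a1 K0 hK]]] := mass_iterate.
have l1 := l_le1; have l20 : 0 < l ^+ 2 by rewrite exprn_gt0.
have l2h : l ^+ 2 <= 2^-1.
  have l2 : l <= 2^-1 by apply: le_trans l8 _; rewrite lef_pV2 ?posrE// ler_nat.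
  by rewrite expr2 -[leRHS]mulr1; apply: ler_pM => //; exact: ltW.
have ln0 : ln (l ^+ 2) < 0.
  by apply: ln_lt0; rewrite l20/=; apply: le_lt_trans l2h _; rewrite invf_lt1// ltr1n.
(* The exponent with a = (l^2)^b0, lowered to q so that q - b stays
   nonnegative. *)
pose b0 := ln a / ln (l ^+ 2).
have b00 : 0 < b0 by rewrite /b0 nmulr_rgt0 ?invr_lt0// ln_lt0// a0.
pose b := Num.min b0 q.
have bpos : 0 < b by rewrite lt_min b00.
have ab : a <= (l ^+ 2) `^ b.
  have aE : a = (l ^+ 2) `^ b0.
    by rewrite /powR gt_eqF// /b0 divfK ?lt_eqF// lnK.
  rewrite {1}aE; apply: ger_powR; first by rewrite l20/= exprn_ile1// ltW.
  by rewrite ge_min lexx.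
exists b, (K * 25 `^ q * ((l ^+ 2)^-1) `^ b); split=> //.
- by rewrite ge_min lexx orbT.
- by rewrite !mulr_gt0 ?powR_gt0 ?invr_gt0.
move=> x r e Sx r0 r4 e0 er.
have exj : exists j, (l ^+ 2) ^+ j.+1 * r < e.
  pose N := Num.truncn (r / e); exists N.
  have h1 : r / e < N.+1%:R by exact: truncnS_gt.
  have h2 : N.+1%:R <= 2 ^+ N.+1 :> R by rewrite -natrX ler_nat ltnW// ltn_expl.
  apply: (@le_lt_trans _ _ (2^-1 ^+ N.+1 * r)).
    by rewrite ler_wpM2r ?(ltW r0)// lerXn2r ?nnegrE ?invr_ge0 ?(ltW l20).
  rewrite exprVn mulrC ltr_pdivrMr ?exprn_gt0//.
  by rewrite -ltr_pdivrMl// mulrC (lt_le_trans h1).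
(* The last scale at which the tube still contains the e-neighbourhood. *)
case: (ex_minnP exj) => j hj jmin.
have ej : e <= (l ^+ 2) ^+ j * r.
  case: j hj jmin => [|j] hj jmin; first by rewrite expr0 mul1r ltW.
  by rewrite leNgt; apply/negP => /jmin; rewrite ltnn.
pose t := Num.sqrt r.
have t0 : 0 < t by rewrite sqrtr_gt0.
have tE : t ^+ 2 = r by rewrite sqr_sqrtr// ltW.
have t2 : t <= 2 by rewrite -(@ler_pXn2r _ 2) ?nnegrE ?(ltW t0)// tE -natrX.
have lj0 : 0 < l ^+ j by rewrite exprn_gt0.
apply: (@le_trans _ _ (mass x (l ^+ j * t) t)%:E).
  rewrite -cap_tube_fin//; apply: le_measure; rewrite ?inE.
  - by rewrite -setIA; apply: measurableI; [exact: measurable_dball|exact: (measurable_tube reg (ltW q0))].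
  - exact: measurable_cap_tube.
  - rewrite /cap_tube tE => z [zb /tubeP[y Ey zy]]; split=> //.
    apply/tubeP; exists y => //; apply: lt_le_trans zy _.
    by rewrite exprMn tE -exprM mulnC exprM.
rewrite lee_fin; apply: le_trans (hK j x t t Sx t0 t2 t0) _.
have h5 : 0 <= t + 4 * t - 4 * (l ^+ j * t).
  have : l ^+ j * t <= t by rewrite ler_piMl ?(ltW t0)// exprn_ile1// ltW.
  lra.
have step1 : ((t + 4 * t - 4 * (l ^+ j * t)) ^+ 2) `^ q <= 25 `^ q * r `^ q.
  rewrite -powR_scale// ge0_ler_powR ?nnegrE ?sqr_ge0 ?mulr_ge0 ?(ltW q0) ?(ltW r0)//.
  rewrite (_ : 25 * r = (5 * t) ^+ 2); last by rewrite exprMn tE; congr (_ * _); rewrite -natrX.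
  apply: lerXn2r; rewrite ?nnegrE ?mulr_ge0 ?(ltW t0)//.
  have : 0 < l ^+ j * t by rewrite mulr_gt0.
  lra.
have step2 : a ^+ j <= ((l ^+ 2)^-1) `^ b * (e / r) `^ b.
  rewrite -powRM ?invr_ge0 ?divr_ge0 ?(ltW l20) ?(ltW e0) ?(ltW r0)//.
  apply: (@le_trans _ _ (((l ^+ 2) `^ b) ^+ j)).
    by apply: lerXn2r; rewrite ?nnegrE ?powR_ge0 ?(ltW a0).
  rewrite -powR_mulrn ?powR_ge0// powRAC powR_mulrn ?(ltW l20)//.
  have lj : 0 <= (l ^+ 2) ^+ j by rewrite exprn_ge0// ltW.
  apply: ge0_ler_powR; rewrite ?nnegrE ?(ltW bpos)//.
    by rewrite mulr_ge0 ?invr_ge0 ?divr_ge0 ?(ltW l20) ?(ltW e0) ?(ltW r0).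
  rewrite ler_pdivlMl// -exprS ler_pdivlMr//.
  exact: ltW.
have -> : e `^ q * (r / e) `^ (q - b) = r `^ q * (e / r) `^ b.
  by rewrite !powR_pieces// subKr mulrC.
apply: (@le_trans _ _ ((((l ^+ 2)^-1) `^ b * (e / r) `^ b) * (K * (25 `^ q * r `^ q)))).
  apply: ler_pM => //; first by rewrite exprn_ge0// ltW.
    by rewrite mulr_ge0 ?powR_ge0// ltW.
  by rewrite ler_wpM2l// ltW.
by rewrite le_eqVlt; apply/orP; left; apply/eqP; ring.
Qed.
End one_scale.

(** Radii above 4 are reduced to 4, since the whole sphere has diameter 2. *)
Lemma porous_tube c : 0 < c -> c < 1 ->
  (forall x r, S x -> 0 < r -> r <= 2 ->
    ((c * r)%:E <= ereal_sup [set dist_set y E | y in dball x r `&` S])%E) ->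
  exists s K : R, [/\ 0 <= s, s < q, 0 < K & forall x r e, S x -> 0 < r -> 0 < e -> e < r ->
    (mu (dball x r `&` S `&` tube E e) <= (K * (e `^ q * (r / e) `^ s))%:E)%E].
Proof.
move=> c0 c1 /(hole_point c0 c1) hole.
have l0 : 0 < Num.sqrt (c / 2) / 8 by rewrite divr_gt0// sqrtr_gt0 divr_gt0.
have l8 : Num.sqrt (c / 2) / 8 <= 8^-1.
  have c2 : c / 2 <= 1 by lra.
  by rewrite ler_piMl// -[leRHS]sqrtr1 ler_wsqrtr.
have [b [K [b0 bq K0 hK]]] := mass_power l0 l8 hole.
have [_ _ [K1 K10 hK1] _] := reg.
exists (q - b), (K + K1); split; rewrite ?subr_ge0 ?addr_gt0//; first by rewrite ltrBlDr ltrDl.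
move=> x r e Sx r0 e0 er.
have s0 : 0 <= q - b by rewrite subr_ge0.
have p0 : 0 <= e `^ q * (r / e) `^ (q - b) by rewrite mulr_ge0 ?powR_ge0.
have [r4|r4] := leP r 4.
  apply: le_trans (hK x r e Sx r0 r4 e0 er) _.
  by rewrite lee_fin ler_wpM2r// lerDl ltW.
have mtub r' : measurable (dball x r' `&` S `&` tube E e).
  by rewrite -setIA; apply: measurableI; [exact: measurable_dball|exact: (measurable_tube reg (ltW q0))].
have sub4 : dball x r `&` S `<=` dball x 4 `&` S.
  move=> z [[z1 _] Sz]; split=> //; split=> //.
  by apply: (@le_lt_trans _ _ 2); [apply: dist_le2 => //; exact: sphere_le1|rewrite ltr_nat].
have mono : (e `^ q * (4 / e) `^ (q - b) <= e `^ q * (r / e) `^ (q - b)).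
  rewrite ler_wpM2l ?powR_ge0// ge0_ler_powR ?nnegrE ?divr_ge0 ?(ltW e0) ?(ltW r0)//.
  by rewrite ler_wpM2r ?invr_ge0 ?(ltW e0) ?(ltW r4).
have [e4|e4] := ltP e 4.
  apply: (@le_trans _ _ (mu (dball x 4 `&` S `&` tube E e))).
    by apply: le_measure; rewrite ?inE//; exact: setSI.
  apply: le_trans (hK x 4 e Sx _ _ e0 e4) _ => //.
  by rewrite lee_fin; apply: ler_pM => //; rewrite ?mulr_ge0 ?powR_ge0 ?(ltW K0)// lerDl ltW.
apply: (@le_trans _ _ (mu (dball x 4 `&` S))).
  apply: le_measure; rewrite ?inE//; last by move=> z [/sub4].
  by apply: measurableI; [exact: measurable_dball|exact: measurable_unit_sphere].
apply: le_trans (hK1 x 4 Sx _) _ => //; rewrite lee_fin.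
apply: ler_pM; rewrite ?powR_ge0 ?(ltW K10)//; first by rewrite lerDr ltW.
rewrite -[leLHS]mulr1; apply: ler_pM; rewrite ?powR_ge0//.
  by rewrite ge0_ler_powR ?nnegrE ?(ltW q0) ?(ltW e0).
by apply: powR_ratio_ge1 => //; exact: ltW.
Qed.
End porosity.

(** * Negative powers and the logarithm of a distance *)

Section negative_powers.
Context d (T : measurableType d) (R : realType).
Local Open Scope ereal_scope.

(** The sets where f^-a is large are those where f is small. *)
Lemma measurable_neg_power (X : set T) (f : T -> \bar R) (a : R) : measurable X ->
  (forall e : R, measurable (X `&` [set x | f x < e%:E])) ->
  (forall x, X x -> 0 <= f x) -> (0 < a)%R ->
  measurable_fun X (fun x => (f x)^-1 `^ a).
Proof.
move=> mX mf f0 a0 _; apply: (measurability _ (ErealGenOInfty.measurableE R)) => //.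
move=> _ [_ [y ->] <-].
have [y0|y0] := ltP y 0%R.
  rewrite (_ : _ `&` _ = X)//; apply/seteqP; split=> [x []//|x Xx]; split=> //=.
  by rewrite in_itv/= andbT (lt_le_trans _ (poweR_ge0 _ _)).
have [->|yn0] := eqVneq y 0%R.
  rewrite (_ : _ `&` _ = \bigcup_k (X `&` [set x | f x < k%:R%:E])).
    exact: bigcupT_measurable.
  apply/seteqP; split=> x.
    move=> [Xx] /=; rewrite in_itv/= andbT; have := f0 x Xx.
    case E : (f x) => [t| |] // t0; last first.
      by rewrite invey poweR_EFin powR0 ?gt_eqF// ltxx.
    move=> _; exists (Num.truncn t).+1 => //; split=> //=.
    by rewrite E lte_fin; exact: truncnS_gt.
  move=> [k _ [Xx /= fk]]; split=> //=; rewrite in_itv/= andbT.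
  move: fk (f0 x Xx); case: (f x) => [t| |] // _; rewrite lee_fin.
  rewrite le_eqVlt => /predU1P[<-|t0]; first by rewrite inve0 poweRyr ?gt_eqF// ltry.
  by rewrite inver gt_eqF// poweR_EFin lte_fin powR_gt0// invr_gt0.
have yp : (0 < y)%R by rewrite lt_neqAle eq_sym yn0.
pose e := ((y `^ a^-1)^-1)%R.
have e0 : (0 < e)%R by rewrite invr_gt0 powR_gt0.
have eE : (e^-1 `^ a = y)%R by rewrite invrK -powRrM mulVf ?gt_eqF// powRr1// ltW.
rewrite (_ : _ `&` _ = X `&` [set x | f x < e%:E])//.
apply/seteqP; split=> x [Xx] /=.
  rewrite in_itv/= andbT; have := f0 x Xx; case E : (f x) => [t| |] //.
    rewrite lee_fin le_eqVlt => /predU1P[t0|t0]; first by rewrite -t0; split=> //.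
    rewrite inver gt_eqF// poweR_EFin lte_fin => yt; split=> //=.
    rewrite ?E lte_fin ltNge; apply/negP => et.
    by move: yt; rewrite ltNge -{1}eE inv_powR_le// ltW.
  by rewrite invey poweR_EFin powR0 ?gt_eqF// lte_fin ltNge (ltW yp).
move=> fe; split=> //=; rewrite in_itv/= andbT.
move: fe (f0 x Xx); case: (f x) => [t| |] //.
rewrite lee_fin lte_fin => te; rewrite le_eqVlt => /predU1P[<-|t0].
  by rewrite inve0 poweRyr ?gt_eqF// ltry.
rewrite inver gt_eqF// poweR_EFin lte_fin -[ltLHS]eE.
apply: gt0_ltr_powR; rewrite ?nnegrE ?invr_ge0 ?(ltW e0) ?(ltW t0)//.
  exact: powR_ge0.
by rewrite ltf_pV2 ?posrE.
Qed.

(** Pointwise, ln (1/f) <= ln (1/r) + (r/f)^a / a. *)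
Lemma log_le_neg_power (X : set T) (mu : {measure set T -> \bar R}) (f : T -> \bar R)
    (a r B : R) : measurable X -> mu X < +oo ->
  (forall e : R, measurable (X `&` [set x | f x < e%:E])) ->
  (forall x, X x -> 0 <= f x) -> (0 < a)%R -> (0 < r)%R ->
  \int[mu]_(x in X) ((f x)^-1 `^ a) <= B%:E ->
  \int[mu]_(x in X) lne (f x)^-1 <= mu X * (ln r^-1)%:E + (a^-1 * r `^ a * B)%:E.
Proof.
move=> mX Xfin mf f0 a0 r0 hB; have mg := measurable_neg_power mX mf f0 a0.
set g := fun x => (f x)^-1 `^ a.
have g0 x : 0 <= g x by exact: poweR_ge0.
have c0 : (0 < a^-1 * r `^ a)%R by rewrite mulr_gt0 ?invr_gt0 ?powR_gt0.
apply: (@le_trans _ _ (\int[mu]_(x in X) ((ln r^-1)%:E + (a^-1 * r `^ a)%:E * g x))).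
  apply: le_integral_any => x Xx; rewrite /g; have := f0 x Xx.
  case: (f x) => [t| |] //; last by rewrite invey /= lexx leNye.
  rewrite lee_fin le_eqVlt => /predU1P[<-|t0].
    by rewrite inve0 poweRyr ?gt_eqF// gt0_muley ?lte_fin// addey// leey.
  rewrite inver gt_eqF// poweR_EFin lne_EFin ?invr_gt0// -EFinM -EFinD lee_fin.
  rewrite -lerBlDl -ln_div ?posrE ?invr_gt0// invrK -mulrA -powRM ?invr_ge0 ?(ltW r0) ?(ltW t0)//.
  have w0 : (0 < r * t^-1)%R by rewrite mulr_gt0 ?invr_gt0.
  rewrite (mulrC _ r) ler_pdivlMl// -ln_powR.
  by apply/ltW/ln_sublinear; rewrite powR_gt0.
have gfin : \int[mu]_(x in X) g x < +oo by apply: le_lt_trans hB (ltry _).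
have ig : mu.-integrable X g.
  apply/integrableP; split=> //.
  by under eq_integral do rewrite gee0_abs//.
have iK : mu.-integrable X (fun=> (ln r^-1)%:E).
  apply/integrableP; split; first exact: measurable_cst.
  by rewrite integral_cst// lte_mul_pinfty.
rewrite integralD//; last exact: integrableZl.
rewrite (integral_cst _ mX) muleC leeD2l// ge0_integralZl_EFin ?(ltW c0)//.
by rewrite (EFinM (_ * _)) lee_pmul2l ?lte_fin.
Qed.
End negative_powers.

(** * Integral forms of the counting bound *)

Section integral_tube.
Context (R : realType) (n : nat).
Local Notation C := (Cn R n).
Implicit Types (x y z : C) (r e a g K : R).
Variables (mu : {measure set C -> \bar R}) (D E : set C) (q : R).
Hypothesis reg : ahlfors_regular mu D q.
Hypothesis q0 : 0 <= q.
Hypothesis ES : E `<=` unit_sphere.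

Lemma measurable_ball_domain x r : measurable (dball x r `&` D).
Proof. by case: reg => mD _ _ _; apply: measurableI => //; exact: measurable_dball. Qed.

Lemma measurable_ball_tube x r e :
  measurable (dball x r `&` D `&` [set z | (dist_set z E < e%:E)%E]).
Proof.
rewrite -setIA; apply: measurableI; first exact: measurable_dball.
exact: (measurable_tube reg q0).
Qed.

Lemma integral_of_counting g a : counting_bound g E -> 0 < a -> a < q - g ->
  exists2 K : R, 0 < K & forall x r, unit_sphere x -> 0 < r ->
    (\int[mu]_(z in dball x r `&` D) ((dist_set z E)^-1 `^ a) <= (K * r `^ (q - a))%:E)%E.
Proof.
move=> cg a0 ag; have [K1 K10 hK1] := tube_of_counting reg q0 ES cg.
have [_ _ [K2 K20 hK2] _] := reg.
have K0 : 0 < K1 + K2 by rewrite addr_gt0.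
exists ((K1 + K2) * layer_const a q g); first by rewrite mulr_gt0// layer_const_gt0.
move=> x r Sx r0; apply: layer_integral => //.
- exact: measurable_ball_domain.
- by move=> e; exact: measurable_ball_tube.
- by move=> z _; exact: dist_set_ge0.
- exact: ltW.
- apply: le_trans (hK2 x r Sx r0) _.
  by rewrite lee_fin ler_wpM2r ?powR_ge0// lerDr ltW.
- move=> e e0 er; apply: le_trans (hK1 x r e Sx r0 e0 er) _.
  by rewrite lee_fin ler_wpM2r ?mulr_ge0 ?powR_ge0// lerDl ltW.
Qed.

Lemma counting_of_integral a K : 0 < a -> a <= q -> 0 <= K ->
  (forall x r, unit_sphere x -> 0 < r ->
    (\int[mu]_(z in dball x r `&` D) ((dist_set z E)^-1 `^ a) <= (K * r `^ (q - a))%:E)%E) ->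
  counting_bound (q - a) E.
Proof.
move=> a0 aq K0 hK; apply: (counting_of_tube reg q0 ES (K := K)) => //.
  by rewrite subr_ge0.
move=> x r e Ex r0 e0 er; have Sx := ES Ex.
have := chebyshev_neg_power (measurable_ball_domain x r) (measurable_ball_tube x r e) a0 e0
  (fun z _ => dist_set_ge0 z E) (hK x r Sx r0).
by rewrite powR_pieces// subKr mulrA.
Qed.

End integral_tube.

Section counting_equivalences.
Context (R : realType) (n : nat).
Local Notation C := (Cn R n).
Implicit Types (x y z : C) (r d e a g K : R) (p : seq C).
Variables (E : set C).
Hypothesis ES : E `<=` unit_sphere.

Lemma separated_count_le x r d B : 0 < d ->
  (forall p, sep_seq (E `&` dball x r) d p -> (size p)%:R <= B) ->
  (separated_count E x d (r / d) <= B%:E)%E.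
Proof.
move=> d0 hB; apply: ge_ereal_sup => _ [p [up Ap sp] <-]; rewrite lee_fin.
by apply: hB; split=> //; move: Ap; rewrite divfK ?gt_eqF.
Qed.

Lemma separated_count_ge x r d p : 0 < d -> sep_seq (E `&` dball x r) d p ->
  ((size p)%:R%:E <= separated_count E x d (r / d))%E.
Proof.
move=> d0 [up Ap sp]; apply: ereal_sup_ubound; exists p => //; split=> //.
by rewrite divfK ?gt_eqF.
Qed.

Lemma upper_dimension_of_counting g (b : R) : counting_bound g E -> g < b ->
  (upper_dimension E < b%:E)%E.
Proof.
move=> [K K0 hK] gb; apply: (@le_lt_trans _ _ g%:E); last by rewrite lte_fin.
apply: ereal_inf_lbound; exists g => //; exists K => x d k Ex d0 dk _.
have : (separated_count E x d (k * d / d) <= (K * (k * d / d) `^ g)%:E)%E.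
  by apply: separated_count_le => // p; exact: hK.
by rewrite mulfK ?gt_eqF.
Qed.

Lemma size_cover p (q : seq C) (P : C -> pred C) (B : R) :
  (forall z, z \in p -> exists2 y, y \in q & P y z) ->
  (forall y, y \in q -> (size [seq z <- p | P y z])%:R <= B) ->
  (size p)%:R <= (size q)%:R * B.
Proof.
elim: q p => [|y q ih] p cov bnd.
  case: p cov {bnd} => [|z p] cov; first by rewrite mul0r.
  by have [|//] := cov z; rewrite inE eqxx.
have -> : size p = (size [seq z <- p | P y z] + size [seq z <- p | ~~ P y z])%N.
  by rewrite !size_filter count_predC.
rewrite natrD /= -natr1 mulrDl mul1r [leRHS]addrC; apply: lerD.
  by apply: bnd; rewrite inE eqxx.
apply: ih => [z|w wq].
  rewrite mem_filter => /andP[nPy zp]; have [w] := cov z zp.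
  by rewrite inE => /predU1P[->|wq] Pw; [rewrite Pw in nPy|exists w].
apply: le_trans (bnd w _); last by rewrite inE wq orbT.
rewrite ler_nat -filter_predI !size_filter sub_count// => z.
by move=> /andP[].
Qed.

(** Radii larger than 1 cost only a constant, because E is covered by finitely
    many balls of radius 1. *)
Lemma counting_of_upper_dimension (m : R) : counting_bound m E -> 0 < m ->
  (upper_dimension E < m%:E)%E -> exists g, [/\ 0 <= g, g < m & counting_bound g E].
Proof.
move=> [N N0 hN] m0' /ereal_inf_lt[_ [g' [C0 hC] <-]]; rewrite lte_fin => g'm.
have m0 := ltW m0'; pose g := Num.max g' 0; exists g.
have g0 : 0 <= g by rewrite le_max lexx orbT.
split=> //; first by rewrite gt_max g'm.
pose K := Num.max C0 1.
have K1 : 1 <= K by rewrite le_max lexx orbT.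
have K0 : 0 < K := lt_le_trans ltr01 K1.
have small x r d p : E x -> 0 < d -> d <= r -> r <= 1 ->
    sep_seq (E `&` dball x r) d p -> (size p)%:R <= K * (r / d) `^ g.
  move=> Ex d0 dr r1 sp; rewrite -lee_fin.
  apply: le_trans (separated_count_ge d0 sp) _.
  apply: le_trans (hC x d (r / d) Ex d0 _ _) _; rewrite ?divfK ?gt_eqF//.
  rewrite lee_fin; apply: (@le_trans _ _ (K * (r / d) `^ g')).
    by rewrite ler_wpM2r ?powR_ge0// le_max lexx.
  rewrite ler_wpM2l ?(ltW K0)// ler_powR ?ler_pdivlMr ?mul1r//.
  by rewrite le_max lexx.
pose M := Num.max (N * 3 `^ m) 1.
have M1 : 1 <= M by rewrite le_max lexx orbT.
have M0 : 0 < M := lt_le_trans ltr01 M1.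
exists (M * K); first by rewrite mulr_gt0.
have sub3 x r : E x -> E `&` dball x r `<=` E `&` dball x 3.
  move=> Ex y [Ey [y1 _]]; split=> //; split=> //.
  by apply: (@le_lt_trans _ _ 2); [apply: dist_le2; rewrite ?ES|rewrite ltr_nat].
have total x r d p : E x -> 1 <= d -> sep_seq (E `&` dball x r) d p -> (size p)%:R <= M.
  move=> Ex d1 sp; have d0 : 0 < d by lra.
  have [d3|d3] := leP d 3.
    apply: le_trans (hN x 3 d p Ex d0 d3 (sub_sep_seq (sub3 x r Ex) sp)) _.
    rewrite le_max ler_wpM2l ?(ltW N0)// ge0_ler_powR ?nnegrE ?divr_ge0 ?(ltW d0)//.
    by rewrite ler_pdivrMr// ler_peMr.
  rewrite (le_trans _ M1)// (ler_nat _ _ 1%N); apply: sep_seq_size1 sp => y z [Ey _] [Ez _].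
  by apply: (@le_lt_trans _ _ 2); [apply: dist_le2; rewrite ?ES|lra].
move=> x r d p Ex d0 dr sp.
have rd1 := powR_ratio_ge1 g0 d0 dr.
have [r1|r1] := leP r 1.
  apply: le_trans (small x r d p Ex d0 dr r1 sp) _.
  by rewrite ler_wpM2r ?powR_ge0// ler_peMl ?(ltW K0).
have [d1|d1] := leP 1 d.
  apply: le_trans (total x r d p Ex d1 sp) _.
  rewrite -mulrA ler_peMr ?(ltW M0)//.
  by rewrite -[leLHS]mulr1; apply: ler_pM.
have AS : E `&` dball x r `<=` unit_sphere by move=> y [/ES].
have [q sq qnet] := maximal_sep_seq AS ltr01 (fun p sp => total x r 1 p Ex (lexx _) sp).
have [_ Aq _] := sq; have [_ Ap _] := sp.
apply: (@le_trans _ _ ((size q)%:R * (K * (r / d) `^ g))); last first.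
  rewrite -mulrA ler_wpM2r ?mulr_ge0 ?powR_ge0 ?(ltW K0)//.
  exact: total Ex (lexx _) sq.
apply: (size_cover (P := fun y z => dist y z < 1)).
  by move=> z /Ap /qnet[y yq zy]; exists y; rewrite // distC.
move=> y yq; have [Ey _] := Aq y yq.
apply: (@le_trans _ _ (K * (1 / d) `^ g)).
  apply: (small y) => //; first exact: ltW.
  apply: sep_seq_filter sp _ => z /Ap[Ez [z1 _]] yz.
  by split.
rewrite ler_wpM2l ?(ltW K0)// ge0_ler_powR ?nnegrE ?divr_ge0 ?(ltW d0)//.
  by lra.
by rewrite ler_wpM2r ?invr_ge0 ?(ltW d0)// ltW.
Qed.

(** The integrand is at most a multiple of t^(b-1) with b = m - a - g > 0, and
    this is a negative power of the distance t to 0 on the half-line. *)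
Lemma integral_count_of_counting g (m : R) : 0 <= g -> g < m -> counting_bound g E ->
  exists a K : R, [/\ 0 < a, a < m, 0 < K & forall x r, E x -> 0 < r ->
    (\int[lebesgue_measure]_(t in `]0%R, r[)
       (separated_count E x t (r / t) * (t `^ (m - a) / t)%:E) <= (K * r `^ (m - a))%:E)%E].
Proof.
move=> g0 gm [K K0 hK].
(* Keeping b below 1 makes the power 1 - b positive, and b below m - g makes
   a positive. *)
pose b := Num.min 2^-1 ((m - g) / 2).
have b0 : 0 < b by rewrite lt_min invr_gt0// ltr0n/= divr_gt0// subr_gt0.
have b1 : b < 1.
  by apply: (@le_lt_trans _ _ 2^-1); rewrite ?ge_min ?lexx// invf_lt1// ltr1n.
have bm : b <= (m - g) / 2 by rewrite ge_min lexx orbT.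
have mab : m - (m - g - b) = g + b by lra.
have b1' : 0 < 1 - b by lra.
have b1'' : 1 - b < 1 - 0 :> R by lra.
have L0 := layer_const_gt0 b1''.
exists (m - g - b), (K * layer_const (1 - b) 1 0); split; [lra|lra|exact: mulr_gt0|].
move=> x r Ex r0; rewrite mab.
have mX : measurable (`]0%R, r[%classic : set (measurableTypeR R)) by exact: measurable_itv.
have mXe (e : R) : measurable ((`]0%R, r[%classic : set (measurableTypeR R)) `&` [set t | (t%:E < e%:E)%E]).
  have mi : measurable (`]-oo, e[%classic : set (measurableTypeR R)) by exact: measurable_itv.
  suff -> : [set t : measurableTypeR R | (t%:E < e%:E)%E] = `]-oo, e[%classic.
    exact: measurableI mX mi.
  by apply/seteqP; split=> t /=; rewrite in_itv/= lte_fin.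
have X0 (t : measurableTypeR R) : `]0%R, r[%classic t -> (0 <= t%:E)%E.
  by rewrite /= in_itv/= lee_fin => /andP[/ltW].
have m1 (e : R) : 0 < e -> (lebesgue_measure (`]0%R, e[%classic : set (measurableTypeR R)) <= e%:E)%E.
  by move=> e0; rewrite lebesgue_measure_itv/= lte_fin e0 -EFinD subr0.
have hint : (\int[lebesgue_measure]_(t in (`]0%R, r[%classic : set (measurableTypeR R)))
    ((t%:E)^-1 `^ (1 - b)) <= (1 * layer_const (1 - b) 1 0 * r `^ (1 - (1 - b)))%:E)%E.
  apply: (layer_integral mX mXe X0 r0 ler01 b1' b1'').
    by rewrite mul1r powRr1 ?(ltW r0)//; exact: m1.
  move=> e e0 er; rewrite powRr0 mulr1 mul1r powRr1 ?(ltW e0)//.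
  apply: le_trans (m1 e e0); apply: le_measure; rewrite ?inE.
  - exact: mXe.
  - exact: measurable_itv.
  - by move=> t [] /=; rewrite !in_itv/= lte_fin => /andP[-> _] ->.
apply: (@le_trans _ _ (\int[lebesgue_measure]_(t in (`]0%R, r[%classic : set (measurableTypeR R)))
    ((K * r `^ g)%:E * ((t%:E)^-1 `^ (1 - b))))%E).
  apply: le_integral_any => t /=; rewrite in_itv/= => /andP[t0 tr].
  rewrite inver gt_eqF// poweR_EFin -EFinM.
  apply: (@le_trans _ _ ((K * (r / t) `^ g)%:E * (t `^ (g + b) / t)%:E)%E).
    apply: lee_wpmul2r; first by rewrite lee_fin divr_ge0 ?powR_ge0 ?ltW.
    by apply: separated_count_le => // p; apply: hK => //; exact: ltW.
  rewrite -EFinM lee_fin le_eqVlt; apply/orP; left; apply/eqP.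
  have ne c1 c2 : t `^ (c1 + c2) = t `^ c1 * t `^ c2.
    by rewrite powRD//; apply/implyP => _; rewrite gt_eqF.
  rewrite powRM ?invr_ge0 ?(ltW r0) ?(ltW t0)// -!powR_inv1 ?(ltW t0)// -!powRrM !mulN1r.
  rewrite opprB (ne b (-1)) (ne g b) powRN; field.
  by rewrite gt_eqF// powR_gt0.
rewrite ge0_integralZl_EFin//; last 3 first.
- by move=> t _; exact: poweR_ge0.
- exact: measurable_neg_power.
- by rewrite mulr_ge0 ?powR_ge0 ?ltW.
apply: (@le_trans _ _ ((K * r `^ g)%:E * (1 * layer_const (1 - b) 1 0 * r `^ (1 - (1 - b)))%:E)%E).
  by apply: lee_wpmul2l => //; rewrite lee_fin mulr_ge0 ?powR_ge0 ?ltW.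
rewrite -EFinM lee_fin le_eqVlt; apply/orP; left; apply/eqP.
rewrite powRD; last by apply/implyP => _; rewrite gt_eqF.
by rewrite subKr; ring.
Qed.

(** The count increases when the separation t decreases, so that the integral over
    d / 2 < t < d already contains the count at scale d. *)
Lemma counting_of_integral_count a K (m : R) : a < m -> 0 <= K ->
  (forall x r, E x -> 0 < r ->
    (\int[lebesgue_measure]_(t in `]0%R, r[)
       (separated_count E x t (r / t) * (t `^ (m - a) / t)%:E) <= (K * r `^ (m - a))%:E)%E) ->
  counting_bound (m - a) E.
Proof.
move=> am K0 hK; set g := m - a; have g0 : 0 < g by rewrite subr_gt0.
exists (2 * 2 `^ g * K + 1); first by rewrite ltr_wpDl// !mulr_ge0 ?powR_ge0.
move=> x r d p Ex d0 dr sp; have r0 : 0 < r := lt_le_trans d0 dr.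
rewrite mulrDl mul1r -[leLHS]addr0; apply: lerD; last exact: powR_ge0.
have mX : measurable (`]0%R, r[%classic : set (measurableTypeR R)) by exact: measurable_itv.
pose A : set (measurableTypeR R) := `]d / 2, d[%classic.
have mA : measurable A by exact: measurable_itv.
have AX : A `<=` `]0%R, r[%classic.
  move=> t /=; rewrite !in_itv/= => /andP[t1 t2].
  by rewrite (lt_trans _ t1) ?divr_gt0// (lt_le_trans t2 dr).
have muA : lebesgue_measure A = (d / 2)%:E.
  have d2 : d / 2 < d by lra.
  by rewrite lebesgue_measure_itv/= lte_fin d2 -EFinD; congr EFin; lra.
pose c := (size p)%:R * ((d / 2) `^ g / d).
have c0 : 0 <= c by rewrite mulr_ge0// divr_ge0 ?powR_ge0 ?ltW.
have low : ((c * (d / 2))%:E <= (K * r `^ g)%:E)%E.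
  apply: le_trans (hK x r Ex r0).
  have <- : ((\int[lebesgue_measure]_(t in (`]0%R, r[%classic : set (measurableTypeR R)))
       (c%:E * (\1_A t)%:E)) = (c * (d / 2))%:E)%E.
    apply: etrans (integral_indic_in _ mX mA AX c0) _.
    by rewrite [RHS](EFinM c) -muA.
  apply: le_integral_any => t /=; rewrite in_itv/= => /andP[t0 tr]; rewrite indicE.
  have [/set_mem|_] := boolP (t \in A); last first.
    rewrite mule0 mule_ge0 ?lee_fin ?divr_ge0 ?powR_ge0 ?(ltW t0)//.
    by apply: le_ereal_sup_tmp; exists 0%E => //; exists [::].
  rewrite /A /= in_itv/= mule1 => /andP[t1 t2]; rewrite /c EFinM.
  apply: lee_pmul; rewrite ?lee_fin ?ler0n ?divr_ge0 ?powR_ge0 ?(ltW d0)//.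
    by apply: separated_count_ge => //; apply: le_sep_seq sp; exact: ltW.
  apply: ler_pM; rewrite ?powR_ge0 ?invr_ge0 ?(ltW d0)//.
    by rewrite ge0_ler_powR ?nnegrE ?divr_ge0 ?(ltW d0) ?(ltW t0) ?(ltW t1)// ltW.
  by rewrite lef_pV2 ?posrE// ltW.
move: low; rewrite lee_fin /c => low.
have dg : 0 < (d / 2) `^ g by rewrite powR_gt0// divr_gt0.
have dE : d `^ g = (d / 2) `^ g * 2 `^ g.
  by rewrite -powRM ?divr_ge0 ?(ltW d0)// divfK.
rewrite powRM ?invr_ge0 ?(ltW d0) ?(ltW r0)// -powR_inv1 ?(ltW d0)// -powRrM mulN1r powRN dE.
rewrite -(@ler_pM2r _ ((d / 2) `^ g / 2)); last by rewrite divr_gt0.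
rewrite (_ : (size p)%:R * ((d / 2) `^ g / 2) = (size p)%:R * ((d / 2) `^ g / d) * (d / 2)); last first.
  by field; rewrite gt_eqF.
apply: le_trans low _; rewrite le_eqVlt; apply/orP; left; apply/eqP.
by field; rewrite !gt_eqF// powR_gt0.
Qed.

End counting_equivalences.

(** * The equivalences on the sphere and in the ball *)

Section sphere_and_ball.
Context (R : realType) (m : nat).
Local Notation n := m.+1.
Local Notation C := (Cn R n).
Implicit Types (x y z : C) (r e s a g K c : R).

Lemma regular_sigma : ahlfors_regular (@sigma R n) unit_sphere n%:R.
Proof.
split; [exact: measurable_unit_sphere|by move=> z /= ->| |].
  exact: sigma_dball_le.
exact: sigma_dball_ge.
Qed.

Lemma regular_volume : ahlfors_regular (@volume R n) unit_ball n.+1%:R.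
Proof.
split; [exact: measurable_unit_ball|by move=> z /ltW| |].
  exact: volume_dball_le.
exact: volume_dball_ge.
Qed.

Variable E : set C.
Hypothesis ES : E `<=` unit_sphere.

Lemma hole_sigma : uniform_hole_condition E ->
  exists s, s < n%:R /\ Sigma_condition s E.
Proof.
move=> [c [c0 c1 hole]].
have [s [K [_ sn _ hK]]] := porous_tube regular_sigma (ltr0Sn _ _) ES c0 c1 hole.
exists s; split=> //; exists K => x r e Sx r0 e0 er.
have := hK x r e Sx r0 e0 er; rewrite powR_pieces// mulrA.
by rewrite -setIA.
Qed.

(** As e < r, an exponent s only gets weaker when it increases; negative ones may
    be replaced by 0. *)
Lemma tube_exponent_max q s K r e : 0 < e -> e < r ->
  K * r `^ s * e `^ (q - s) <= `|K| * (e `^ q * (r / e) `^ Num.max s 0).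
Proof.
move=> e0 er; have r0 : 0 < r := lt_trans e0 er.
rewrite -mulrA -powR_pieces//; apply: (@le_trans _ _ (`|K| * (e `^ q * (r / e) `^ s))).
  by rewrite ler_wpM2r ?mulr_ge0 ?powR_ge0// ler_norm.
rewrite ler_wpM2l// ler_wpM2l ?powR_ge0//; apply: ler_powR.
  by rewrite ler_pdivlMr// mul1r ltW.
by rewrite le_max lexx.
Qed.

(** The condition through which all the others are connected. *)
Definition counting_condition := exists g, [/\ 0 <= g, g < n%:R & counting_bound g E].

Lemma sigma_counting s : s < n%:R -> Sigma_condition s E -> counting_condition.
Proof.
move=> sn [K hK]; exists (Num.max s 0); split.
- by rewrite le_max lexx orbT.
- by rewrite gt_max sn ltr0Sn.
apply: (counting_of_tube regular_sigma (ler0n _ _) ES _ (normr_ge0 K)).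
  by rewrite le_max lexx orbT.
move=> x r e Ex r0 e0 er; rewrite -setIA.
apply: le_trans (hK x r e (ES Ex) r0 e0 er) _.
by rewrite lee_fin tube_exponent_max.
Qed.

Lemma counting_dimension : counting_condition -> (upper_dimension E < n%:R%:E)%E.
Proof. by move=> [g [_ gn cg]]; exact: upper_dimension_of_counting cg gn. Qed.

Lemma dimension_counting : (upper_dimension E < n%:R%:E)%E -> counting_condition.
Proof.
apply: (counting_of_upper_dimension ES _ (ltr0Sn _ _)).
exact: (counting_regular regular_sigma (ler0n _ _) ES).
Qed.

Lemma counting_power_integral : counting_condition ->
  exists a K, [/\ 0 < a, 0 < K & forall x r, unit_sphere x -> 0 < r ->
    (\int[sigma]_(z in dball x r `&` unit_sphere) ((dist_set z E)^-1 `^ a)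
     <= (K * r `^ (n%:R - a))%:E)%E].
Proof.
move=> [g [g0 gn cg]]; pose a := (n%:R - g) / 2.
have a0 : 0 < a by rewrite divr_gt0// subr_gt0.
have ag : a < n%:R - g by rewrite /a; move: (n%:R) gn => N gn; lra.
have [K K0 hK] := integral_of_counting regular_sigma (ler0n _ _) ES cg a0 ag.
by exists a, K.
Qed.

Lemma power_log_integral a K : 0 < a -> 0 < K ->
  (forall x r, unit_sphere x -> 0 < r ->
    (\int[sigma]_(z in dball x r `&` unit_sphere) ((dist_set z E)^-1 `^ a)
     <= (K * r `^ (n%:R - a))%:E)%E) ->
  exists K' : R, 0 < K' /\ forall x r, unit_sphere x -> 0 < r ->
    (\int[sigma]_(z in dball x r `&` unit_sphere) lne (dist_set z E)^-1
     <= sigma (dball x r `&` unit_sphere) * (ln r^-1)%:E + (K' * r ^+ n)%:E)%E.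
Proof.
move=> a0 K0 hK; exists (a^-1 * K); split; first by rewrite mulr_gt0 ?invr_gt0.
move=> x r Sx r0; have [_ _ [K1 K10 hK1] _] := regular_sigma.
have := log_le_neg_power (measurable_ball_domain regular_sigma x r)
  (le_lt_trans (hK1 x r Sx r0) (ltry _))
  (fun e => measurable_ball_tube regular_sigma (ler0n _ _) ES x r e)
  (fun z _ => dist_set_ge0 z E) a0 r0 (hK x r Sx r0).
rewrite (_ : a^-1 * r `^ a * (K * r `^ (n%:R - a)) = a^-1 * K * r ^+ n)//.
rewrite -powR_mulrn ?(ltW r0)// powRB; last by apply/implyP => _; rewrite gt_eqF.
by field; rewrite !gt_eqF// powR_gt0.
Qed.

(** If E came within c r of every point of a cap of radius r, the logarithm would
    be at least ln (1/r) + ln (1/c) throughout the cap, which is too much once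
    ln (1/c) exceeds the constant of the integral bound. *)
Lemma log_hole K : 0 < K ->
  (forall x r, unit_sphere x -> 0 < r ->
    (\int[sigma]_(z in dball x r `&` unit_sphere) lne (dist_set z E)^-1
     <= sigma (dball x r `&` unit_sphere) * (ln r^-1)%:E + (K * r ^+ n)%:E)%E) ->
  uniform_hole_condition E.
Proof.
move=> K0 hK; have [_ _ [K1 K10 hK1] [k k0 hk]] := regular_sigma.
have N0 : 0 < K / k + 1 by rewrite addr_gt0// divr_gt0.
pose c := expR (- (K / k + 1)).
have c0 : 0 < c by exact: expR_gt0.
exists c; split=> //; first by rewrite expR_lt1 oppr_lt0.
move=> x r Sx r0 r2; rewrite leNgt; apply/negP => small.
have cr0 : 0 < c * r by exact: mulr_gt0.
set X := dball x r `&` unit_sphere in small.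
have mX : measurable X := measurable_ball_domain regular_sigma x r.
have low : ((ln (c * r)^-1)%:E * sigma X <= \int[sigma]_(z in X) lne (dist_set z E)^-1)%E.
  rewrite -integral_cst//; apply: le_integral_any => z Xz /=.
  have : (dist_set z E < (c * r)%:E)%E.
    by apply: le_lt_trans small; apply: ereal_sup_ubound; exists z.
  have := dist_set_ge0 z E; case: (dist_set z E) => [t| |] //.
  rewrite lee_fin lte_fin le_eqVlt => /predU1P[<-|t0] tr.
    by rewrite inve0 leey.
  rewrite inver gt_eqF// lne_EFin ?invr_gt0// lee_fin ler_ln ?posrE ?invr_gt0//.
  by rewrite lef_pV2 ?posrE// ltW.
have Xk := hk x r Sx r0 r2.
have := le_trans low (hK x r Sx r0); rewrite -/X.
have Xfin : sigma X \is a fin_num.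
  by rewrite ge0_fin_numE// (le_lt_trans (hK1 x r Sx r0) (ltry _)).
move: Xk; rewrite -/X -(fineK Xfin) -!EFinM -EFinD !lee_fin.
move: (fine (sigma X)) => v kv.
have -> : ln (c * r)^-1 = (K / k + 1) + ln r^-1.
  have <- : ln c^-1 = K / k + 1 by rewrite lnV ?posrE// expRK opprK.
  by rewrite invfM lnM ?posrE ?invr_gt0.
rewrite powR_mulrn ?(ltW r0)// in kv.
have rn0 : 0 < r ^+ n by rewrite exprn_gt0.
have v0 : 0 < v by apply: lt_le_trans kv; rewrite mulr_gt0.
have : K / k * (k * r ^+ n) <= K / k * v by rewrite ler_wpM2l// divr_ge0 ?ltW.
have -> : K / k * (k * r ^+ n) = K * r ^+ n by field; rewrite gt_eqF.
by move: (K / k) (ln _) (K * r ^+ n) => A B D; lra.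
Qed.

Lemma counting_volume : counting_condition ->
  exists s K, [/\ s < n%:R, 0 < K & forall x r e, E x -> 0 < r -> 0 < e -> e < r ->
    (volume (dball x r `&` [set z | unit_ball z /\ (dist_set z E < e%:E)%E])
     <= (K * r `^ s * e `^ (n.+1%:R - s))%:E)%E].
Proof.
move=> [g [g0 gn cg]].
have [K K0 hK] := tube_of_counting regular_volume (ler0n _ _) ES cg.
exists g, K; split=> // x r e Ex r0 e0 er.
have := hK x r e (ES Ex) r0 e0 er; rewrite powR_pieces// mulrA.
by rewrite -setIA.
Qed.

Lemma volume_counting s K : s < n%:R ->
  (forall x r e, E x -> 0 < r -> 0 < e -> e < r ->
    (volume (dball x r `&` [set z | unit_ball z /\ (dist_set z E < e%:E)%E])
     <= (K * r `^ s * e `^ (n.+1%:R - s))%:E)%E) -> counting_condition.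
Proof.
move=> sn hK; exists (Num.max s 0); split.
- by rewrite le_max lexx orbT.
- by rewrite gt_max sn ltr0Sn.
apply: (counting_of_tube regular_volume (ler0n _ _) ES _ (normr_ge0 K)).
  by rewrite le_max lexx orbT.
move=> x r e Ex r0 e0 er; rewrite -setIA.
apply: le_trans (hK x r e Ex r0 e0 er) _.
by rewrite lee_fin tube_exponent_max.
Qed.

Lemma counting_volume_integral : counting_condition -> exists a0 : R, 1 < a0 /\
  forall a, 0 < a -> a < a0 -> exists K, 0 < K /\
    forall x r, unit_sphere x -> 0 < r ->
      (\int[volume]_(z in dball x r `&` unit_ball) ((dist_set z E)^-1 `^ a)
       <= (K * r `^ (n.+1%:R - a))%:E)%E.
Proof.
move=> [g [g0 gn cg]]; exists (n.+1%:R - g); split.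
  by rewrite -natr1; move: (n%:R) gn => N gn; lra.
move=> a a0 ag.
have [K K0 hK] := integral_of_counting regular_volume (ler0n _ _) ES cg a0 ag.
by exists K.
Qed.

Lemma volume_integral_counting (a0 : R) : 1 < a0 ->
  (forall a, 0 < a -> a < a0 -> exists K, 0 < K /\
    forall x r, unit_sphere x -> 0 < r ->
      (\int[volume]_(z in dball x r `&` unit_ball) ((dist_set z E)^-1 `^ a)
       <= (K * r `^ (n.+1%:R - a))%:E)%E) -> counting_condition.
Proof.
(* a > 1 gives the exponent n + 1 - a < n; a <= 2 keeps it nonnegative. *)
move=> a01 ha; pose a := Num.min ((1 + a0) / 2) 2.
have a1 : 1 < a by rewrite lt_min ltr1n andbT; lra.
have aa0 : a < a0 by apply: (@le_lt_trans _ _ ((1 + a0) / 2)); [rewrite ge_min lexx|lra].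
have a2 : a <= n.+1%:R.
  by apply: (@le_trans _ _ 2); [rewrite ge_min lexx orbT|rewrite ler_nat].
have a00 : 0 < a := lt_trans ltr01 a1.
have [K [K0 hK]] := ha a a00 aa0.
exists (n.+1%:R - a); split.
- by rewrite subr_ge0.
- by rewrite -natr1; move: (n%:R) a1 => N a1; lra.
exact: (counting_of_integral regular_volume (ler0n _ _) ES a00 a2 (ltW K0) hK).
Qed.

End sphere_and_ball.

Theorem theorem5 (R : realType) (n : nat) (n_ge1 : (1 <= n)%N)
    (E : set (Cn R n)) (E_sphere : E `<=` unit_sphere) (E_closed : closed E) :
  [<->
    uniform_hole_condition E;
    exists s : R, s < n%:R /\ Sigma_condition s E;
    (upper_dimension E < n%:R%:E)%E;
    exists a C : R, [/\ 0 < a, 0 < C &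
      forall (x : Cn R n) (r : R), unit_sphere x -> 0 < r ->
        (\int[sigma]_(z in dball x r `&` unit_sphere) ((dist_set z E)^-1 `^ a)
         <= (C * r `^ (n%:R - a))%:E)%E];
    exists C : R, 0 < C /\
      forall (x : Cn R n) (r : R), unit_sphere x -> 0 < r ->
        (\int[sigma]_(z in dball x r `&` unit_sphere) lne (dist_set z E)^-1
         <= sigma (dball x r `&` unit_sphere) * (ln r^-1)%:E
            + (C * r ^+ n)%:E)%E;
    exists a C : R, [/\ 0 < a, a < n%:R, 0 < C &
      forall (x : Cn R n) (r : R), E x -> 0 < r ->
        (\int[lebesgue_measure]_(t in `]0%R, r[)
            (separated_count E x t (r / t) * (t `^ (n%:R - a) / t)%:E)
         <= (C * r `^ (n%:R - a))%:E)%E];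
    exists s C : R, [/\ s < n%:R, 0 < C &
      forall (x : Cn R n) (r eps : R), E x -> 0 < r -> 0 < eps -> eps < r ->
        (volume (dball x r `&`
                 [set z | unit_ball z /\ (dist_set z E < eps%:E)%E])
         <= (C * r `^ s * eps `^ (n.+1%:R - s))%:E)%E];
    exists a0 : R, 1 < a0 /\
      forall a : R, 0 < a -> a < a0 -> exists C : R, 0 < C /\
        forall (x : Cn R n) (r : R), unit_sphere x -> 0 < r ->
          (\int[volume]_(z in dball x r `&` unit_ball)
              ((dist_set z E)^-1 `^ a)
           <= (C * r `^ (n.+1%:R - a))%:E)%E
  ].
Proof.
case: n n_ge1 E E_sphere E_closed => [//|m] _ E ES _.
have counting_hole : counting_condition E -> uniform_hole_condition E.
  move=> /(counting_power_integral ES)[a [K [a0 K0]]].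
  by move=> /(power_log_integral ES a0 K0)[K' [K'0 /(log_hole K'0)]].
tfae.
- exact: hole_sigma.
- by move=> [s [sn /(sigma_counting ES sn)]]; exact: counting_dimension.
- by move=> /(dimension_counting ES)/(counting_power_integral ES).
- by move=> [a [K [a0 K0]]]; exact: power_log_integral.
- move=> [K [K0 /(log_hole K0)/(hole_sigma ES)[s [sn]]]].
  move=> /(sigma_counting ES sn)[g [g0 gn cg]].
  exact: (integral_count_of_counting g0 gn cg).
- move=> [a [K [a0 an K0 hK]]]; apply: (counting_volume ES).
  exists (m.+1%:R - a); split; first by rewrite subr_ge0 ltW.
    by rewrite ltrBlDr ltrDl.
  exact: (counting_of_integral_count an (ltW K0) hK).
- by move=> [s [K [sn _ hK]]]; exact/(counting_volume_integral ES)/(volume_counting ES sn hK).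
- by move=> [a0 [a01 ha]]; exact/counting_hole/(volume_integral_counting ES a01 ha).
Qed.
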